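(* Let $I=\{e^{it}:a\le t\le b\}$ with $0\le a<b\le 2\pi$, and let $k\in\{0,1,2,\dots\}\cup\{\infty\}$. Then each of the classes $U_2(I,k)$, $U_3(I,k)$, $U_4(I,k)$, $U_5(I,k)$ is a dense $G_\delta$ subset of $C^k(I)$.
   Context: $D=\{|z|<1\}$, $D(z_0,r)$ the open disk of center $z_0$, radius $r$. $C^k(I)$ is the space of $u:I\to\mathbb{C}$ such that $\theta\mapsto u(e^{i\theta})$ is $k$ times continuously differentiable on $[a,b]$ (one-sided at the endpoints), with seminorms $\sup_{\theta\in[a,b]}|\frac{d^l}{d\theta^l}u(e^{i\theta})|$, integers $0\le l\le k$. For $z_0\in I$, $r>0$ let $\Omega(z_0,r)=D(z_0,r)\cap\{|z|>1\}$, $P(z_0,r)=D(z_0,r)\cap D$. $U_2(I,z_0,k)$: the $u\in C^k(I)$ for which there exist no $r>0$ and no continuous $\lambda:I\cup\Omega(z_0,r)\to\mathbb{C}$ holomorphic on $\Omega(z_0,r)$ with $\lambda=u$ on $D(z_0,r)\cap I$. $U_3(I,z_0,k)$: the same with $P(z_0,r)$ instead of $\Omega(z_0,r)$. $U_4(I,z_0,k)=U_2(I,z_0,k)\cap U_3(I,z_0,k)$. $U_5(I,z_0,k)$: the $u\in C^k(I)$ for which there exist no $r>0$ and no holomorphic $F:D(z_0,r)\to\mathbb{C}$ with $F=u$ on $D(z_0,r)\cap I$. $U_j(I,k)=\bigcap_{z_0\in I}U_j(I,z_0,k)$, $j=2,3,4,5$. *)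

(* Defs.v *)
From Stdlib Require Import Reals Lra.
Open Scope R_scope.

Definition C : Type := (R * R)%type.
Definition Cadd (z w : C) : C := (fst z + fst w, snd z + snd w).
Definition Csub (z w : C) : C := (fst z - fst w, snd z - snd w).
Definition Cmul (z w : C) : C :=
  (fst z * fst w - snd z * snd w, fst z * snd w + snd z * fst w).
Definition RtoC (x : R) : C := (x, 0).
Definition Cnorm (z : C) : R := sqrt (fst z * fst z + snd z * snd z).
Definition Cexp_i (t : R) : C := (cos t, sin t).

Definition inD (z0 : C) (r : R) (z : C) : Prop := Cnorm (Csub z z0) < r.
Definition inI (a b : R) (z : C) : Prop := exists t, a <= t <= b /\ z = Cexp_i t.
Definition inOmega (z0 : C) (r : R) (z : C) : Prop := inD z0 r z /\ 1 < Cnorm z.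
Definition inP (z0 : C) (r : R) (z : C) : Prop := inD z0 r z /\ Cnorm z < 1.

Definition cont_on (S : C -> Prop) (f : C -> C) : Prop :=
  forall z, S z -> forall eps, 0 < eps -> exists delta, 0 < delta /\
    forall w, S w -> Cnorm (Csub w z) < delta -> Cnorm (Csub (f w) (f z)) < eps.

Definition holo_on (S : C -> Prop) (f : C -> C) : Prop :=
  forall z, S z -> exists f' : C, forall eps, 0 < eps -> exists delta, 0 < delta /\
    forall w, Cnorm (Csub w z) < delta ->
      Cnorm (Csub (Csub (f w) (f z)) (Cmul f' (Csub w z))) <= eps * Cnorm (Csub w z).

Inductive ext_nat : Type := Fin (n : nat) | Inf.
Definition le_ext (l : nat) (k : ext_nat) : Prop :=
  match k with Fin n => (l <= n)%nat | Inf => True end.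

Definition has_deriv_within (a b : R) (g : R -> C) (x : R) (d : C) : Prop :=
  forall eps, 0 < eps -> exists delta, 0 < delta /\
    forall y, a <= y <= b -> Rabs (y - x) < delta ->
      Cnorm (Csub (Csub (g y) (g x)) (Cmul (RtoC (y - x)) d)) <= eps * Rabs (y - x).

Definition cont_within (a b : R) (g : R -> C) : Prop :=
  forall x, a <= x <= b -> forall eps, 0 < eps -> exists delta, 0 < delta /\
    forall y, a <= y <= b -> Rabs (y - x) < delta -> Cnorm (Csub (g y) (g x)) < eps.

Definition deriv_chain (a b : R) (k : ext_nat) (g : R -> C) (d : nat -> R -> C) : Prop :=
  (forall t, a <= t <= b -> d 0%nat t = g t) /\
  (forall l, le_ext l k -> cont_within a b (d l)) /\
  (forall l, le_ext (S l) k -> forall t, a <= t <= b -> has_deriv_within a b (d l) t (d (S l) t)).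

(** u : I -> C is represented by u : C -> C (values off I are irrelevant);
    u ∈ C^k(I) iff θ ↦ u(e^{iθ}) is C^k on [a,b]. *)
Definition Ck (a b : R) (k : ext_nat) (u : C -> C) : Prop :=
  exists d, deriv_chain a b k (fun t => u (Cexp_i t)) d.

(** v lies in the basic neighbourhood of u given by the seminorms of order
    l <= min(N,k):  sup_{[a,b]} |u^{(l)} - v^{(l)}| <= eps. *)
Definition near (a b : R) (k : ext_nat) (N : nat) (eps : R) (u v : C -> C) : Prop :=
  forall du dv, deriv_chain a b k (fun t => u (Cexp_i t)) du ->
    deriv_chain a b k (fun t => v (Cexp_i t)) dv ->
    forall l, le_ext l k -> (l <= N)%nat ->
      forall t, a <= t <= b -> Cnorm (Csub (du l t) (dv l t)) <= eps.

Definition Ck_open (a b : R) (k : ext_nat) (O : (C -> C) -> Prop) : Prop :=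
  forall u, Ck a b k u -> O u -> exists N eps, 0 < eps /\
    forall v, Ck a b k v -> near a b k N eps u v -> O v.

Definition Ck_dense (a b : R) (k : ext_nat) (A : (C -> C) -> Prop) : Prop :=
  forall u, Ck a b k u -> forall N eps, 0 < eps ->
    exists v, Ck a b k v /\ A v /\ near a b k N eps u v.

Definition Ck_Gdelta (a b : R) (k : ext_nat) (A : (C -> C) -> Prop) : Prop :=
  exists O : nat -> (C -> C) -> Prop, (forall n, Ck_open a b k (O n)) /\
    forall u, Ck a b k u -> (A u <-> forall n, O n u).

Definition dense_Gdelta_in_Ck (a b : R) (k : ext_nat) (A : (C -> C) -> Prop) : Prop :=
  (forall u, A u -> Ck a b k u) /\ Ck_dense a b k A /\ Ck_Gdelta a b k A.

Definition U2_at (a b : R) (z0 : C) (k : ext_nat) (u : C -> C) : Prop :=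
  Ck a b k u /\
  ~ (exists r (lam : C -> C), 0 < r /\
       cont_on (fun z => inI a b z \/ inOmega z0 r z) lam /\
       holo_on (inOmega z0 r) lam /\
       (forall z, inD z0 r z -> inI a b z -> lam z = u z)).

Definition U3_at (a b : R) (z0 : C) (k : ext_nat) (u : C -> C) : Prop :=
  Ck a b k u /\
  ~ (exists r (lam : C -> C), 0 < r /\
       cont_on (fun z => inI a b z \/ inP z0 r z) lam /\
       holo_on (inP z0 r) lam /\
       (forall z, inD z0 r z -> inI a b z -> lam z = u z)).

Definition U4_at (a b : R) (z0 : C) (k : ext_nat) (u : C -> C) : Prop :=
  U2_at a b z0 k u /\ U3_at a b z0 k u.

Definition U5_at (a b : R) (z0 : C) (k : ext_nat) (u : C -> C) : Prop :=
  Ck a b k u /\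
  ~ (exists r (F : C -> C), 0 < r /\
       holo_on (inD z0 r) F /\
       (forall z, inD z0 r z -> inI a b z -> F z = u z)).

Definition U2 a b k u : Prop := Ck a b k u /\ forall z0, inI a b z0 -> U2_at a b z0 k u.
Definition U3 a b k u : Prop := Ck a b k u /\ forall z0, inI a b z0 -> U3_at a b z0 k u.
Definition U4 a b k u : Prop := Ck a b k u /\ forall z0, inI a b z0 -> U4_at a b z0 k u.
Definition U5 a b k u : Prop := Ck a b k u /\ forall z0, inI a b z0 -> U5_at a b z0 k u.

(* Main.v *)
(** For functions extending to one side of the circle near [z0], pass to the
    coordinate [w] with [z = exp (+-w)]: the extension becomes a bounded
    holomorphic function on a rectangle, prescribed on one of its sides.  There
    are countably many choices of rational position, size and bound.  By the
    two-constants theorem, if the boundary values of such extensions converge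
    uniformly, then the extensions converge uniformly on a smaller rectangle, so
    every function in the uniform closure of one of these countably many sets is
    still extendable at the corresponding point.  Hence the complement of each
    class is a countable union of closed sets.

    For density, [f t = sum_n 2^(-n^2) cos (2^n t)] is smooth and extends to
    neither side near any point.  For a given [u] and a given rectangle, at most
    one member of the pencil [u + tau f] extends over that rectangle, so all but
    countably many [tau] give a function which extends nowhere. *)
Require Import Defs.
From Stdlib Require Import Reals Lra Lia Classical ClassicalEpsilon Cantor.
From Coquelicot Require Import Coquelicot.
Open Scope R_scope.

(** * Complex differentiability *)

(** A uniform limit of extensions is controlled only on a rectangle sixteen times smaller, so the
    functions extendable with fixed data are not shown to form a closed set. The closed sets are the
    sup-norm closures of these sets; it is enough that their elements extend over some smaller
    rectangle. The bound belongs to the data because the two-constants estimate depends on it. An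
    extension is merely continuous up to the circle, hence Cauchy's theorem is needed for functions
    that are holomorphic only inside the rectangle. All functions are total, and data given on a
    closed rectangle are made continuous on the plane by composing with a retraction. The
    coefficients 2^(-n^2) are a compromise: they beat every power 2^(-n l), which gives smoothness,
    but for large n they exceed exp (- k 2^n), the decay that a one-sided extension would force on
    them. Density does not use Baire's theorem: a single perturbation works for all four classes,
    and it settles U_5 because a two-sided extension is also a one-sided one. *)

Definition Ccont (f : C -> C) (z : C) : Prop :=
  forall eps, 0 < eps -> exists d, 0 < d /\
    forall w, Cmod (w - z)%C < d -> Cmod (f w - f z)%C < eps.

Lemma Cmod_minus_sym (z w : C) : Cmod (z - w)%C = Cmod (w - z)%C.
Proof. rewrite <- Cmod_opp. f_equal. ring. Qed.

Lemma Cmod_minus_triangle (u v w : C) : Cmod (u - w)%C <= Cmod (u - v)%C + Cmod (v - w)%C.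
Proof. replace (u - w)%C with ((u - v) + (v - w))%C by ring. apply Cmod_triangle. Qed.

Lemma Cmod_le_plus_minus (u v : C) : Cmod u <= Cmod v + Cmod (u - v)%C.
Proof. replace u with (v + (u - v))%C at 1 by ring. apply Cmod_triangle. Qed.

Lemma Cmod_minus_0 (z : C) : Cmod (z - z)%C = 0.
Proof. replace (z - z)%C with (RtoC 0) by ring. apply Cmod_0. Qed.

Lemma Cmod_le_abs (z : C) : Cmod z <= Rabs (fst z) + Rabs (snd z).
Proof.
  destruct z as [x y]; unfold Cmod; simpl fst; simpl snd.
  apply Rle_trans with (sqrt ((Rabs x + Rabs y) ^ 2)).
  - apply sqrt_le_1_alt. rewrite <- (pow2_abs x), <- (pow2_abs y).
    pose proof (Rabs_pos x); pose proof (Rabs_pos y). nra.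
  - rewrite sqrt_pow2. lra. pose proof (Rabs_pos x); pose proof (Rabs_pos y); lra.
Qed.

Lemma abs_fst_le_Cmod (z : C) : Rabs (fst z) <= Cmod z.
Proof. eapply Rle_trans; [ apply Rmax_l | apply Rmax_Cmod ]. Qed.

Lemma abs_snd_le_Cmod (z : C) : Rabs (snd z) <= Cmod z.
Proof. eapply Rle_trans; [ apply Rmax_r | apply Rmax_Cmod ]. Qed.

Lemma Ccont_ext_loc (f g : C -> C) (z : C) (r : R) :
  0 < r -> (forall w, Cmod (w - z)%C < r -> f w = g w) -> Ccont f z -> Ccont g z.
Proof.
  intros Hr Hfg Hf eps Heps. destruct (Hf eps Heps) as [d [Hd Hd']].
  exists (Rmin d r). split. apply Rmin_glb_lt; assumption.
  intros w Hw. rewrite <- !Hfg.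
  - apply Hd'. eapply Rlt_le_trans; [exact Hw | apply Rmin_l].
  - rewrite Cmod_minus_0. assumption.
  - eapply Rlt_le_trans; [exact Hw | apply Rmin_r].
Qed.

Lemma Ccont_const (c z : C) : Ccont (fun _ => c) z.
Proof. intros eps Heps. exists 1. split. lra. intros. rewrite Cmod_minus_0. assumption. Qed.

Lemma Ccont_id (z : C) : Ccont (fun w => w) z.
Proof. intros eps Heps. exists eps. auto. Qed.

Lemma Ccont_comp (f g : C -> C) (z : C) : Ccont f z -> Ccont g (f z) -> Ccont (fun w => g (f w)) z.
Proof.
  intros Hf Hg eps Heps. destruct (Hg eps Heps) as [d [Hd Hd']].
  destruct (Hf d Hd) as [d2 [Hd2 Hd2']]. exists d2. split; auto.
Qed.

Lemma Ccont_plus (f g : C -> C) (z : C) : Ccont f z -> Ccont g z -> Ccont (fun w => f w + g w)%C z.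
Proof.
  intros Hf Hg eps Heps.
  destruct (Hf (eps / 2)) as [d [Hd Hd']]. lra.
  destruct (Hg (eps / 2)) as [d2 [Hd2 Hd2']]. lra.
  exists (Rmin d d2). split. apply Rmin_glb_lt; assumption.
  intros w Hw.
  specialize (Hd' w (Rlt_le_trans _ _ _ Hw (Rmin_l _ _))).
  specialize (Hd2' w (Rlt_le_trans _ _ _ Hw (Rmin_r _ _))).
  replace (f w + g w - (f z + g z))%C with ((f w - f z) + (g w - g z))%C by ring.
  eapply Rle_lt_trans; [apply Cmod_triangle | lra].
Qed.

Lemma Ccont_opp (f : C -> C) (z : C) : Ccont f z -> Ccont (fun w => - f w)%C z.
Proof.
  intros Hf eps Heps. destruct (Hf eps Heps) as [d [Hd Hd']]. exists d; split; auto.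
  intros w Hw. replace (- f w - - f z)%C with (- (f w - f z))%C by ring.
  rewrite Cmod_opp. auto.
Qed.

Lemma Ccont_minus (f g : C -> C) (z : C) : Ccont f z -> Ccont g z -> Ccont (fun w => f w - g w)%C z.
Proof. intros Hf Hg. apply Ccont_plus; auto. apply Ccont_opp; auto. Qed.

Lemma Ccont_mult (f g : C -> C) (z : C) : Ccont f z -> Ccont g z -> Ccont (fun w => f w * g w)%C z.
Proof.
  intros Hf Hg eps Heps.
  pose proof (Cmod_ge_0 (f z)). pose proof (Cmod_ge_0 (g z)).
  set (e := Rmin 1 (eps / (Cmod (f z) + Cmod (g z) + 2))).
  assert (He : 0 < e). { apply Rmin_glb_lt. lra. apply Rdiv_lt_0_compat; lra. }
  assert (He1 : e <= 1) by apply Rmin_l.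
  assert (He2 : e * (Cmod (f z) + Cmod (g z) + 2) <= eps).
  { apply Rle_div_r. lra. apply Rmin_r. }
  destruct (Hf e He) as [d [Hd Hd']].
  destruct (Hg e He) as [d2 [Hd2 Hd2']].
  exists (Rmin d d2). split. apply Rmin_glb_lt; assumption.
  intros w Hw.
  specialize (Hd' w (Rlt_le_trans _ _ _ Hw (Rmin_l _ _))).
  specialize (Hd2' w (Rlt_le_trans _ _ _ Hw (Rmin_r _ _))).
  replace (f w * g w - f z * g z)%C
    with ((f w - f z) * (g w - g z) + (f w - f z) * g z + f z * (g w - g z))%C by ring.
  pose proof (Cmod_ge_0 (f w - f z)%C). pose proof (Cmod_ge_0 (g w - g z)%C).
  eapply Rle_lt_trans; [apply Cmod_triangle |].
  eapply Rle_lt_trans; [apply Rplus_le_compat_r, Cmod_triangle |].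
  rewrite !Cmod_mult. nra.
Qed.

Lemma Ccont_Cinv (c : C) : c <> 0 -> Ccont Cinv c.
Proof.
  intros Hc eps Heps. assert (Hm : 0 < Cmod c) by (apply Cmod_gt_0; auto).
  set (m := Cmod c) in *.
  exists (Rmin (m / 2) (eps * (m * m / 2))).
  split. { apply Rmin_glb_lt. lra. apply Rmult_lt_0_compat; nra. }
  intros w Hw.
  assert (H1 : Cmod (w - c)%C < m / 2) by (eapply Rlt_le_trans; [exact Hw | apply Rmin_l]).
  assert (H2 : Cmod (w - c)%C < eps * (m * m / 2)) by (eapply Rlt_le_trans; [exact Hw | apply Rmin_r]).
  assert (H3 : m / 2 < Cmod w).
  { pose proof (Cmod_le_plus_minus c w) as H. rewrite Cmod_minus_sym in H. fold m in H. lra. }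
  assert (Hw0 : w <> 0). { apply Cmod_gt_0. lra. }
  replace (/ w - / c)%C with ((c - w) / (w * c))%C by (field; split; auto).
  rewrite Cmod_div, Cmod_mult, Cmod_minus_sym by (apply Cmult_neq_0; auto). fold m.
  apply Rlt_div_l. nra.
  eapply Rlt_le_trans; [exact H2|]. apply Rmult_le_compat_l; nra.
Qed.

Lemma Ccont_inv (f : C -> C) (z : C) : Ccont f z -> f z <> 0 -> Ccont (fun w => / f w)%C z.
Proof. intros Hf Hz. apply (Ccont_comp f Cinv); auto. apply Ccont_Cinv; auto. Qed.

Lemma Ccont_pow (f : C -> C) (n : nat) (z : C) : Ccont f z -> Ccont (fun w => f w ^ n)%C z.
Proof.
  intros Hf. induction n as [|n IH]; simpl.
  - apply Ccont_const.
  - apply Ccont_mult; auto.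
Qed.

Lemma Ccont_of_components (f : C -> C) (z : C) :
  continuity_2d_pt (fun x y => fst (f (x, y))) (fst z) (snd z) ->
  continuity_2d_pt (fun x y => snd (f (x, y))) (fst z) (snd z) -> Ccont f z.
Proof.
  intros H1 H2 eps Heps.
  destruct (H1 (mkposreal _ (is_pos_div_2 (mkposreal eps Heps)))) as [d1 Hd1].
  destruct (H2 (mkposreal _ (is_pos_div_2 (mkposreal eps Heps)))) as [d2 Hd2].
  simpl in Hd1, Hd2.
  exists (Rmin d1 d2). split. apply Rmin_glb_lt; [apply d1 | apply d2].
  intros [x y] Hw.
  pose proof (abs_fst_le_Cmod ((x, y) - z)%C) as Hx. pose proof (abs_snd_le_Cmod ((x, y) - z)%C) as Hy.
  destruct z as [zx zy]; simpl in *.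
  pose proof (Rmin_l d1 d2). pose proof (Rmin_r d1 d2).
  assert (A1 := Hd1 x y ltac:(unfold Rminus; lra) ltac:(unfold Rminus; lra)).
  assert (A2 := Hd2 x y ltac:(unfold Rminus; lra) ltac:(unfold Rminus; lra)).
  eapply Rle_lt_trans; [apply Cmod_le_abs |]. simpl. unfold Rminus in *. lra.
Qed.

Lemma Ccont_fst (f : C -> C) (z : C) :
  Ccont f z -> continuity_2d_pt (fun x y => fst (f (x, y))) (fst z) (snd z).
Proof.
  intros H eps. destruct (H eps (cond_pos eps)) as [d [Hd Hd']].
  exists (mkposreal _ (is_pos_div_2 (mkposreal d Hd))). simpl. intros u v Hu Hv.
  destruct z as [x y]; simpl in *.
  eapply Rle_lt_trans; [apply (abs_fst_le_Cmod (f (u, v) - f (x, y))%C)|].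
  apply Hd'. eapply Rle_lt_trans; [apply Cmod_le_abs|]. simpl. unfold Rminus in *. lra.
Qed.

Lemma Ccont_snd (f : C -> C) (z : C) :
  Ccont f z -> continuity_2d_pt (fun x y => snd (f (x, y))) (fst z) (snd z).
Proof.
  intros H eps. destruct (H eps (cond_pos eps)) as [d [Hd Hd']].
  exists (mkposreal _ (is_pos_div_2 (mkposreal d Hd))). simpl. intros u v Hu Hv.
  destruct z as [x y]; simpl in *.
  eapply Rle_lt_trans; [apply (abs_snd_le_Cmod (f (u, v) - f (x, y))%C)|].
  apply Hd'. eapply Rle_lt_trans; [apply Cmod_le_abs|]. simpl. unfold Rminus in *. lra.
Qed.

(** Carathéodory's form of complex differentiability: the rules of
    differentiation reduce to continuity, and [phi] itself is the difference
    quotient needed in Cauchy's integral formula. *)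
Definition holo (f : C -> C) (z : C) : Prop :=
  exists phi : C -> C, Ccont phi z /\ forall w, f w = (f z + phi w * (w - z))%C.

Lemma caratheodory (f : C -> C) (z f' : C) :
  (forall eps, 0 < eps -> exists d, 0 < d /\ forall w, Cmod (w - z)%C < d ->
      Cmod (f w - f z - f' * (w - z))%C <= eps * Cmod (w - z)%C) ->
  exists phi : C -> C, phi z = f' /\ Ccont phi z /\ forall w, f w = (f z + phi w * (w - z))%C.
Proof.
  intros H.
  exists (fun w => if excluded_middle_informative (w = z) then f' else ((f w - f z) / (w - z))%C).
  split; [|split].
  - destruct (excluded_middle_informative (z = z)) as [_|n]; [reflexivity | congruence].
  - intros eps Heps. destruct (H (eps / 2)) as [d [Hd Hd']]. lra.
    exists d. split; auto. intros w Hw.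
    destruct (excluded_middle_informative (z = z)) as [_|n]; [|congruence].
    destruct (excluded_middle_informative (w = z)) as [e|n].
    + rewrite Cmod_minus_0. assumption.
    + assert (Hwz : (w - z)%C <> 0). { intro E. apply n. apply Ceq_minus; auto. }
      replace ((f w - f z) / (w - z) - f')%C with ((f w - f z - f' * (w - z)) / (w - z))%C by (field; auto).
      rewrite Cmod_div by auto. assert (0 < Cmod (w - z)%C) by (apply Cmod_gt_0; auto).
      apply Rlt_div_l; auto. specialize (Hd' w Hw). nra.
  - intros w. destruct (excluded_middle_informative (w = z)) as [e|n].
    + subst. ring.
    + field. intro E. apply n. apply Ceq_minus; auto.
Qed.

Lemma holo_of_deriv (f : C -> C) (z f' : C) :
  (forall eps, 0 < eps -> exists d, 0 < d /\ forall w, Cmod (w - z)%C < d ->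
      Cmod (f w - f z - f' * (w - z))%C <= eps * Cmod (w - z)%C) -> holo f z.
Proof. intros H. destruct (caratheodory f z f' H) as (phi & _ & Hphi). exists phi. exact Hphi. Qed.

Lemma deriv_of_holo (f : C -> C) (z : C) : holo f z -> exists f', 
  forall eps, 0 < eps -> exists d, 0 < d /\ forall w, Cmod (w - z)%C < d ->
      Cmod (f w - f z - f' * (w - z))%C <= eps * Cmod (w - z)%C.
Proof.
  intros [phi [Hc H]]. exists (phi z). intros eps Heps.
  destruct (Hc eps Heps) as [d [Hd Hd']]. exists d; split; auto. intros w Hw.
  rewrite (H w). replace (f z + phi w * (w - z) - f z - phi z * (w - z))%C with ((phi w - phi z) * (w - z))%C by ring.
  rewrite Cmod_mult. apply Rmult_le_compat_r. apply Cmod_ge_0. left; auto.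
Qed.

Lemma holo_ext_loc (f g : C -> C) (z : C) (r : R) :
  0 < r -> (forall w, Cmod (w - z)%C < r -> f w = g w) -> holo f z -> holo g z.
Proof.
  intros Hr Hfg Hf. destruct (deriv_of_holo f z Hf) as [f' Hf'].
  apply (holo_of_deriv g z f'). intros eps Heps.
  destruct (Hf' eps Heps) as [d [Hd Hd']]. exists (Rmin d r).
  split. apply Rmin_glb_lt; assumption.
  intros w Hw. rewrite <- !Hfg.
  - apply Hd'. eapply Rlt_le_trans; [exact Hw | apply Rmin_l].
  - rewrite Cmod_minus_0. assumption.
  - eapply Rlt_le_trans; [exact Hw | apply Rmin_r].
Qed.

Lemma holo_Ccont (f : C -> C) (z : C) : holo f z -> Ccont f z.
Proof.
  intros [phi [Hc H]].
  apply (Ccont_ext_loc (fun w => f z + phi w * (w - z))%C f z 1). lra.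
  - intros; symmetry; auto.
  - apply Ccont_plus. apply Ccont_const. apply Ccont_mult; auto.
    apply Ccont_minus. apply Ccont_id. apply Ccont_const.
Qed.

Lemma holo_const (c z : C) : holo (fun _ => c) z.
Proof. exists (fun _ => RtoC 0). split. apply Ccont_const. intros; ring. Qed.

Lemma holo_id (z : C) : holo (fun w => w) z.
Proof. exists (fun _ => RtoC 1). split. apply Ccont_const. intros; ring. Qed.

Lemma holo_plus (f g : C -> C) (z : C) : holo f z -> holo g z -> holo (fun w => f w + g w)%C z.
Proof.
  intros [p [Hp Hf]] [q [Hq Hg]]. exists (fun w => p w + q w)%C. split.
  apply Ccont_plus; auto. intros w. rewrite (Hf w), (Hg w). ring.
Qed.

Lemma holo_opp (f : C -> C) (z : C) : holo f z -> holo (fun w => - f w)%C z.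
Proof.
  intros [p [Hp Hf]]. exists (fun w => - p w)%C. split.
  apply Ccont_opp; auto. intros w. rewrite (Hf w). ring.
Qed.

Lemma holo_minus (f g : C -> C) (z : C) : holo f z -> holo g z -> holo (fun w => f w - g w)%C z.
Proof. intros Hf Hg. apply holo_plus; auto. apply holo_opp; auto. Qed.

Lemma holo_mult (f g : C -> C) (z : C) : holo f z -> holo g z -> holo (fun w => f w * g w)%C z.
Proof.
  intros Hf0 Hg0. pose proof (holo_Ccont _ _ Hg0) as Hgc.
  destruct Hf0 as [p [Hp Hf]]; destruct Hg0 as [q [Hq Hg]].
  exists (fun w => p w * g w + f z * q w)%C. split.
  - apply Ccont_plus; apply Ccont_mult; auto. apply Ccont_const.
  - intros w. rewrite (Hf w).
    replace (f z * g z)%C with (f z * (g w - q w * (w - z)))%C by (rewrite (Hg w); ring). ring.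
Qed.

Lemma holo_comp (f g : C -> C) (z : C) : holo f z -> holo g (f z) -> holo (fun w => g (f w)) z.
Proof.
  intros Hf0 [q [Hq Hg]]. pose proof (holo_Ccont _ _ Hf0) as Hfc. destruct Hf0 as [p [Hp Hf]].
  exists (fun w => q (f w) * p w)%C. split.
  - apply Ccont_mult; auto. apply (Ccont_comp f q); auto.
  - intros w. rewrite (Hg (f w)). rewrite (Hf w) at 2. ring.
Qed.

Lemma holo_Cinv (c : C) : c <> 0 -> holo Cinv c.
Proof.
  (* This identity for 1/w exhibits the difference quotient. It may fail at w = 0, where [/ w] is a
     default value; the radius |c| excludes that point. *)
  intros Hc. apply (holo_ext_loc (fun w => / c + (- / w * / c) * (w - c))%C _ c (Cmod c)).
  - apply Cmod_gt_0; auto.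
  - intros w Hw. field. split; auto. intros E. subst w.
    rewrite Cmod_minus_sym in Hw. replace (c - 0)%C with c in Hw by ring. lra.
  - exists (fun w => - / w * / c)%C. split.
    + apply Ccont_mult. apply Ccont_opp. apply Ccont_Cinv; auto. apply Ccont_const.
    + intros w. ring.
Qed.

Lemma holo_inv (f : C -> C) (z : C) : holo f z -> f z <> 0 -> holo (fun w => / f w)%C z.
Proof. intros Hf Hz. apply (holo_comp f Cinv); auto. apply holo_Cinv; auto. Qed.

Lemma holo_pow (f : C -> C) (n : nat) (z : C) : holo f z -> holo (fun w => f w ^ n)%C z.
Proof.
  intros Hf. induction n as [|n IH]; simpl.
  - apply holo_const.
  - apply holo_mult; auto.
Qed.

(** * Integrals along rectangles *)

Definition Cex_RInt (g : R -> C) (a b : R) : Prop :=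
  ex_RInt (fun t => fst (g t)) a b /\ ex_RInt (fun t => snd (g t)) a b.

Definition CInt (g : R -> C) (a b : R) : C :=
  (RInt (fun t => fst (g t)) a b, RInt (fun t => snd (g t)) a b).

Lemma Cex_RInt_cont (g : R -> C) (a b : R) : a <= b ->
  (forall t, a <= t <= b -> forall eps, 0 < eps -> exists d, 0 < d /\
     forall s, Rabs (s - t) < d -> Cmod (g s - g t)%C < eps) ->
  Cex_RInt g a b.
Proof.
  intros Hab H.
  split; apply (ex_RInt_continuous (V := R_CompleteNormedModule));
    rewrite Rmin_left, Rmax_right by assumption; intros t Ht;
    apply filterlim_locally; intros eps; destruct (H t Ht eps (cond_pos eps)) as [d [Hd Hd']];
    exists (mkposreal d Hd); intros s Hs.
  - eapply Rle_lt_trans; [apply (abs_fst_le_Cmod (g s - g t)%C) | apply Hd'; exact Hs].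
  - eapply Rle_lt_trans; [apply (abs_snd_le_Cmod (g s - g t)%C) | apply Hd'; exact Hs].
Qed.

Lemma CInt_ext (f g : R -> C) (a b : R) : a <= b ->
  (forall t, a <= t <= b -> f t = g t) -> CInt f a b = CInt g a b.
Proof.
  intros Hab H. unfold CInt. f_equal; apply RInt_ext;
  rewrite Rmin_left, Rmax_right by assumption; intros t Ht; rewrite H; auto; lra.
Qed.

Lemma CInt_Chasles (f : R -> C) (a b c : R) : Cex_RInt f a b -> Cex_RInt f b c ->
  (CInt f a b + CInt f b c)%C = CInt f a c.
Proof.
  intros [H1 H2] [H3 H4]. unfold CInt, Cplus; simpl.
  f_equal; apply (RInt_Chasles (V := R_CompleteNormedModule)); assumption.
Qed.

Lemma CInt_minus (f g : R -> C) (a b : R) : Cex_RInt f a b -> Cex_RInt g a b ->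
  CInt (fun t => f t - g t)%C a b = (CInt f a b - CInt g a b)%C.
Proof.
  intros [H1 H2] [H3 H4]. unfold CInt, Cminus, Cplus, Copp; simpl.
  f_equal.
  - apply (RInt_minus (V := R_CompleteNormedModule) (fun t => fst (f t)) (fun t => fst (g t))); assumption.
  - apply (RInt_minus (V := R_CompleteNormedModule) (fun t => snd (f t)) (fun t => snd (g t))); assumption.
Qed.

Lemma CInt_scal (c : C) (f : R -> C) (a b : R) : Cex_RInt f a b ->
  CInt (fun t => c * f t)%C a b = (c * CInt f a b)%C.
Proof.
  intros [H1 H2]. unfold CInt, Cmult; simpl. f_equal.
  - etransitivity.
    apply (RInt_minus (V := R_CompleteNormedModule) (fun t => fst c * fst (f t)) (fun t => snd c * snd (f t)));
    apply (ex_RInt_scal (V := R_NormedModule)); assumption.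
    unfold minus, plus, opp; simpl. unfold Rminus.
    f_equal; [|f_equal]; apply (RInt_scal (V := R_CompleteNormedModule)); assumption.
  - etransitivity.
    apply (RInt_plus (V := R_CompleteNormedModule) (fun t => fst c * snd (f t)) (fun t => snd c * fst (f t)));
    apply (ex_RInt_scal (V := R_NormedModule)); assumption.
    unfold plus; simpl.
    f_equal; apply (RInt_scal (V := R_CompleteNormedModule)); assumption.
Qed.

(** The factor 2 comes from estimating real and imaginary parts separately. Every later use
    tolerates a constant factor. *)
Lemma CInt_bound (f : R -> C) (a b M : R) : a <= b -> Cex_RInt f a b ->
  (forall t, a <= t <= b -> Cmod (f t) <= M) -> Cmod (CInt f a b) <= 2 * (b - a) * M.
Proof.
  intros Hab [H1 H2] H.
  eapply Rle_trans; [apply Cmod_le_abs|]. unfold CInt; simpl.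
  assert (A1 : Rabs (RInt (fun t => fst (f t)) a b) <= (b - a) * M).
  { apply abs_RInt_le_const; auto. intros t Ht.
    eapply Rle_trans; [apply abs_fst_le_Cmod | auto]. }
  assert (A2 : Rabs (RInt (fun t => snd (f t)) a b) <= (b - a) * M).
  { apply abs_RInt_le_const; auto. intros t Ht.
    eapply Rle_trans; [apply abs_snd_le_Cmod | auto]. }
  lra.
Qed.

Definition in_rect (x1 x2 y1 y2 : R) (z : C) : Prop :=
  x1 <= fst z <= x2 /\ y1 <= snd z <= y2.
Definition in_open_rect (x1 x2 y1 y2 : R) (z : C) : Prop :=
  x1 < fst z < x2 /\ y1 < snd z < y2.
Definition in_frame (x1 x2 y1 y2 : R) (z : C) : Prop :=
  in_rect x1 x2 y1 y2 z /\ (fst z = x1 \/ fst z = x2 \/ snd z = y1 \/ snd z = y2).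

Definition rect_int (f : C -> C) (x1 x2 y1 y2 : R) : C :=
  (CInt (fun x => f (x, y1)) x1 x2 + Ci * CInt (fun y => f (x2, y)) y1 y2
   - CInt (fun x => f (x, y2)) x1 x2 - Ci * CInt (fun y => f (x1, y)) y1 y2)%C.

Definition rect_integrable (f : C -> C) (x1 x2 y1 y2 : R) : Prop :=
  Cex_RInt (fun x => f (x, y1)) x1 x2 /\ Cex_RInt (fun y => f (x2, y)) y1 y2 /\
  Cex_RInt (fun x => f (x, y2)) x1 x2 /\ Cex_RInt (fun y => f (x1, y)) y1 y2.

Lemma Cex_RInt_hor (f : C -> C) (a b y : R) : a <= b ->
  (forall x, a <= x <= b -> Ccont f (x, y)) -> Cex_RInt (fun x => f (x, y)) a b.
Proof.
  intros Hab H. apply Cex_RInt_cont; auto. intros t Ht eps Heps.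
  destruct (H t Ht eps Heps) as [d [Hd Hd']]. exists d. split; auto. intros s Hs.
  apply Hd'. eapply Rle_lt_trans; [apply Cmod_le_abs|]. simpl.
  replace (y + - y) with 0 by ring. rewrite Rabs_R0. unfold Rminus in Hs. lra.
Qed.

Lemma Cex_RInt_ver (f : C -> C) (a b x : R) : a <= b ->
  (forall y, a <= y <= b -> Ccont f (x, y)) -> Cex_RInt (fun y => f (x, y)) a b.
Proof.
  intros Hab H. apply Cex_RInt_cont; auto. intros t Ht eps Heps.
  destruct (H t Ht eps Heps) as [d [Hd Hd']]. exists d. split; auto. intros s Hs.
  apply Hd'. eapply Rle_lt_trans; [apply Cmod_le_abs|]. simpl.
  replace (x + - x) with 0 by ring. rewrite Rabs_R0. unfold Rminus in Hs. lra.
Qed.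

Lemma rect_integrable_cont (f : C -> C) (x1 x2 y1 y2 : R) : x1 <= x2 -> y1 <= y2 ->
  (forall z, in_frame x1 x2 y1 y2 z -> Ccont f z) -> rect_integrable f x1 x2 y1 y2.
Proof.
  intros Hx Hy H.
  assert (K : forall x y, x1 <= x <= x2 -> y1 <= y <= y2 -> (x = x1 \/ x = x2 \/ y = y1 \/ y = y2) ->
    Ccont f (x, y)) by (intros; apply H; unfold in_frame, in_rect; auto).
  split; [|split; [|split]].
  - apply Cex_RInt_hor; auto. intros t Ht. apply K; auto; lra.
  - apply Cex_RInt_ver; auto. intros t Ht. apply K; auto; lra.
  - apply Cex_RInt_hor; auto. intros t Ht. apply K; auto; lra.
  - apply Cex_RInt_ver; auto. intros t Ht. apply K; auto; lra.
Qed.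

Lemma rect_int_ext (f g : C -> C) (x1 x2 y1 y2 : R) : x1 <= x2 -> y1 <= y2 ->
  (forall z, in_frame x1 x2 y1 y2 z -> f z = g z) -> rect_int f x1 x2 y1 y2 = rect_int g x1 x2 y1 y2.
Proof.
  intros Hx Hy H. unfold rect_int.
  rewrite (CInt_ext (fun x => f (x, y1)) (fun x => g (x, y1))),
    (CInt_ext (fun x => f (x, y2)) (fun x => g (x, y2))),
    (CInt_ext (fun y => f (x1, y)) (fun y => g (x1, y))),
    (CInt_ext (fun y => f (x2, y)) (fun y => g (x2, y))); auto;
  intros t Ht; apply H; unfold in_frame, in_rect; simpl; lra.
Qed.

Lemma rect_int_minus (f g : C -> C) (x1 x2 y1 y2 : R) :
  rect_integrable f x1 x2 y1 y2 -> rect_integrable g x1 x2 y1 y2 ->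
  rect_int (fun z => f z - g z)%C x1 x2 y1 y2 = (rect_int f x1 x2 y1 y2 - rect_int g x1 x2 y1 y2)%C.
Proof.
  intros (F1 & F2 & F3 & F4) (G1 & G2 & G3 & G4). unfold rect_int.
  rewrite (CInt_minus (fun x => f (x, y1)) (fun x => g (x, y1))),
    (CInt_minus (fun x => f (x, y2)) (fun x => g (x, y2))),
    (CInt_minus (fun y => f (x1, y)) (fun y => g (x1, y))),
    (CInt_minus (fun y => f (x2, y)) (fun y => g (x2, y))); auto.
  ring.
Qed.

Lemma rect_int_scal (c : C) (f : C -> C) (x1 x2 y1 y2 : R) :
  rect_integrable f x1 x2 y1 y2 ->
  rect_int (fun z => c * f z)%C x1 x2 y1 y2 = (c * rect_int f x1 x2 y1 y2)%C.
Proof.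
  intros (F1 & F2 & F3 & F4). unfold rect_int.
  rewrite (CInt_scal c (fun x => f (x, y1))),
    (CInt_scal c (fun x => f (x, y2))),
    (CInt_scal c (fun y => f (x1, y))),
    (CInt_scal c (fun y => f (x2, y))); auto.
  ring.
Qed.

Lemma rect_int_bound (f : C -> C) (x1 x2 y1 y2 M : R) : x1 <= x2 -> y1 <= y2 ->
  rect_integrable f x1 x2 y1 y2 ->
  (forall z, in_frame x1 x2 y1 y2 z -> Cmod (f z) <= M) ->
  Cmod (rect_int f x1 x2 y1 y2) <= 4 * ((x2 - x1) + (y2 - y1)) * M.
Proof.
  intros Hx Hy (F1 & F2 & F3 & F4) H. unfold rect_int.
  assert (A1 := CInt_bound (fun x => f (x, y1)) x1 x2 M Hx F1
    ltac:(intros t Ht; apply H; unfold in_frame, in_rect; simpl; lra)).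
  assert (A2 := CInt_bound (fun y => f (x2, y)) y1 y2 M Hy F2
    ltac:(intros t Ht; apply H; unfold in_frame, in_rect; simpl; lra)).
  assert (A3 := CInt_bound (fun x => f (x, y2)) x1 x2 M Hx F3
    ltac:(intros t Ht; apply H; unfold in_frame, in_rect; simpl; lra)).
  assert (A4 := CInt_bound (fun y => f (x1, y)) y1 y2 M Hy F4
    ltac:(intros t Ht; apply H; unfold in_frame, in_rect; simpl; lra)).
  unfold Cminus.
  eapply Rle_trans; [apply Cmod_triangle|].
  eapply Rle_trans; [apply Rplus_le_compat_r, Cmod_triangle|].
  eapply Rle_trans; [apply Rplus_le_compat_r, Rplus_le_compat_r, Cmod_triangle|].
  rewrite !Cmod_opp, !Cmod_mult, !Cmod_Ci. lra.
Qed.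

Lemma rect_int_split_x (f : C -> C) (x1 x2 x3 y1 y2 : R) :
  rect_integrable f x1 x2 y1 y2 -> rect_integrable f x2 x3 y1 y2 ->
  rect_int f x1 x3 y1 y2 = (rect_int f x1 x2 y1 y2 + rect_int f x2 x3 y1 y2)%C.
Proof.
  intros (F1 & F2 & F3 & F4) (G1 & G2 & G3 & G4). unfold rect_int.
  rewrite <- (CInt_Chasles (fun x => f (x, y1)) x1 x2 x3), <- (CInt_Chasles (fun x => f (x, y2)) x1 x2 x3); auto.
  ring.
Qed.

Lemma rect_int_split_y (f : C -> C) (x1 x2 y1 y2 y3 : R) :
  rect_integrable f x1 x2 y1 y2 -> rect_integrable f x1 x2 y2 y3 ->
  rect_int f x1 x2 y1 y3 = (rect_int f x1 x2 y1 y2 + rect_int f x1 x2 y2 y3)%C.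
Proof.
  intros (F1 & F2 & F3 & F4) (G1 & G2 & G3 & G4). unfold rect_int.
  rewrite <- (CInt_Chasles (fun y => f (x1, y)) y1 y2 y3), <- (CInt_Chasles (fun y => f (x2, y)) y1 y2 y3); auto.
  ring.
Qed.

Lemma RInt_affine (p q a b : R) : RInt (fun x => p * x + q) a b = p * (b ^ 2 - a ^ 2) / 2 + q * (b - a).
Proof.
  apply is_RInt_unique.
  replace (p * (b ^ 2 - a ^ 2) / 2 + q * (b - a))
    with (minus (p * b ^ 2 / 2 + q * b) (p * a ^ 2 / 2 + q * a)) by (unfold minus, plus, opp; simpl; field).
  apply (is_RInt_derive (V := R_CompleteNormedModule) (fun x => p * x ^ 2 / 2 + q * x)).
  - intros x _. auto_derive; auto. field.
  - intros x _. apply continuity_pt_filterlim. apply derivable_continuous_pt. apply ex_derive_Reals_0. auto_derive. auto.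
Qed.

(** Explicit primitives settle this case; in [goursat] the affine approximation at the limit point
    can therefore be subtracted for free. *)
Lemma rect_int_affine (c d : C) (x1 x2 y1 y2 : R) :
  rect_int (fun z => c + d * z)%C x1 x2 y1 y2 = RtoC 0.
Proof.
  destruct c as [c1 c2]; destruct d as [d1 d2].
  unfold rect_int, CInt; simpl.
  assert (E : forall p q f a b, (forall x : R, f x = p * x + q) -> RInt f a b = p * (b ^ 2 - a ^ 2) / 2 + q * (b - a)).
  { intros p q f a b H. rewrite <- RInt_affine. apply RInt_ext. intros; apply H. }
  rewrite (E d1 (c1 - d2 * y1) (fun x => c1 + (d1 * x - d2 * y1))) by (intros; ring).
  rewrite (E d2 (c2 + d1 * y1) (fun x => c2 + (d1 * y1 + d2 * x))) by (intros; ring).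
  rewrite (E d1 (c1 - d2 * y2) (fun x => c1 + (d1 * x - d2 * y2))) by (intros; ring).
  rewrite (E d2 (c2 + d1 * y2) (fun x => c2 + (d1 * y2 + d2 * x))) by (intros; ring).
  rewrite (E (- d2) (c1 + d1 * x1) (fun y => c1 + (d1 * x1 - d2 * y))) by (intros; ring).
  rewrite (E d1 (c2 + d2 * x1) (fun y => c2 + (d1 * y + d2 * x1))) by (intros; ring).
  rewrite (E (- d2) (c1 + d1 * x2) (fun y => c1 + (d1 * x2 - d2 * y))) by (intros; ring).
  rewrite (E d1 (c2 + d2 * x2) (fun y => c2 + (d1 * y + d2 * x2))) by (intros; ring).
  unfold Ci, Cminus, Cplus, Copp, Cmult, RtoC; simpl. f_equal; field.
Qed.

(** * Cauchy's theorem *)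

(** Serves twice: for the point to which Goursat's rectangles shrink and for the choice of the
    parameter of the pencil. *)
Lemma nested_intervals (a b : nat -> R) :
  (forall n, a n <= a (S n)) -> (forall n, b (S n) <= b n) -> (forall n, a n <= b n) ->
  exists x, forall n, a n <= x <= b n.
Proof.
  intros Ha Hb Hab.
  assert (Ha' : forall n k, a n <= a (n + k)%nat).
  { intros n k. induction k. rewrite Nat.add_0_r; lra. rewrite Nat.add_succ_r. specialize (Ha (n + k)%nat). lra. }
  assert (Hb' : forall n k, b (n + k)%nat <= b n).
  { intros n k. induction k. rewrite Nat.add_0_r; lra. rewrite Nat.add_succ_r. specialize (Hb (n + k)%nat). lra. }
  assert (H : forall m n, a m <= b n).
  { intros m n. specialize (Ha' m n). specialize (Hb' n m). specialize (Hab (m + n)%nat).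
    rewrite Nat.add_comm in Hb'. lra. }
  destruct (completeness (fun x => exists n, x = a n)) as [x [Hx1 Hx2]].
  - exists (b O). intros y [n ->]. apply H.
  - exists (a O). exists O. reflexivity.
  - exists x. intros n. split.
    + apply Hx1. exists n. reflexivity.
    + apply Hx2. intros y [m ->]. apply H.
Qed.

(** The integral is the sum of those over the four quarters, so they cannot all be smaller than k /
    4 in modulus. *)
Lemma rect_int_quarter (f : C -> C) (x y w h k : R) : 0 <= w -> 0 <= h -> (forall z, Ccont f z) ->
  k <= Cmod (rect_int f x (x + w) y (y + h)) ->
  exists x' y', (x' = x \/ x' = x + w / 2) /\ (y' = y \/ y' = y + h / 2) /\
    k / 4 <= Cmod (rect_int f x' (x' + w / 2) y' (y' + h / 2)).
Proof.
  intros Hw Hh Hf Hk. apply NNPP. intros Hn.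
  assert (A : forall x' y', (x' = x \/ x' = x + w / 2) -> (y' = y \/ y' = y + h / 2) ->
    Cmod (rect_int f x' (x' + w / 2) y' (y' + h / 2)) < k / 4).
  { intros x' y' H1 H2. apply Rnot_le_lt. intros H3. apply Hn. exists x', y'. auto. }
  assert (I : forall a b c d, a <= b -> c <= d -> rect_integrable f a b c d)
    by (intros; apply rect_integrable_cont; auto).
  rewrite (rect_int_split_x f x (x + w / 2) (x + w)) in Hk by (apply I; lra).
  rewrite (rect_int_split_y f x (x + w / 2) y (y + h / 2) (y + h)) in Hk by (apply I; lra).
  rewrite (rect_int_split_y f (x + w / 2) (x + w) y (y + h / 2) (y + h)) in Hk by (apply I; lra).
  pose proof (A x y (or_introl eq_refl) (or_introl eq_refl)) as B1.
  pose proof (A x _ (or_introl eq_refl) (or_intror eq_refl)) as B2.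
  pose proof (A _ y (or_intror eq_refl) (or_introl eq_refl)) as B3.
  pose proof (A _ _ (or_intror eq_refl) (or_intror eq_refl)) as B4.
  replace (x + w / 2 + w / 2) with (x + w) in * by field.
  replace (y + h / 2 + h / 2) with (y + h) in * by field.
  match type of Hk with _ <= Cmod (?a + ?b + (?c + ?d))%C =>
    pose proof (Cmod_triangle (a + b)%C (c + d)%C); pose proof (Cmod_triangle a b); pose proof (Cmod_triangle c d) end.
  lra.
Qed.

Lemma goursat (f : C -> C) (x1 x2 y1 y2 : R) : x1 < x2 -> y1 < y2 ->
  (forall z, Ccont f z) -> (forall z, in_rect x1 x2 y1 y2 z -> holo f z) ->
  rect_int f x1 x2 y1 y2 = RtoC 0.
Proof.
  intros Hx Hy Hc Hh. apply Cmod_eq_0.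
  destruct (Rle_lt_or_eq_dec _ _ (Cmod_ge_0 (rect_int f x1 x2 y1 y2))) as [HK|HK]; [exfalso|auto].
  set (K := Cmod (rect_int f x1 x2 y1 y2)) in *.
  set (W := x2 - x1). set (H := y2 - y1).
  assert (HW : 0 < W) by (unfold W; lra). assert (HH : 0 < H) by (unfold H; lra).
  set (Inv := fun (n : nat) (p : R * R) =>
    K / 4 ^ n <= Cmod (rect_int f (fst p) (fst p + W / 2 ^ n) (snd p) (snd p + H / 2 ^ n))).
  set (Nest := fun (n : nat) (p q : R * R) =>
    (fst p <= fst q /\ fst q + W / 2 ^ (S n) <= fst p + W / 2 ^ n) /\
    (snd p <= snd q /\ snd q + H / 2 ^ (S n) <= snd p + H / 2 ^ n)).
  assert (P2 : forall n, 0 < 2 ^ n) by (intros; apply pow_lt; lra).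
  assert (P4 : forall n, 0 < 4 ^ n) by (intros; apply pow_lt; lra).
  assert (S2 : forall n c, c / 2 ^ (S n) = c / 2 ^ n / 2).
  { intros n c. simpl. specialize (P2 n). field. lra. }
  assert (S4 : forall n c, c / 4 ^ (S n) = c / 4 ^ n / 4).
  { intros n c. simpl. specialize (P4 n). field. lra. }
  (* The invariant stands under the existential, so that choice yields a step function defined on
     all corners. *)
  assert (Step : forall n p, exists q, Inv n p -> Inv (S n) q /\ Nest n p q).
  { intros n p. destruct (classic (Inv n p)) as [Hp|Hp]; [|exists p; intros; contradiction].
    assert (0 < W / 2 ^ n) by (apply Rdiv_lt_0_compat; auto).
    assert (0 < H / 2 ^ n) by (apply Rdiv_lt_0_compat; auto).
    destruct (rect_int_quarter f (fst p) (snd p) (W / 2 ^ n) (H / 2 ^ n) (K / 4 ^ n)) as (x' & y' & Ex & Ey & Hq); auto; try lra.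
    exists (x', y'). intros _. unfold Inv, Nest; simpl fst; simpl snd. rewrite !S2, S4.
    split. exact Hq. destruct Ex, Ey; lra. }
  set (next := fun n p => proj1_sig (constructive_indefinite_description _ (Step n p))).
  assert (Hnext : forall n p, Inv n p -> Inv (S n) (next n p) /\ Nest n p (next n p))
    by (intros n p; unfold next; exact (proj2_sig (constructive_indefinite_description _ (Step n p)))).
  set (P := fix P n := match n with O => (x1, y1) | S m => next m (P m) end).
  assert (HP : forall n, Inv n (P n)).
  { induction n as [|n IH]; [|apply Hnext; auto].
    unfold Inv; simpl. rewrite !Rdiv_1_r. unfold W, H.
    replace (x1 + (x2 - x1)) with x2 by ring. replace (y1 + (y2 - y1)) with y2 by ring. fold K. lra. }
  assert (HN : forall n, Nest n (P n) (P (S n))) by (intros n; apply (Hnext n (P n)); auto).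
  assert (Q2 : forall n c, 0 < c -> 0 < c / 2 ^ n) by (intros; apply Rdiv_lt_0_compat; auto).
  destruct (nested_intervals (fun n => fst (P n)) (fun n => fst (P n) + W / 2 ^ n)) as [X HX].
  { intros n; apply HN. } { intros n; apply HN. } { intros n; simpl. specialize (Q2 n W HW). lra. }
  destruct (nested_intervals (fun n => snd (P n)) (fun n => snd (P n) + H / 2 ^ n)) as [Y HY].
  { intros n; apply HN. } { intros n; apply HN. } { intros n; simpl. specialize (Q2 n H HH). lra. }
  destruct (Hh (X, Y)) as [phi [Hphi Ef]].
  { specialize (HX O). specialize (HY O). simpl in HX, HY. rewrite Rdiv_1_r in *.
    unfold W, H in *. unfold in_rect; simpl; lra. }
  set (L := W + H) in *. assert (HL : 0 < L) by (unfold L; lra).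
  (* With this value the final bound 4 (L / 2^n) (e L / 2^n) is half of K / 4^n, which the invariant
     forbids. *)
  set (e := K / (8 * L ^ 2)).
  assert (HL2 : 0 < L ^ 2) by (apply pow_lt; auto).
  assert (He : 0 < e) by (apply Rdiv_lt_0_compat; lra).
  destruct (Hphi e He) as [d [Hd Hd']].
  destruct (pow_lt_1_zero (/ 2)) with (y := d / L) as [n Hn].
  { rewrite Rabs_pos_eq; lra. } { apply Rdiv_lt_0_compat; auto. }
  specialize (Hn n (le_n n)). rewrite Rabs_pos_eq in Hn by (apply pow_le; lra).
  assert (HLd : L / 2 ^ n < d).
  { rewrite pow_inv in Hn. apply (Rmult_lt_compat_l L) in Hn; auto.
    unfold Rdiv. replace d with (L * (d / L)) by (field; lra). exact Hn. }
  specialize (HP n). specialize (HX n). specialize (HY n). simpl in HX, HY. unfold Inv in HP.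
  set (xa := fst (P n)) in *. set (ya := snd (P n)) in *.
  pose proof (Q2 n W HW) as HWn. pose proof (Q2 n H HH) as HHn.
  assert (ELn : L / 2 ^ n = W / 2 ^ n + H / 2 ^ n) by (unfold L, Rdiv; ring).
  (* Tangent map of [f] at the limit point; what remains of [f] is (phi w - phi z)(w - z), where z =
     (X, Y). *)
  set (aff := fun w : C => ((f (X, Y) - phi (X, Y) * (X, Y)) + phi (X, Y) * w)%C).
  assert (Caff : forall z, Ccont aff z).
  { intros z. apply Ccont_plus. apply Ccont_const. apply Ccont_mult. apply Ccont_const. apply Ccont_id. }
  assert (EJ : rect_int f xa (xa + W / 2 ^ n) ya (ya + H / 2 ^ n) =
    rect_int (fun w => f w - aff w)%C xa (xa + W / 2 ^ n) ya (ya + H / 2 ^ n)).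
  { rewrite rect_int_minus by (apply rect_integrable_cont; auto; lra).
    unfold aff. rewrite rect_int_affine. ring. }
  assert (B : Cmod (rect_int (fun w => f w - aff w)%C xa (xa + W / 2 ^ n) ya (ya + H / 2 ^ n))
    <= 4 * (W / 2 ^ n + H / 2 ^ n) * (e * (L / 2 ^ n))).
  { replace (W / 2 ^ n + H / 2 ^ n) with ((xa + W / 2 ^ n - xa) + (ya + H / 2 ^ n - ya)) by ring.
    apply rect_int_bound; try lra.
    - apply rect_integrable_cont; try lra. intros z _. apply Ccont_minus; auto.
    - intros w [[Hwx Hwy] _].
      assert (Dw : Cmod (w - (X, Y))%C <= L / 2 ^ n).
      { eapply Rle_trans; [apply Cmod_le_abs|]. rewrite ELn. simpl.
        apply Rplus_le_compat; apply Rabs_le; lra. }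
      rewrite (Ef w). unfold aff.
      replace (f (X, Y) + phi w * (w - (X, Y)) - (f (X, Y) - phi (X, Y) * (X, Y) + phi (X, Y) * w))%C
        with ((phi w - phi (X, Y)) * (w - (X, Y)))%C by ring.
      rewrite Cmod_mult. apply Rmult_le_compat; try apply Cmod_ge_0; auto.
      left. apply Hd'. lra. }
  rewrite EJ in HP. rewrite <- ELn in B.
  assert (E4 : 4 * (L / 2 ^ n) * (e * (L / 2 ^ n)) = K / 4 ^ n / 2).
  { unfold e. replace (4 ^ n) with (2 ^ n * 2 ^ n).
    2:{ rewrite <- Rpow_mult_distr. f_equal. }
    specialize (P2 n). field. split; lra. }
  assert (0 < K / 4 ^ n) by (apply Rdiv_lt_0_compat; auto). lra.
Qed.

Lemma unif_cont_rect (f : C -> C) (x1 x2 y1 y2 : R) : (forall z, Ccont f z) ->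
  forall eps, 0 < eps -> exists d, 0 < d /\ forall z w,
    in_rect x1 x2 y1 y2 z -> in_rect x1 x2 y1 y2 w ->
    Cmod (w - z)%C < d -> Cmod (f w - f z)%C < eps.
Proof.
  intros Hf eps Heps.
  assert (He : 0 < eps / 2) by lra.
  destruct (uniform_continuity_2d (fun x y => fst (f (x, y))) x1 x2 y1 y2) with (eps := mkposreal _ He) as [d1 Hd1].
  { intros x y _ _. apply (Ccont_fst f (x, y)). auto. }
  destruct (uniform_continuity_2d (fun x y => snd (f (x, y))) x1 x2 y1 y2) with (eps := mkposreal _ He) as [d2 Hd2].
  { intros x y _ _. apply (Ccont_snd f (x, y)). auto. }
  simpl in Hd1, Hd2.
  exists (Rmin d1 d2). split. apply Rmin_glb_lt; [apply d1|apply d2].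
  intros [zx zy] [wx wy] [Hz1 Hz2] [Hw1 Hw2] Hw; simpl in *.
  pose proof (abs_fst_le_Cmod ((wx, wy) - (zx, zy))%C) as A1.
  pose proof (abs_snd_le_Cmod ((wx, wy) - (zx, zy))%C) as A2. simpl in A1, A2.
  pose proof (Rmin_l d1 d2). pose proof (Rmin_r d1 d2).
  eapply Rle_lt_trans; [apply Cmod_le_abs|]. simpl.
  assert (B1 := Hd1 zx zy wx wy ltac:(auto) ltac:(auto) ltac:(auto) ltac:(auto) ltac:(unfold Rminus; lra) ltac:(unfold Rminus; lra)).
  assert (B2 := Hd2 zx zy wx wy ltac:(auto) ltac:(auto) ltac:(auto) ltac:(auto) ltac:(unfold Rminus; lra) ltac:(unfold Rminus; lra)).
  unfold Rminus in *. lra.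
Qed.

(** A slight contraction towards the centre sends the closed rectangle into the open one, so
    [goursat] applies to the contracted function. By uniform continuity its integral is as close as
    desired to that of [f]. *)
Lemma cauchy_rect (f : C -> C) (x1 x2 y1 y2 : R) : x1 < x2 -> y1 < y2 ->
  (forall z, Ccont f z) -> (forall z, in_open_rect x1 x2 y1 y2 z -> holo f z) ->
  rect_int f x1 x2 y1 y2 = RtoC 0.
Proof.
  intros Hx Hy Hc Hh. apply Cmod_eq_0.
  destruct (Rle_lt_or_eq_dec _ _ (Cmod_ge_0 (rect_int f x1 x2 y1 y2))) as [HK|HK]; [exfalso|auto].
  set (K := Cmod (rect_int f x1 x2 y1 y2)) in *.
  set (L := (x2 - x1) + (y2 - y1)). assert (HL : 0 < L) by (unfold L; lra).
  set (e := K / (8 * L)). assert (He : 0 < e) by (apply Rdiv_lt_0_compat; lra).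
  destruct (unif_cont_rect f x1 x2 y1 y2 Hc e He) as [d [Hd Hd']].
  (* The contraction moves each point by at most t L <= d / 2, within the modulus of continuity
     [d]. *)
  set (t := Rmin (/ 2) (d / (2 * L))).
  assert (Ht : 0 < t) by (apply Rmin_glb_lt; [lra | apply Rdiv_lt_0_compat; lra]).
  assert (Ht1 : t <= / 2) by apply Rmin_l.
  assert (Ht2 : t * L <= d / 2).
  { replace (d / 2) with (d / (2 * L) * L) by (field; lra). apply Rmult_le_compat_r. lra. apply Rmin_r. }
  set (c := (((x1 + x2) / 2, (y1 + y2) / 2)) : C).
  set (sh := fun z : C => (c + RtoC (1 - t) * (z - c))%C).
  assert (Csh : forall z, holo sh z).
  { intros z. apply holo_plus. apply holo_const. apply holo_mult. apply holo_const.
    apply holo_minus. apply holo_id. apply holo_const. }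
  assert (Esh : forall z, sh z = ((x1 + x2) / 2 + (1 - t) * (fst z - (x1 + x2) / 2),
                                 (y1 + y2) / 2 + (1 - t) * (snd z - (y1 + y2) / 2))).
  { intros [a b]. unfold sh, c, Cplus, Cmult, Cminus, Copp, Cplus, RtoC; simpl. f_equal; ring. }
  assert (J0 : rect_int (fun z => f (sh z)) x1 x2 y1 y2 = RtoC 0).
  { apply goursat; auto.
    - intros z. apply (Ccont_comp sh f); auto. apply holo_Ccont; auto.
    - intros z [Hz1 Hz2]. apply (holo_comp sh f); auto. apply Hh. rewrite Esh. split; simpl; nra. }
  assert (E : rect_int f x1 x2 y1 y2 = rect_int (fun z => f z - f (sh z))%C x1 x2 y1 y2).
  { rewrite rect_int_minus. rewrite J0. ring.
    apply rect_integrable_cont; auto; lra. apply rect_integrable_cont; auto; try lra.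
    intros z _. apply (Ccont_comp sh f); auto. apply holo_Ccont; auto. }
  assert (B : Cmod (rect_int (fun z => f z - f (sh z))%C x1 x2 y1 y2) <= 4 * L * e).
  { apply rect_int_bound; try lra.
    - apply rect_integrable_cont; try lra. intros z _. apply Ccont_minus; auto.
      apply (Ccont_comp sh f); auto. apply holo_Ccont; auto.
    - intros z [[Hz1 Hz2] _]. left. apply Hd'.
      + rewrite Esh. split; simpl; nra.
      + split; auto.
      + eapply Rle_lt_trans; [apply Cmod_le_abs|]. rewrite Esh. simpl.
        apply Rle_lt_trans with (t * (x2 - x1) + t * (y2 - y1)).
        * apply Rplus_le_compat; apply Rabs_le; nra.
        * rewrite <- Rmult_plus_distr_l. fold L. lra. }
  rewrite <- E in B. fold K in B. replace (4 * L * e) with (K / 2) in B by (unfold e; field; lra). lra.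
Qed.

(** * Cauchy's formula and the maximum principle *)

Lemma in_open_rect_ball (x1 x2 y1 y2 : R) (z : C) : in_open_rect x1 x2 y1 y2 z ->
  exists r, 0 < r /\ forall w, Cmod (w - z)%C < r -> in_open_rect x1 x2 y1 y2 w.
Proof.
  intros [[Hz1 Hz2] [Hz3 Hz4]].
  exists (Rmin (Rmin (fst z - x1) (x2 - fst z)) (Rmin (snd z - y1) (y2 - snd z))).
  split. { repeat apply Rmin_glb_lt; lra. }
  intros w Hw.
  apply Rmin_Rgt in Hw. destruct Hw as [Hw1 Hw2]. apply Rmin_Rgt in Hw1, Hw2.
  pose proof (abs_fst_le_Cmod (w - z)%C) as A1. pose proof (abs_snd_le_Cmod (w - z)%C) as A2.
  simpl in A1, A2. apply Rabs_le_between in A1, A2. split; lra.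
Qed.

Lemma in_frame_dist (x1 x2 y1 y2 : R) (z : C) : in_open_rect x1 x2 y1 y2 z ->
  exists rho, 0 < rho /\ forall w, in_frame x1 x2 y1 y2 w -> rho <= Cmod (w - z)%C.
Proof.
  intros [[Hz1 Hz2] [Hz3 Hz4]].
  exists (Rmin (Rmin (fst z - x1) (x2 - fst z)) (Rmin (snd z - y1) (y2 - snd z))).
  split. { repeat apply Rmin_glb_lt; lra. }
  intros w [_ Hw].
  pose proof (abs_fst_le_Cmod (w - z)%C) as A1. pose proof (abs_snd_le_Cmod (w - z)%C) as A2.
  simpl in A1, A2.
  pose proof (Rmin_l (Rmin (fst z - x1) (x2 - fst z)) (Rmin (snd z - y1) (y2 - snd z))).
  pose proof (Rmin_r (Rmin (fst z - x1) (x2 - fst z)) (Rmin (snd z - y1) (y2 - snd z))).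
  pose proof (Rmin_l (fst z - x1) (x2 - fst z)). pose proof (Rmin_r (fst z - x1) (x2 - fst z)).
  pose proof (Rmin_l (snd z - y1) (y2 - snd z)). pose proof (Rmin_r (snd z - y1) (y2 - snd z)).
  revert A1 A2. unfold Rabs.
  destruct (Rcase_abs (fst w + - fst z)), (Rcase_abs (snd w + - snd z)); intros; lra.
Qed.

Lemma in_frame_neq (x1 x2 y1 y2 : R) (z w : C) :
  in_open_rect x1 x2 y1 y2 z -> in_frame x1 x2 y1 y2 w -> (w - z)%C <> 0.
Proof.
  intros Hz Hw E. destruct (in_frame_dist _ _ _ _ _ Hz) as [r [Hr H]].
  specialize (H w Hw). rewrite E, Cmod_0 in H. lra.
Qed.

Lemma Ccont_inv_sub (z w : C) : (w - z)%C <> 0 -> Ccont (fun u => / (u - z))%C w.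
Proof.
  intros H. apply (Ccont_inv (fun u => u - z)%C); auto.
  apply Ccont_minus. apply Ccont_id. apply Ccont_const.
Qed.

Lemma holo_inv_sub (z w : C) : (w - z)%C <> 0 -> holo (fun u => / (u - z))%C w.
Proof.
  intros H. apply (holo_inv (fun u => u - z)%C); auto.
  apply holo_minus. apply holo_id. apply holo_const.
Qed.

Lemma Cneq_minus (z w : C) : w <> z -> (w - z)%C <> 0.
Proof. intros H E. apply H. apply Ceq_minus; auto. Qed.

(** The Carathéodory quotient of [f] at z is continuous everywhere and holomorphic inside except
    perhaps at z. The two lines through z cut the rectangle into four open ones that miss z, so
    Cauchy's theorem applies to each. The integral of 1/(w - z) remains as a factor: its value is
    never computed, only shown to be nonzero. *)
Lemma cauchy_formula (f : C -> C) (x1 x2 y1 y2 : R) (z : C) :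
  (forall w, Ccont f w) -> (forall w, in_open_rect x1 x2 y1 y2 w -> holo f w) ->
  in_open_rect x1 x2 y1 y2 z ->
  rect_int (fun w => f w * / (w - z))%C x1 x2 y1 y2 =
  (f z * rect_int (fun w => / (w - z))%C x1 x2 y1 y2)%C.
Proof.
  intros Hc Hh Hz. destruct (Hh z Hz) as [phi [Cphi Ephi]].
  assert (E : forall w, w <> z -> phi w = ((f w - f z) * / (w - z))%C).
  { intros w Hw. rewrite (Ephi w). field. apply Cneq_minus; auto. }
  assert (Loc : forall w, w <> z -> 0 < Cmod (w - z)%C /\
    forall u, Cmod (u - w)%C < Cmod (w - z)%C -> ((f u - f z) * / (u - z))%C = phi u).
  { intros w Hw. split. apply Cmod_gt_0; apply Cneq_minus; auto.
    intros u Hu. rewrite E; auto. intros ->. rewrite Cmod_minus_sym in Hu. lra. }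
  assert (Hcphi : forall w, Ccont phi w).
  { intros w. destruct (classic (w = z)) as [->|Hw]; auto.
    destruct (Loc w Hw) as [Hr Hloc]. apply (Ccont_ext_loc _ _ w _ Hr Hloc).
    apply Ccont_mult. apply Ccont_minus; auto. apply Ccont_const.
    apply Ccont_inv_sub, Cneq_minus; auto. }
  assert (Hhphi : forall w, in_open_rect x1 x2 y1 y2 w -> w <> z -> holo phi w).
  { intros w Hwr Hw. destruct (Loc w Hw) as [Hr Hloc]. apply (holo_ext_loc _ _ w _ Hr Hloc).
    apply holo_mult. apply holo_minus; auto. apply holo_const.
    apply holo_inv_sub, Cneq_minus; auto. }
  assert (J0 : rect_int phi x1 x2 y1 y2 = RtoC 0).
  { destruct Hz as [[Hz1 Hz2] [Hz3 Hz4]].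
    rewrite (rect_int_split_x phi x1 (fst z) x2) by (apply rect_integrable_cont; auto; lra).
    rewrite (rect_int_split_y phi x1 (fst z) y1 (snd z) y2) by (apply rect_integrable_cont; auto; lra).
    rewrite (rect_int_split_y phi (fst z) x2 y1 (snd z) y2) by (apply rect_integrable_cont; auto; lra).
    rewrite !cauchy_rect; auto; try lra; try ring;
    intros w [[Hw1 Hw2] [Hw3 Hw4]]; (apply Hhphi; [split; split; lra | intros ->; lra]). }
  assert (Hx : x1 <= x2) by (destruct Hz; lra). assert (Hy : y1 <= y2) by (destruct Hz; lra).
  assert (Fr : forall w, in_frame x1 x2 y1 y2 w -> w <> z).
  { intros w Hw ->. apply (in_frame_neq x1 x2 y1 y2 z z Hz Hw). ring. }
  rewrite <- rect_int_scal.
  2:{ apply rect_integrable_cont; auto. intros w Hw. apply Ccont_inv_sub, Cneq_minus; auto. }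
  apply Ceq_minus. rewrite <- rect_int_minus.
  - rewrite <- J0. apply rect_int_ext; auto. intros w Hw. rewrite E by auto. ring.
  - apply rect_integrable_cont; auto. intros w Hw. apply Ccont_mult; auto. apply Ccont_inv_sub, Cneq_minus; auto.
  - apply rect_integrable_cont; auto. intros w Hw. apply Ccont_mult; auto. apply Ccont_const. apply Ccont_inv_sub, Cneq_minus; auto.
Qed.

Lemma RInt_pos_cont (g : R -> R) (a b : R) : a < b -> (forall t, a <= t <= b -> 0 < g t) ->
  (forall t, a <= t <= b -> ex_derive g t) -> 0 < RInt g a b.
Proof.
  intros Hab Hg Hd. apply RInt_gt_0; auto.
  - intros; apply Hg; lra.
  - intros t Ht. apply (ex_derive_continuous (V := R_NormedModule)). apply Hd; auto.
Qed.

(** The imaginary part is a sum of four positive integrals, one for each side, since z lies strictly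
    to the left of every oriented side. *)
Lemma winding_neq_0 (x1 x2 y1 y2 : R) (z : C) : in_open_rect x1 x2 y1 y2 z ->
  rect_int (fun w => / (w - z))%C x1 x2 y1 y2 <> 0.
Proof.
  destruct z as [p q]. intros [[Hz1 Hz2] [Hz3 Hz4]] E. simpl in *.
  apply (f_equal snd) in E. revert E. unfold rect_int, CInt; simpl.
  rewrite !Rmult_1_r, !Rmult_0_l, !Rplus_0_l, !Rmult_1_l.
  assert (D : forall a b : R, a < 0 \/ 0 < a -> 0 < a * (a * 1) + b * (b * 1)) by (intros a b [?|?]; nra).
  assert (D' : forall a b : R, b < 0 \/ 0 < b -> 0 < a * (a * 1) + b * (b * 1)) by (intros a b [?|?]; nra).
  assert (A1 : 0 < RInt (fun t => - (y1 + - q) / ((t + - p) * ((t + - p) * 1) + (y1 + - q) * ((y1 + - q) * 1))) x1 x2).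
  { apply RInt_pos_cont; try lra.
    - intros t _. apply Rdiv_lt_0_compat; [lra | apply D'; lra].
    - intros t _. auto_derive. apply Rgt_not_eq, D'. lra. }
  assert (A2 : 0 < RInt (fun t => (x2 + - p) / ((x2 + - p) * ((x2 + - p) * 1) + (t + - q) * ((t + - q) * 1))) y1 y2).
  { apply RInt_pos_cont; try lra.
    - intros t _. apply Rdiv_lt_0_compat; [lra | apply D; lra].
    - intros t _. auto_derive. apply Rgt_not_eq, D. lra. }
  assert (A3 : 0 < RInt (fun t => - (- (y2 + - q) / ((t + - p) * ((t + - p) * 1) + (y2 + - q) * ((y2 + - q) * 1)))) x1 x2).
  { apply RInt_pos_cont; try lra.
    - intros t _. rewrite <- Ropp_div. apply Rdiv_lt_0_compat; [lra | apply D'; lra].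
    - intros t _. auto_derive. apply Rgt_not_eq, D'. lra. }
  assert (A4 : 0 < RInt (fun t => - ((x1 + - p) / ((x1 + - p) * ((x1 + - p) * 1) + (t + - q) * ((t + - q) * 1)))) y1 y2).
  { apply RInt_pos_cont; try lra.
    - intros t _. rewrite <- Ropp_div. apply Rdiv_lt_0_compat; [lra | apply D; lra].
    - intros t _. auto_derive. apply Rgt_not_eq, D. lra. }
  rewrite (RInt_opp (V := R_CompleteNormedModule)) in A3, A4.
  2:{ apply (ex_RInt_continuous (V := R_CompleteNormedModule)). intros t _. apply (ex_derive_continuous (V := R_NormedModule)). auto_derive. apply Rgt_not_eq, D. lra. }
  2:{ apply (ex_RInt_continuous (V := R_CompleteNormedModule)). intros t _. apply (ex_derive_continuous (V := R_NormedModule)). auto_derive. apply Rgt_not_eq, D'. lra. }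
  unfold opp in A3, A4; simpl in A3, A4. rewrite !Rmult_1_r in *.
  intros E.
  repeat match goal with H : context [RInt ?g ?a ?b] |- _ => generalize dependent (RInt g a b); intros end.
  lra.
Qed.

Lemma max_modulus_interior (f : C -> C) (x1 x2 y1 y2 m : R) (z : C) : 0 < m ->
  (forall w, Ccont f w) -> (forall w, in_open_rect x1 x2 y1 y2 w -> holo f w) ->
  (forall w, in_frame x1 x2 y1 y2 w -> Cmod (f w) <= m) ->
  in_open_rect x1 x2 y1 y2 z -> Cmod (f z) <= m.
Proof.
  intros Hm Hc Hh Hb Hz. apply Rnot_lt_le. intros Hlt.
  destruct (in_frame_dist _ _ _ _ _ Hz) as [rho [Hrho Hd]].
  pose proof (proj1 (Cmod_gt_0 _) (winding_neq_0 _ _ _ _ _ Hz)) as Hk.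
  set (k := Cmod (rect_int (fun w => / (w - z))%C x1 x2 y1 y2)) in *.
  assert (Hx : x1 <= x2) by (destruct Hz; lra). assert (Hy : y1 <= y2) by (destruct Hz; lra).
  set (P := 4 * ((x2 - x1) + (y2 - y1)) / rho).
  (* Cauchy's formula for the powers of [f] loses only a constant factor,
     which disappears when the [n]-th root is taken. *)
  assert (B : forall n, Cmod (f z) ^ n * k <= P * m ^ n).
  { intros n. pose proof (cauchy_formula (fun w => f w ^ n)%C x1 x2 y1 y2 z) as CF.
    unfold k. rewrite <- Cmod_pow, <- Cmod_mult, <- CF; auto.
    - replace (P * m ^ n) with (4 * ((x2 - x1) + (y2 - y1)) * (m ^ n * / rho)) by (unfold P, Rdiv; ring).
      apply rect_int_bound; auto.
      + apply rect_integrable_cont; auto. intros w Hw. apply Ccont_mult. apply Ccont_pow; auto.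
        apply Ccont_inv_sub. apply (in_frame_neq x1 x2 y1 y2); auto.
      + intros w Hw. rewrite Cmod_mult, Cmod_pow, Cmod_inv by (apply (in_frame_neq x1 x2 y1 y2); auto).
        apply Rmult_le_compat.
        * apply pow_le, Cmod_ge_0.
        * left. apply Rinv_0_lt_compat. specialize (Hd w Hw). lra.
        * apply pow_incr. split. apply Cmod_ge_0. auto.
        * apply Rinv_le_contravar; auto.
    - intros w. apply Ccont_pow; auto.
    - intros w Hw. apply holo_pow; auto. }
  destruct (Pow_x_infinity (Cmod (f z) / m)) with (b := P / k + 1) as [n Hn].
  { rewrite Rabs_pos_eq. apply Rlt_gt. apply (Rmult_lt_reg_r m); auto. unfold Rdiv. rewrite Rmult_assoc, Rinv_l; lra.
    apply Rdiv_le_0_compat. apply Cmod_ge_0. auto. }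
  specialize (Hn n (le_n n)). specialize (B n).
  rewrite Rabs_pos_eq in Hn by (apply pow_le, Rdiv_le_0_compat; [apply Cmod_ge_0 | auto]).
  assert (Hmn : 0 < m ^ n) by (apply pow_lt; auto).
  assert (E : Cmod (f z) ^ n = (Cmod (f z) / m) ^ n * m ^ n).
  { rewrite <- Rpow_mult_distr. f_equal. field. lra. }
  rewrite E in B.
  assert ((Cmod (f z) / m) ^ n * k <= P) by nra.
  assert ((P / k + 1) * k <= P) by nra.
  replace ((P / k + 1) * k) with (P + k) in H0 by (field; lra). lra.
Qed.

Lemma max_modulus (f : C -> C) (x1 x2 y1 y2 m : R) (z : C) :
  (forall w, Ccont f w) -> (forall w, in_open_rect x1 x2 y1 y2 w -> holo f w) ->
  (forall w, in_frame x1 x2 y1 y2 w -> Cmod (f w) <= m) ->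
  in_rect x1 x2 y1 y2 z -> Cmod (f z) <= m.
Proof.
  intros Hc Hh Hb Hz.
  destruct (classic (in_frame x1 x2 y1 y2 z)) as [Hf|Hf]; auto.
  assert (Hz' : in_open_rect x1 x2 y1 y2 z).
  { unfold in_frame, in_rect, in_open_rect in *. destruct Hz as [[A B] [D E]].
    assert (fst z <> x1) by tauto. assert (fst z <> x2) by tauto. assert (snd z <> y1) by tauto.
    assert (snd z <> y2) by tauto. lra. }
  assert (Hm : 0 <= m).
  { eapply Rle_trans; [apply Cmod_ge_0|]. apply (Hb (x1, y1)). unfold in_frame, in_rect; simpl. destruct Hz; lra. }
  apply Rnot_lt_le. intros Hlt.
  apply (Rlt_irrefl (Cmod (f z))).
  (* The midpoint is positive even if m = 0, as the interior version requires, and still smaller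
     than |f z|. *)
  apply Rle_lt_trans with ((m + Cmod (f z)) / 2); [|lra].
  apply (max_modulus_interior f x1 x2 y1 y2); auto. lra.
  intros w Hw. specialize (Hb w Hw). lra.
Qed.

(** Only continuity of [f] enters. The derivative is the integral of f(w)/(w - z)^2, because 1/(w -
    u) - 1/(w - z) - (u - z)/(w - z)^2 equals (u - z)^2 / ((w - u)(w - z)^2), which is quadratic in
    u - z. *)
Lemma holo_cauchy_integral (f : C -> C) (x1 x2 y1 y2 M : R) (z : C) :
  (forall w, Ccont f w) -> (forall w, in_frame x1 x2 y1 y2 w -> Cmod (f w) <= M) ->
  in_open_rect x1 x2 y1 y2 z ->
  holo (fun u => rect_int (fun w => f w * / (w - u))%C x1 x2 y1 y2) z.
Proof.
  intros Hc Hb Hz.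
  destruct (in_frame_dist _ _ _ _ _ Hz) as [rho [Hrho Hd]].
  assert (Hx : x1 <= x2) by (destruct Hz; lra). assert (Hy : y1 <= y2) by (destruct Hz; lra).
  assert (HM : 0 <= M).
  { eapply Rle_trans; [apply Cmod_ge_0|]. apply (Hb (x1, y1)). unfold in_frame, in_rect; simpl. lra. }
  set (P := 4 * ((x2 - x1) + (y2 - y1))). assert (HP : 0 <= P) by (unfold P; lra).
  apply (holo_of_deriv _ z (rect_int (fun w => f w * (/ (w - z) * / (w - z)))%C x1 x2 y1 y2)).
  intros eps Heps. set (A := P * (M * (2 / (rho * rho * rho)))).
  assert (Hr3 : 0 < rho * rho * rho) by (repeat apply Rmult_lt_0_compat; auto).
  assert (HA : 0 <= A).
  { repeat apply Rmult_le_pos; auto; try lra. left. apply Rinv_0_lt_compat; auto. }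
  (* Within rho / 2 of z, the point u keeps distance at least rho / 2 from the frame; this gives the
     factor 2 / rho^3 in [A]. *)
  exists (Rmin (rho / 2) (eps / (A + 1))). split.
  { apply Rmin_glb_lt. lra. apply Rdiv_lt_0_compat; lra. }
  intros u Hu.
  assert (Hu1 : Cmod (u - z)%C < rho / 2) by (eapply Rlt_le_trans; [exact Hu | apply Rmin_l]).
  assert (Hu2 : Cmod (u - z)%C * (A + 1) <= eps).
  { apply Rle_div_r. lra. left. eapply Rlt_le_trans; [exact Hu | apply Rmin_r]. }
  assert (Du : forall w, in_frame x1 x2 y1 y2 w -> rho / 2 <= Cmod (w - u)%C).
  { intros w Hw. specialize (Hd w Hw). pose proof (Cmod_minus_triangle w u z). lra. }
  assert (Nz : forall w, in_frame x1 x2 y1 y2 w -> (w - z)%C <> 0).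
  { intros w Hw. apply (in_frame_neq x1 x2 y1 y2); auto. }
  assert (Nu : forall w, in_frame x1 x2 y1 y2 w -> (w - u)%C <> 0).
  { intros w Hw. apply Cmod_gt_0. specialize (Du w Hw). lra. }
  assert (I1 : rect_integrable (fun w => f w * / (w - u))%C x1 x2 y1 y2).
  { apply rect_integrable_cont; auto. intros w Hw. apply Ccont_mult; auto. apply Ccont_inv_sub; auto. }
  assert (I2 : rect_integrable (fun w => f w * / (w - z))%C x1 x2 y1 y2).
  { apply rect_integrable_cont; auto. intros w Hw. apply Ccont_mult; auto. apply Ccont_inv_sub; auto. }
  assert (C3 : forall w, in_frame x1 x2 y1 y2 w -> Ccont (fun w => f w * (/ (w - z) * / (w - z)))%C w).
  { intros w Hw. apply Ccont_mult; auto. apply Ccont_mult; apply Ccont_inv_sub; auto. }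
  assert (I3 : rect_integrable (fun w => f w * (/ (w - z) * / (w - z)))%C x1 x2 y1 y2)
    by (apply rect_integrable_cont; auto).
  rewrite <- rect_int_minus by auto.
  rewrite (Cmult_comm _ (u - z)%C), <- rect_int_scal by auto.
  assert (I12 : rect_integrable (fun w => f w * / (w - u) - f w * / (w - z))%C x1 x2 y1 y2).
  { apply rect_integrable_cont; auto. intros w Hw. apply Ccont_minus; apply Ccont_mult; auto; apply Ccont_inv_sub; auto. }
  assert (C3' : forall w, in_frame x1 x2 y1 y2 w -> Ccont (fun w => (u - z) * (f w * (/ (w - z) * / (w - z))))%C w).
  { intros w Hw. apply (Ccont_mult (fun _ => (u - z)%C)). apply Ccont_const. auto. }
  assert (I3' : rect_integrable (fun w => (u - z) * (f w * (/ (w - z) * / (w - z))))%C x1 x2 y1 y2)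
    by (apply rect_integrable_cont; auto).
  rewrite <- rect_int_minus by auto.
  assert (B : Cmod (rect_int (fun w => f w * / (w - u) - f w * / (w - z) - (u - z) * (f w * (/ (w - z) * / (w - z))))%C x1 x2 y1 y2)
    <= P * (M * (Cmod (u - z)%C * Cmod (u - z)%C * (2 / (rho * rho * rho))))).
  { apply rect_int_bound; auto.
    - apply rect_integrable_cont; auto. intros w Hw. apply Ccont_minus; auto.
      apply Ccont_minus; apply Ccont_mult; auto; apply Ccont_inv_sub; auto.
    - intros w Hw. pose proof (Nz w Hw). pose proof (Nu w Hw).
      replace (f w * / (w - u) - f w * / (w - z) - (u - z) * (f w * (/ (w - z) * / (w - z))))%C
        with (f w * ((u - z) * (u - z) * / ((w - u) * (w - z) * (w - z))))%C by (field; split; auto).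
      rewrite Cmod_mult. apply Rmult_le_compat; auto; try apply Cmod_ge_0.
      rewrite !Cmod_mult. apply Rmult_le_compat_l. apply Rmult_le_pos; apply Cmod_ge_0.
      rewrite Cmod_inv by (repeat apply Cmult_neq_0; auto). rewrite !Cmod_mult.
      replace (2 / (rho * rho * rho)) with (/ (rho / 2 * rho * rho)) by (field; lra).
      specialize (Du w Hw). specialize (Hd w Hw).
      apply Rinv_le_contravar.
      + repeat apply Rmult_lt_0_compat; lra.
      + apply Rmult_le_compat; try lra; try nra. }
  eapply Rle_trans; [exact B|].
  replace (P * (M * (Cmod (u - z)%C * Cmod (u - z)%C * (2 / (rho * rho * rho)))))
    with (Cmod (u - z)%C * A * Cmod (u - z)%C) by (unfold A; ring).
  pose proof (Cmod_ge_0 (u - z)%C). apply Rmult_le_compat_r; nra.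
Qed.

(** Near z, [f] is the quotient of the Cauchy integral of [f] by that of the constant 1. Both are
    holomorphic and the second does not vanish. *)
Lemma holo_of_cauchy_formula (f : C -> C) (x1 x2 y1 y2 M : R) (z : C) :
  (forall w, Ccont f w) -> (forall w, in_frame x1 x2 y1 y2 w -> Cmod (f w) <= M) ->
  (forall u, in_open_rect x1 x2 y1 y2 u -> rect_int (fun w => f w * / (w - u))%C x1 x2 y1 y2 =
     (f u * rect_int (fun w => / (w - u))%C x1 x2 y1 y2)%C) ->
  in_open_rect x1 x2 y1 y2 z -> holo f z.
Proof.
  intros Hc Hb Hf Hz.
  destruct (in_open_rect_ball _ _ _ _ _ Hz) as [r [Hr Hin]].
  apply (holo_ext_loc (fun u => rect_int (fun w => f w * / (w - u))%C x1 x2 y1 y2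
    * / rect_int (fun w => RtoC 1 * / (w - u))%C x1 x2 y1 y2)%C f z r Hr).
  - intros u Hu. rewrite Hf by auto.
    assert (E : rect_int (fun w => RtoC 1 * / (w - u))%C x1 x2 y1 y2 = rect_int (fun w => / (w - u))%C x1 x2 y1 y2).
    { apply rect_int_ext. destruct Hz; lra. destruct Hz; lra. intros; ring. }
    rewrite E. field. apply winding_neq_0; auto.
  - apply holo_mult.
    + apply (holo_cauchy_integral f x1 x2 y1 y2 M); auto.
    + apply (holo_inv (fun u => rect_int (fun w => RtoC 1 * / (w - u))%C x1 x2 y1 y2)).
      * apply (holo_cauchy_integral (fun _ => RtoC 1) x1 x2 y1 y2 1); auto.
        intros; apply Ccont_const. intros. rewrite Cmod_1. lra.
      * assert (E : rect_int (fun w => RtoC 1 * / (w - z))%C x1 x2 y1 y2 = rect_int (fun w => / (w - z))%C x1 x2 y1 y2).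
        { apply rect_int_ext. destruct Hz; lra. destruct Hz; lra. intros; ring. }
        rewrite E. apply winding_neq_0; auto.
Qed.

(** Cauchy's formula, unlike differentiability, passes to uniform limits, and by the previous lemma
    it implies holomorphy. *)
Lemma holo_unif_limit (f : C -> C) (x1 x2 y1 y2 M : R) :
  (forall w, Ccont f w) -> (forall w, in_frame x1 x2 y1 y2 w -> Cmod (f w) <= M) ->
  (forall eps, 0 < eps -> exists g, (forall w, Ccont g w) /\
     (forall w, in_open_rect x1 x2 y1 y2 w -> holo g w) /\
     (forall w, in_rect x1 x2 y1 y2 w -> Cmod (f w - g w)%C <= eps)) ->
  forall z, in_open_rect x1 x2 y1 y2 z -> holo f z.
Proof.
  intros Hc Hb Hg z Hz. apply (holo_of_cauchy_formula f x1 x2 y1 y2 M z Hc Hb); auto. clear z Hz.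
  intros u Hu. apply Ceq_minus. apply Cmod_eq_0.
  destruct (Rle_lt_or_eq_dec _ _ (Cmod_ge_0 (rect_int (fun w => f w * / (w - u))%C x1 x2 y1 y2 -
     (f u * rect_int (fun w => / (w - u)) x1 x2 y1 y2))%C)) as [HK|HK]; [exfalso|auto].
  match type of HK with 0 < ?k => set (K := k) in * end.
  destruct (in_frame_dist _ _ _ _ _ Hu) as [rho [Hrho Hd]].
  assert (Hx : x1 <= x2) by (destruct Hu; lra). assert (Hy : y1 <= y2) by (destruct Hu; lra).
  set (k := rect_int (fun w => / (w - u))%C x1 x2 y1 y2) in *.
  set (P := 4 * ((x2 - x1) + (y2 - y1))). assert (HP : 0 <= P) by (unfold P; lra).
  pose proof (Cmod_ge_0 k) as Hk.
  assert (HPr : 0 <= P / rho) by (apply Rdiv_le_0_compat; auto).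
  set (e := K / (2 * (P / rho + Cmod k + 1))).
  assert (He : 0 < e) by (apply Rdiv_lt_0_compat; lra).
  destruct (Hg e He) as (g & Cg & Hhg & Bg).
  assert (Nu : forall w, in_frame x1 x2 y1 y2 w -> (w - u)%C <> 0)
    by (intros; apply (in_frame_neq x1 x2 y1 y2); auto).
  assert (I : forall h, (forall w, Ccont h w) -> rect_integrable (fun w => h w * / (w - u))%C x1 x2 y1 y2).
  { intros h Hh. apply rect_integrable_cont; auto. intros w Hw. apply Ccont_mult; auto. apply Ccont_inv_sub; auto. }
  assert (E : (rect_int (fun w => f w * / (w - u))%C x1 x2 y1 y2 - f u * k =
     rect_int (fun w => f w * / (w - u) - g w * / (w - u)) x1 x2 y1 y2 - (f u - g u) * k)%C).
  { rewrite rect_int_minus by (apply I; auto).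
    rewrite (cauchy_formula g) by auto. fold k. ring. }
  assert (B : Cmod (rect_int (fun w => f w * / (w - u) - g w * / (w - u))%C x1 x2 y1 y2) <= P * (e * / rho)).
  { apply rect_int_bound; auto.
    - apply rect_integrable_cont; auto. intros w Hw.
      apply Ccont_minus; apply Ccont_mult; auto; apply Ccont_inv_sub; auto.
    - intros w Hw. replace (f w * / (w - u) - g w * / (w - u))%C with ((f w - g w) * / (w - u))%C by ring.
      rewrite Cmod_mult, Cmod_inv by auto. apply Rmult_le_compat.
      apply Cmod_ge_0. left; apply Rinv_0_lt_compat; specialize (Hd w Hw); lra.
      apply Bg. apply Hw. apply Rinv_le_contravar; auto. }
  assert (B2 : Cmod ((f u - g u) * k)%C <= e * Cmod k).
  { rewrite Cmod_mult. apply Rmult_le_compat_r; auto. apply Bg. unfold in_rect, in_open_rect in *. lra. }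
  assert (B3 : K <= P * (e * / rho) + e * Cmod k).
  { unfold K. rewrite E. unfold Cminus at 1. eapply Rle_trans; [apply Cmod_triangle|]. rewrite Cmod_opp. lra. }
  replace (P * (e * / rho) + e * Cmod k) with (e * (P / rho + Cmod k)) in B3 by (unfold Rdiv; ring).
  assert (e * (P / rho + Cmod k + 1) = K / 2).
  { unfold e. generalize dependent (P / rho). intros q Hq. intros. field. lra. }
  lra.
Qed.

(** * Exponential and logarithm *)

Definition Cexp (z : C) : C := (exp (fst z) * cos (snd z), exp (fst z) * sin (snd z)).

Lemma Cexp_plus (z w : C) : Cexp (z + w)%C = (Cexp z * Cexp w)%C.
Proof.
  unfold Cexp, Cmult, Cplus; simpl. rewrite exp_plus, cos_plus, sin_plus. f_equal; ring.
Qed.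

Lemma Cexp_0 : Cexp 0 = RtoC 1.
Proof. unfold Cexp, RtoC; simpl. rewrite exp_0, cos_0, sin_0. f_equal; ring. Qed.

Lemma Cmod_Cexp (z : C) : Cmod (Cexp z) = exp (fst z).
Proof.
  unfold Cexp, Cmod; simpl fst; simpl snd.
  replace ((exp (fst z) * cos (snd z)) ^ 2 + (exp (fst z) * sin (snd z)) ^ 2) with (exp (fst z) ^ 2).
  - apply sqrt_pow2. left. apply exp_pos.
  - pose proof (sin2_cos2 (snd z)) as H. unfold Rsqr in H.
    replace (exp (fst z) ^ 2) with (exp (fst z) ^ 2 * (sin (snd z) * sin (snd z) + cos (snd z) * cos (snd z)))
      by (rewrite H; ring). ring.
Qed.

Lemma Cexp_neq_0 (z : C) : Cexp z <> 0.
Proof. apply Cmod_gt_0. rewrite Cmod_Cexp. apply exp_pos. Qed.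

Lemma derivable_pt_lim_bound (f : R -> R) (l eps : R) : derivable_pt_lim f 0 l -> 0 < eps ->
  exists d, 0 < d /\ forall h, Rabs h < d -> Rabs (f h - f 0 - l * h) <= eps * Rabs h.
Proof.
  intros H Heps. destruct (H eps Heps) as [d Hd]. exists d. split. apply d.
  intros h Hh. destruct (Req_dec h 0) as [->|Hh0].
  - replace (f 0 - f 0 - l * 0) with 0 by ring. rewrite Rabs_R0. lra.
  - specialize (Hd h Hh0 Hh). rewrite Rplus_0_l in Hd.
    replace (f h - f 0 - l * h) with (((f h - f 0) / h - l) * h) by (field; auto).
    rewrite Rabs_mult. apply Rmult_le_compat_r. apply Rabs_pos. lra.
Qed.

Lemma Cexp_deriv_0 (eps : R) : 0 < eps -> exists d, 0 < d /\ forall w : C, Cmod w < d ->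
  Cmod (Cexp w - 1 - w)%C <= eps * Cmod w.
Proof.
  (* The real and imaginary parts of the error turn out to be at most 3 e |w| and 5 e |w|. The
     condition |w| < e turns the product of two first-order terms into such a bound. *)
  intros Heps. set (e := Rmin 1 (eps / 12)).
  assert (He : 0 < e) by (apply Rmin_glb_lt; lra).
  assert (He1 : e <= 1) by apply Rmin_l. assert (He2 : e <= eps / 12) by apply Rmin_r.
  pose proof (derivable_pt_lim_exp 0) as De. rewrite exp_0 in De.
  pose proof (derivable_pt_lim_cos 0) as Dc. rewrite sin_0, Ropp_0 in Dc.
  pose proof (derivable_pt_lim_sin 0) as Ds. rewrite cos_0 in Ds.
  destruct (derivable_pt_lim_bound exp 1 e De He) as [d1 [Hd1 B1]].
  destruct (derivable_pt_lim_bound cos 0 e Dc He) as [d2 [Hd2 B2]].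
  destruct (derivable_pt_lim_bound sin 1 e Ds He) as [d3 [Hd3 B3]].
  rewrite exp_0 in B1. rewrite cos_0 in B2. rewrite sin_0 in B3.
  exists (Rmin e (Rmin d1 (Rmin d2 d3))). split. { apply Rmin_glb_lt; [|apply Rmin_glb_lt; [|apply Rmin_glb_lt]]; auto. }
  intros w Hw.
  pose proof (Rmin_l e (Rmin d1 (Rmin d2 d3))). pose proof (Rmin_r e (Rmin d1 (Rmin d2 d3))).
  pose proof (Rmin_l d1 (Rmin d2 d3)). pose proof (Rmin_r d1 (Rmin d2 d3)).
  pose proof (Rmin_l d2 d3). pose proof (Rmin_r d2 d3).
  pose proof (abs_fst_le_Cmod w) as Hx. pose proof (abs_snd_le_Cmod w) as Hy.
  destruct w as [x y]; simpl in Hx, Hy. set (m := Cmod (x, y)) in *.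
  specialize (B1 x ltac:(lra)). specialize (B2 y ltac:(lra)). specialize (B3 y ltac:(lra)).
  replace (exp x - 1 - 1 * x) with (exp x - 1 - x) in B1 by ring.
  replace (cos y - 1 - 0 * y) with (cos y - 1) in B2 by ring.
  replace (sin y - 0 - 1 * y) with (sin y - y) in B3 by ring.
  assert (Hm : 0 <= m) by apply Cmod_ge_0.
  assert (C1 : Rabs (exp x - 1 - x) <= e * m) by nra.
  assert (C2 : Rabs (cos y - 1) <= e * m) by nra.
  assert (C3 : Rabs (sin y - y) <= e * m) by nra.
  assert (C4 : Rabs (exp x - 1) <= 2 * m).
  { replace (exp x - 1) with ((exp x - 1 - x) + x) by ring. eapply Rle_trans; [apply Rabs_triang|]. nra. }
  assert (C5 : Rabs (sin y) <= 2 * m).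
  { replace (sin y) with ((sin y - y) + y) by ring. eapply Rle_trans; [apply Rabs_triang|]. nra. }
  eapply Rle_trans; [apply Cmod_le_abs|]. unfold Cexp; simpl.
  assert (D1 : Rabs (exp x * cos y + - (1) + - x) <= 3 * (e * m)).
  { replace (exp x * cos y + - (1) + - x) with ((exp x - 1 - x) * cos y + (1 + x) * (cos y - 1)) by ring.
    eapply Rle_trans; [apply Rabs_triang|]. rewrite !Rabs_mult.
    assert (Rabs (cos y) <= 1) by (apply Rabs_le; pose proof (COS_bound y); lra).
    assert (Rabs (1 + x) <= 2) by (eapply Rle_trans; [apply Rabs_triang|]; rewrite Rabs_R1; lra).
    pose proof (Rabs_pos (exp x - 1 - x)). pose proof (Rabs_pos (cos y - 1)).
    pose proof (Rabs_pos (cos y)). pose proof (Rabs_pos (1 + x)). nra. }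
  assert (D2 : Rabs (exp x * sin y + - 0 + - y) <= 5 * (e * m)).
  { replace (exp x * sin y + - 0 + - y) with ((exp x - 1) * sin y + (sin y - y)) by ring.
    eapply Rle_trans; [apply Rabs_triang|]. rewrite !Rabs_mult.
    pose proof (Rabs_pos (exp x - 1)). pose proof (Rabs_pos (sin y)).
    assert (Rabs (exp x - 1) * Rabs (sin y) <= 4 * (m * m)) by nra. nra. }
  nra.
Qed.

(** The value phi(z), which is not zero, is recorded because [holo_Clog] divides by it. *)
Lemma Cexp_caratheodory (z : C) : exists phi, phi z = Cexp z /\ Ccont phi z /\
  forall w, Cexp w = (Cexp z + phi w * (w - z))%C.
Proof.
  apply caratheodory. intros eps Heps.
  pose proof (proj1 (Cmod_gt_0 _) (Cexp_neq_0 z)) as Hz.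
  destruct (Cexp_deriv_0 (eps / Cmod (Cexp z))) as [d [Hd Hd']].
  { apply Rdiv_lt_0_compat; auto. }
  exists d. split; auto. intros w Hw. specialize (Hd' _ Hw).
  replace (Cexp w) with (Cexp z * Cexp (w - z))%C by (rewrite <- Cexp_plus; f_equal; ring).
  replace (Cexp z * Cexp (w - z) - Cexp z - Cexp z * (w - z))%C
    with (Cexp z * (Cexp (w - z) - 1 - (w - z)))%C by ring.
  rewrite Cmod_mult. apply (Rmult_le_compat_l (Cmod (Cexp z))) in Hd'; [|lra].
  eapply Rle_trans; [exact Hd'|]. right. field. lra.
Qed.

Lemma holo_Cexp (z : C) : holo Cexp z.
Proof. destruct (Cexp_caratheodory z) as (phi & _ & H). exists phi. exact H. Qed.

(** A logarithm near [1], truncated away from [1] so that it is continuous on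
    the whole plane. *)
Definition Clog (z : C) : C := (ln (Rmax (Cmod z) (/ 2)), atan (snd z / Rmax (fst z) (/ 2))).

Lemma continuity_pt_Rmax (c x : R) : continuity_pt (fun t => Rmax t c) x.
Proof.
  intros eps Heps. exists eps. split; auto. intros y [_ Hy]. simpl in *. unfold R_dist in *.
  revert Hy. unfold Rmax. destruct (Rle_dec y c), (Rle_dec x c); unfold Rabs;
    repeat destruct Rcase_abs; lra.
Qed.

Lemma continuity_2d_pt_Cmod (x y : R) : continuity_2d_pt (fun u v => Cmod (u, v)) x y.
Proof.
  intros eps. exists (mkposreal _ (is_pos_div_2 eps)). simpl. intros u v Hu Hv.
  assert (H : Cmod ((u, v) - (x, y))%C < eps).
  { eapply Rle_lt_trans; [apply Cmod_le_abs|]. simpl. unfold Rminus in *. lra. }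
  pose proof (Cmod_le_plus_minus (u, v) (x, y)) as H1.
  pose proof (Cmod_le_plus_minus (x, y) (u, v)) as H2.
  rewrite Cmod_minus_sym in H2. apply Rabs_def1; lra.
Qed.

Lemma Ccont_Clog (z : C) : Ccont Clog z.
Proof.
  assert (P : forall t, 0 < Rmax t (/ 2)) by (intros t; pose proof (Rmax_r t (/ 2)); lra).
  apply Ccont_of_components; simpl.
  - apply (continuity_1d_2d_pt_comp ln (fun x y => Rmax (Cmod (x, y)) (/ 2))).
    + apply derivable_continuous_pt. exists (/ Rmax (Cmod (fst z, snd z)) (/ 2)).
      apply derivable_pt_lim_ln. apply P.
    + apply (continuity_1d_2d_pt_comp (fun t => Rmax t (/ 2)) (fun x y => Cmod (x, y))).
      apply continuity_pt_Rmax. apply continuity_2d_pt_Cmod.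
  - apply (continuity_1d_2d_pt_comp atan (fun x y => y / Rmax x (/ 2))).
    + apply derivable_continuous_pt. apply derivable_pt_atan.
    + apply continuity_2d_pt_mult. apply continuity_2d_pt_id2.
      apply continuity_2d_pt_inv. 2: apply Rgt_not_eq, P.
      apply (continuity_1d_2d_pt_comp (fun t => Rmax t (/ 2)) (fun x y => x)).
      apply continuity_pt_Rmax. apply continuity_2d_pt_id1.
Qed.

Lemma Cexp_Clog (z : C) : Cmod (z - 1)%C < / 2 -> Cexp (Clog z) = z.
Proof.
  intros Hz. destruct z as [x y]. pose proof (abs_fst_le_Cmod ((x, y) - 1)%C) as Hx. simpl in Hx.
  assert (Hx' : / 2 < x). { assert (A : Rabs (x + - (1)) < / 2) by lra. apply Rabs_def2 in A. lra. }
  pose proof (abs_fst_le_Cmod (x, y)) as Hm. simpl in Hm. rewrite Rabs_pos_eq in Hm by lra.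
  unfold Clog, Cexp; simpl fst; simpl snd.
  rewrite !Rmax_left by lra. rewrite exp_ln by lra. rewrite cos_atan, sin_atan.
  assert (E : sqrt (1 + (y / x)²) = Cmod (x, y) / x).
  { unfold Cmod; simpl fst; simpl snd. unfold Rsqr.
    replace (1 + y / x * (y / x)) with ((x ^ 2 + y ^ 2) / x ^ 2) by (field; lra).
    rewrite sqrt_div_alt. rewrite sqrt_pow2 by lra. reflexivity. apply pow_lt. lra. }
  rewrite E. f_equal; field; lra.
Qed.

(** Differentiation of an inverse function in Carathéodory's form: applying the expansion of [Cexp]
    at log z to log w gives w - z = phi(log w)(log w - log z), so 1 / phi(log w) is the quotient for
    the logarithm. Continuity of [Clog] does the rest. *)
Lemma holo_Clog (z : C) : Cmod (z - 1)%C < / 2 -> holo Clog z.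
Proof.
  intros Hz. destruct (Cexp_caratheodory (Clog z)) as (phi & Ephi & Cphi & H).
  assert (N : phi (Clog z) <> 0) by (rewrite Ephi; apply Cexp_neq_0).
  apply (holo_ext_loc (fun w => Clog z + / phi (Clog w) * (w - z))%C Clog z (/ 2 - Cmod (z - 1)%C)).
  - lra.
  - intros w Hw. assert (Hw1 : Cmod (w - 1)%C < / 2).
    { pose proof (Cmod_minus_triangle w z 1). lra. }
    specialize (H (Clog w)). rewrite !Cexp_Clog in H by auto.
    (* If the quotient vanished, the expansion would give w = z, where the claim is trivial. *)
    destruct (classic (phi (Clog w) = 0)) as [E|E].
    + assert (Ew : w = z) by (rewrite H, E; ring). rewrite Ew. ring.
    + assert (Ew : (w - z)%C = (phi (Clog w) * (Clog w - Clog z))%C) by (rewrite H at 1; ring).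
      rewrite Ew. field. auto.
  - exists (fun w => / phi (Clog w))%C. split.
    + apply (Ccont_inv (fun w => phi (Clog w))); auto. apply (Ccont_comp Clog phi); auto. apply Ccont_Clog.
    + intros w. ring.
Qed.

Lemma Clog_Cexp_small (eps : R) : 0 < eps -> exists r, 0 < r /\ r <= / 2 /\
  forall z, Cmod (z - 1)%C < r -> Cmod (Clog z) < eps.
Proof.
  intros Heps. destruct (Ccont_Clog 1 eps Heps) as [d [Hd Hd']].
  exists (Rmin d (/ 2)). split. apply Rmin_glb_lt; lra. split. apply Rmin_r.
  intros z Hz. replace (Clog z) with (Clog z - Clog 1)%C.
  - apply Hd'. eapply Rlt_le_trans; [exact Hz | apply Rmin_l].
  - assert (E : Clog 1 = RtoC 0).
    { unfold Clog. rewrite Cmod_1. unfold RtoC; simpl. rewrite !Rmax_left by lra. rewrite ln_1.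
      f_equal. replace (0 / 1) with 0 by field. apply atan_0. }
    rewrite E. ring.
Qed.

(** * Retraction of the plane onto a closed rectangle *)

Definition clamp (a b x : R) : R := Rmax a (Rmin b x).
(** Composing with this retraction gives a function continuous on the plane, unchanged on the
    rectangle, hence holomorphic at the same interior points. This is the form of data on which
    Cauchy's theorem was proved. *)
Definition Cclamp (x1 x2 y1 y2 : R) (z : C) : C := (clamp x1 x2 (fst z), clamp y1 y2 (snd z)).

Lemma clamp_in (a b x : R) : a <= b -> a <= clamp a b x <= b.
Proof. intros H. unfold clamp, Rmax, Rmin. destruct (Rle_dec b x), (Rle_dec a _); lra. Qed.

Lemma clamp_id (a b x : R) : a <= x <= b -> clamp a b x = x.
Proof. intros H. unfold clamp, Rmax, Rmin. destruct (Rle_dec b x), (Rle_dec a _); lra. Qed.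

Lemma clamp_lipschitz (a b x y : R) : a <= b -> Rabs (clamp a b x - clamp a b y) <= Rabs (x - y).
Proof.
  intros H. unfold clamp, Rmax, Rmin.
  destruct (Rle_dec b x), (Rle_dec b y); repeat destruct (Rle_dec a _);
  unfold Rabs; repeat destruct Rcase_abs; lra.
Qed.

Lemma Cclamp_in (x1 x2 y1 y2 : R) (z : C) : x1 <= x2 -> y1 <= y2 -> in_rect x1 x2 y1 y2 (Cclamp x1 x2 y1 y2 z).
Proof. intros Hx Hy. split; apply clamp_in; auto. Qed.

Lemma Cclamp_id (x1 x2 y1 y2 : R) (z : C) : in_rect x1 x2 y1 y2 z -> Cclamp x1 x2 y1 y2 z = z.
Proof. intros [Hx Hy]. unfold Cclamp. rewrite !clamp_id by auto. destruct z; reflexivity. Qed.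

Lemma Ccont_clamped (f : C -> C) (x1 x2 y1 y2 : R) : x1 <= x2 -> y1 <= y2 ->
  (forall z, in_rect x1 x2 y1 y2 z -> forall eps, 0 < eps -> exists d, 0 < d /\
    forall w, in_rect x1 x2 y1 y2 w -> Cmod (w - z)%C < d -> Cmod (f w - f z)%C < eps) ->
  forall z, Ccont (fun w => f (Cclamp x1 x2 y1 y2 w)) z.
Proof.
  intros Hx Hy Hf z eps Heps.
  destruct (Hf _ (Cclamp_in x1 x2 y1 y2 z Hx Hy) eps Heps) as [d [Hd Hd']].
  exists (d / 2). split. lra. intros w Hw. apply Hd'. apply Cclamp_in; auto.
  eapply Rle_lt_trans; [apply Cmod_le_abs|]. unfold Cclamp; simpl.
  pose proof (clamp_lipschitz x1 x2 (fst w) (fst z) Hx).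
  pose proof (clamp_lipschitz y1 y2 (snd w) (snd z) Hy).
  pose proof (abs_fst_le_Cmod (w - z)%C) as A1. pose proof (abs_snd_le_Cmod (w - z)%C) as A2.
  simpl in A1, A2. unfold Rminus in *. lra.
Qed.

Lemma in_open_in_rect (x1 x2 y1 y2 : R) (z : C) : in_open_rect x1 x2 y1 y2 z -> in_rect x1 x2 y1 y2 z.
Proof. unfold in_open_rect, in_rect. lra. Qed.

Lemma holo_clamped (f : C -> C) (x1 x2 y1 y2 : R) (z : C) :
  in_open_rect x1 x2 y1 y2 z -> holo f z -> holo (fun w => f (Cclamp x1 x2 y1 y2 w)) z.
Proof.
  intros Hz Hf. destruct (in_open_rect_ball _ _ _ _ _ Hz) as [r [Hr H]].
  apply (holo_ext_loc f _ z r Hr); auto. intros w Hw. rewrite Cclamp_id; auto. apply in_open_in_rect; auto.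
Qed.

(** * Two constants and limits of extensions *)

(** The weight [exp (N h)] is small on three sides of the rectangle and at least
    [1] near the middle of the fourth. *)
Lemma two_constants (d c M eta : R) : 0 < d -> 0 < eta -> exists eps, 0 < eps /\
  forall f, (forall w, Ccont f w) -> (forall w, in_open_rect 0 d (c - d) (c + d) w -> holo f w) ->
    (forall w, in_rect 0 d (c - d) (c + d) w -> Cmod (f w) <= M) ->
    (forall x, c - d <= x <= c + d -> Cmod (f (0, x)) <= eps) ->
    forall w, in_rect 0 (d / 16) (c - d / 2) (c + d / 2) w -> Cmod (f w) <= eta.
Proof.
  intros Hd Heta.
  set (A := exp (d ^ 2 / 2)).
  assert (HA : 1 < A). { unfold A. rewrite <- exp_0. apply exp_increasing. assert (0 < d ^ 2) by (apply pow_lt; auto). lra. }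
  assert (HA' : 0 < / A < 1).
  { split. apply Rinv_0_lt_compat; lra. rewrite <- Rinv_1. apply Rinv_lt_contravar; lra. }
  pose proof (Rabs_pos M) as HM.
  (* [A] is the maximum of |exp h| on the edge x = 0, and 1/A bounds it on the other sides. [N]
     makes M / A^N smaller than eta; on the edge, eps = eta / A^N absorbs the factor A^N. *)
  destruct (pow_lt_1_zero (/ A)) with (y := eta / (Rabs M + 1)) as [N HN].
  { rewrite Rabs_pos_eq; lra. } { apply Rdiv_lt_0_compat; lra. }
  specialize (HN N (le_n N)).
  assert (HAN : 0 < (/ A) ^ N) by (apply pow_lt; lra).
  rewrite Rabs_pos_eq in HN by lra. apply Rlt_div_r in HN; [|lra].
  exists (eta * (/ A) ^ N). split. { apply Rmult_lt_0_compat; auto. }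
  intros f Cf Hf Bf Sf w Hw.
  (* Re h = d^2/2 - 2 d x + x^2 - (y - c)^2. This is at most d^2/2 on x = 0 and at most -d^2/2 on x
     = d and on y = c - d, y = c + d. For 0 <= x <= d/16 and |y - c| <= d/2 it is at least d^2/8. *)
  set (h := fun u : C => (RtoC (d ^ 2 / 2) - RtoC (2 * d) * (u - (0, c)) + (u - (0, c)) * (u - (0, c)))%C).
  assert (Rh : forall u, fst (h u) = d ^ 2 / 2 - 2 * d * fst u + fst u ^ 2 - (snd u - c) ^ 2).
  { intros [x y]. unfold h, RtoC, Cplus, Cminus, Copp, Cmult, Cplus; simpl. ring. }
  assert (Hh : forall u, holo h u).
  { intros u. assert (holo (fun u : C => (u - (0, c))%C) u) by (apply holo_minus; [apply holo_id | apply holo_const]).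
    apply holo_plus. apply holo_minus. apply holo_const. apply holo_mult; auto. apply holo_const. apply holo_mult; auto. }
  set (G := fun u : C => (f u * Cexp (h u) ^ N)%C).
  assert (HE : forall u, holo (fun u => Cexp (h u) ^ N)%C u).
  { intros u. apply holo_pow. apply (holo_comp h Cexp); auto. apply holo_Cexp. }
  assert (MG : forall u, Cmod (G u) = Cmod (f u) * exp (fst (h u)) ^ N).
  { intros u. unfold G. rewrite Cmod_mult, Cmod_pow, Cmod_Cexp. reflexivity. }
  assert (small : forall u, in_rect 0 d (c - d) (c + d) u -> fst (h u) <= - (d ^ 2 / 2) -> Cmod (G u) <= eta).
  { intros u Hu Hhu. rewrite MG.
    assert (E : exp (fst (h u)) ^ N <= (/ A) ^ N).
    { apply pow_incr. split. left; apply exp_pos. unfold A. rewrite <- exp_Ropp.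
      destruct (Rle_lt_or_eq_dec _ _ Hhu) as [L | ->]. left. apply exp_increasing; auto. lra. }
    specialize (Bf u Hu). pose proof (Cmod_ge_0 (f u)). pose proof (Rle_abs M).
    assert (0 <= exp (fst (h u)) ^ N) by (apply pow_le; left; apply exp_pos).
    apply Rle_trans with (Cmod (f u) * (/ A) ^ N). apply Rmult_le_compat_l; auto.
    apply Rle_trans with (M * (/ A) ^ N). apply Rmult_le_compat_r; lra. nra. }
  assert (HG : Cmod (G w) <= eta).
  { apply (max_modulus G 0 d (c - d) (c + d)).
    - intros u. apply Ccont_mult; auto. apply holo_Ccont; auto.
    - intros u Hu. apply holo_mult; auto.
    - intros u [Hr [E|[E|[E|E]]]].
      + rewrite MG. destruct u as [x y]; simpl in E; subst x.
        assert (B : exp (fst (h (0, y))) ^ N <= A ^ N).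
        { apply pow_incr. split. left; apply exp_pos. unfold A. rewrite Rh. simpl fst; simpl snd.
          assert (Hs : d ^ 2 / 2 - 2 * d * 0 + 0 ^ 2 - (y - c) ^ 2 <= d ^ 2 / 2).
          { pose proof (pow2_ge_0 (y - c)). nra. }
          destruct (Rle_lt_or_eq_dec _ _ Hs) as [L | ->]. left. apply exp_increasing; auto. lra. }
        specialize (Sf y ltac:(unfold in_rect in Hr; simpl in Hr; lra)).
        replace eta with (eta * (/ A) ^ N * A ^ N).
        * apply Rmult_le_compat; auto. apply Cmod_ge_0. apply pow_le. left; apply exp_pos.
        * rewrite pow_inv. field. apply pow_nonzero. lra.
      + apply small; auto. rewrite Rh, E. pose proof (pow2_ge_0 (snd u - c)). nra.
      + apply small; auto. rewrite Rh, E. destruct Hr. nra.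
      + apply small; auto. rewrite Rh, E. destruct Hr. nra.
    - unfold in_rect in *. lra. }
  rewrite MG in HG.
  assert (1 <= exp (fst (h w)) ^ N).
  { apply pow_R1_Rle. rewrite <- exp_0.
    assert (Hs : 0 <= fst (h w)).
    { rewrite Rh. destruct Hw as [Hw1 Hw2].
      assert ((snd w - c) ^ 2 <= (d / 2) ^ 2) by (apply pow_maj_Rabs, Rabs_le; lra).
      pose proof (pow2_ge_0 (fst w)). nra. }
    destruct (Rle_lt_or_eq_dec _ _ Hs) as [L | <-]. left. apply exp_increasing; auto. lra. }
  pose proof (Cmod_ge_0 (f w)). nra.
Qed.

Lemma unif_cauchy_limit (L : nat -> C -> C) (S : C -> Prop) :
  (forall eta, 0 < eta -> exists N, forall n m, (N <= n)%nat -> (N <= m)%nat ->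
     forall w, S w -> Cmod (L n w - L m w)%C <= eta) ->
  exists lam : C -> C, forall eta, 0 < eta -> exists N, forall n, (N <= n)%nat ->
     forall w, S w -> Cmod (L n w - lam w)%C <= eta.
Proof.
  intros HC.
  exists (fun w => (real (Lim_seq (fun n => fst (L n w))), real (Lim_seq (fun n => snd (L n w))))).
  assert (K : forall p : C -> R, (forall z w, p (z - w)%C = p z - p w) -> (forall z, Rabs (p z) <= Cmod z) ->
    forall eta, 0 < eta -> exists N, forall n, (N <= n)%nat -> forall w, S w ->
      Rabs (p (L n w) - real (Lim_seq (fun n => p (L n w)))) <= eta).
  { intros p Hp1 Hp2 eta Heta. destruct (HC eta Heta) as [N HN]. exists N. intros n Hn w Hw.
    assert (Hlim : is_lim_seq (fun n => p (L n w)) (Finite (real (Lim_seq (fun n => p (L n w)))))).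
    { apply Lim_seq_correct'. apply ex_lim_seq_cauchy_corr. intros eps.
      destruct (HC _ (is_pos_div_2 eps)) as [N2 HN2]. exists N2. intros k m Hk Hm.
      specialize (HN2 k m Hk Hm w Hw). rewrite <- Hp1. simpl in HN2.
      eapply Rle_lt_trans; [apply Hp2|]. pose proof (cond_pos eps). lra. }
    assert (Hb := is_lim_seq_minus' (fun _ => p (L n w)) _ _ _ (is_lim_seq_const _) Hlim).
    apply is_lim_seq_abs in Hb.
    refine (is_lim_seq_le_loc _ (fun _ => eta) _ (Finite eta) _ Hb (is_lim_seq_const eta)).
    exists N. intros m Hm. rewrite <- Hp1. eapply Rle_trans; [apply Hp2 | auto]. }
  intros eta Heta.
  destruct (K fst (fun _ _ => eq_refl) abs_fst_le_Cmod (eta / 2) ltac:(lra)) as [N1 H1].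
  destruct (K snd (fun _ _ => eq_refl) abs_snd_le_Cmod (eta / 2) ltac:(lra)) as [N2 H2].
  exists (N1 + N2)%nat. intros n Hn w Hw.
  specialize (H1 n ltac:(lia) w Hw). specialize (H2 n ltac:(lia) w Hw).
  eapply Rle_trans; [apply Cmod_le_abs|]. simpl. unfold Rminus in *. lra.
Qed.

(** [both = false] is the one-sided rectangle, [both = true] the two-sided one. *)
Definition left_end (both : bool) (d : R) : R := if both then - d else 0.

Lemma two_constants_sides (both : bool) (d c M eta : R) : 0 < d -> 0 < eta -> exists eps, 0 < eps /\
  forall f, (forall w, Ccont f w) -> (forall w, in_open_rect (left_end both d) d (c - d) (c + d) w -> holo f w) ->
    (forall w, in_rect (left_end both d) d (c - d) (c + d) w -> Cmod (f w) <= M) ->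
    (forall x, c - d <= x <= c + d -> Cmod (f (0, x)) <= eps) ->
    forall w, in_rect (left_end both (d / 16)) (d / 16) (c - d / 16) (c + d / 16) w -> Cmod (f w) <= eta.
Proof.
  intros Hd Heta. destruct (two_constants d c M eta Hd Heta) as [eps [Heps H]].
  exists eps. split; auto. intros f Cf Hf Bf Sf w Hw.
  assert (Hsub : forall u, in_open_rect 0 d (c - d) (c + d) u -> in_open_rect (left_end both d) d (c - d) (c + d) u).
  { intros u Hu. unfold in_open_rect, left_end in *. destruct both; lra. }
  assert (Hsub' : forall u, in_rect 0 d (c - d) (c + d) u -> in_rect (left_end both d) d (c - d) (c + d) u).
  { intros u Hu. unfold in_rect, left_end in *. destruct both; lra. }
  destruct (Rle_lt_dec 0 (fst w)) as [Hw0|Hw0].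
  - apply H; auto. unfold in_rect in *. lra.
  - assert (Eb : both = true) by (destruct both; auto; unfold in_rect, left_end in Hw; lra). subst both.
    unfold left_end in *.
    (* The half-turn about (0, c) exchanges the two halves of the rectangle and preserves the common
       edge; unlike the reflection in that edge it is holomorphic. *)
    set (s := fun u : C => (RtoC 0 - u + (0, 2 * c)%R)%C).
    assert (Es : forall x y, s (x, y) = (- x, 2 * c - y)).
    { intros x y. unfold s, Cplus, Cminus, Copp, RtoC, Cplus; simpl. f_equal; ring. }
    assert (Hs : forall u, holo s u).
    { intros u. apply holo_plus. apply holo_minus. apply holo_const. apply holo_id. apply holo_const. }
    replace w with (s (s w)) by (destruct w; rewrite !Es; f_equal; ring).
    apply (H (fun u => f (s u))).
    + intros u. apply (Ccont_comp s f); auto. apply holo_Ccont; auto.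
    + intros [x y] Hu. apply (holo_comp s f); auto. apply Hf. rewrite Es. unfold in_open_rect in *; simpl in *. lra.
    + intros [x y] Hu. apply Bf. rewrite Es. unfold in_rect in *; simpl in *. lra.
    + intros x Hx. rewrite Es, Ropp_0. apply Sf. lra.
    + destruct w as [x y]. rewrite Es. unfold in_rect in *; simpl in *. lra.
Qed.

(** Continuity on the whole plane costs nothing, thanks to [Cclamp], and includes continuity up to
    the edge x = 0 that carries the boundary values. *)
Definition rect_ext (both : bool) (d c M : R) (Lam : C -> C) : Prop :=
  (forall w, Ccont Lam w) /\
  (forall w, in_open_rect (left_end both d) d (c - d) (c + d) w -> holo Lam w) /\
  (forall w, in_rect (left_end both d) d (c - d) (c + d) w -> Cmod (Lam w) <= M).

Lemma rect_ext_limit (both : bool) (d c M : R) (g : R -> C) : 0 < d ->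
  (forall eps, 0 < eps -> exists Lam, rect_ext both d c M Lam /\
     forall x, c - d <= x <= c + d -> Cmod (Lam (0, x) - g x)%C <= eps) ->
  exists Lam M', rect_ext both (d / 16) c M' Lam /\
     forall x, c - d / 16 <= x <= c + d / 16 -> Lam (0, x) = g x.
Proof.
  intros Hd H.
  assert (Hn : forall n : nat, 0 < / (INR n + 1)).
  { intros n. apply Rinv_0_lt_compat. pose proof (pos_INR n). lra. }
  set (L := fun n => proj1_sig (constructive_indefinite_description _ (H _ (Hn n)))).
  assert (HL : forall n, rect_ext both d c M (L n) /\
     forall x, c - d <= x <= c + d -> Cmod (L n (0, x) - g x)%C <= / (INR n + 1))
    by (intros n; unfold L; exact (proj2_sig (constructive_indefinite_description _ (H _ (Hn n))))).
  assert (Harch : forall eta, 0 < eta -> exists N, forall n, (N <= n)%nat -> / (INR n + 1) <= eta).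
  { intros eta Heta. destruct (nfloor_ex (/ eta)) as [N HN]. left; apply Rinv_0_lt_compat; auto.
    exists N. intros n Hn'. apply le_INR in Hn'. rewrite <- (Rinv_inv eta).
    apply Rinv_le_contravar. apply Rinv_0_lt_compat; auto. lra. }
  set (x1 := left_end both (d / 16)) in *. set (S := in_rect x1 (d / 16) (c - d / 16) (c + d / 16)).
  assert (Hx1 : x1 <= d / 16) by (unfold x1, left_end; destruct both; lra).
  assert (Hsub : forall w, S w -> in_rect (left_end both d) d (c - d) (c + d) w).
  { intros w Hw. unfold S, x1, in_rect, left_end in *. destruct both; lra. }
  assert (Hsub' : forall w, in_open_rect x1 (d / 16) (c - d / 16) (c + d / 16) w ->
      in_open_rect (left_end both d) d (c - d) (c + d) w).
  { intros w Hw. unfold S, x1, in_open_rect, left_end in *. destruct both; lra. }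
  assert (Hedge : forall x, c - d / 16 <= x <= c + d / 16 -> S (0, x)).
  { intros x Hx. unfold S, x1, in_rect, left_end; simpl. destruct both; lra. }
  destruct (unif_cauchy_limit L S) as [lam Hlam].
  { intros eta Heta. destruct (two_constants_sides both d c (2 * M) eta Hd Heta) as [eps [Heps TC]].
    destruct (Harch (eps / 2)) as [N HN]. lra. exists N. intros n m Hn' Hm w Hw.
    destruct (HL n) as [(Cn & Hhn & Bn) An]. destruct (HL m) as [(Cm & Hhm & Bm) Am].
    apply (TC (fun w => L n w - L m w)%C); auto.
    - intros u. apply Ccont_minus; auto.
    - intros u Hu. apply holo_minus; auto.
    - intros u Hu. unfold Cminus. eapply Rle_trans; [apply Cmod_triangle|]. rewrite Cmod_opp.
      specialize (Bn u Hu). specialize (Bm u Hu). lra.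
    - intros x Hx. eapply Rle_trans; [apply (Cmod_minus_triangle _ (g x))|].
      rewrite (Cmod_minus_sym (g x)). specialize (An x Hx). specialize (Am x Hx).
      pose proof (HN n Hn'). pose proof (HN m Hm). lra. }
  (* The limit [lam] is controlled only on [S], so it is replaced by its clamped version. *)
  set (Lam := fun w => lam (Cclamp x1 (d / 16) (c - d / 16) (c + d / 16) w)).
  assert (CLam : forall w, Ccont Lam w).
  { apply Ccont_clamped; try lra. intros z Hz eps Heps.
    destruct (Hlam (eps / 4)) as [N HN]. lra. specialize (HN N (le_n N)).
    destruct (HL N) as [(CN & _) _]. destruct (CN z (eps / 4)) as [r [Hr Hr']]. lra.
    exists r. split; auto. intros w Hw Hwz. specialize (Hr' w Hwz).
    pose proof (Cmod_minus_triangle (lam w) (L N w) (lam z)) as T1.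
    pose proof (Cmod_minus_triangle (L N w) (L N z) (lam z)) as T2.
    rewrite (Cmod_minus_sym (lam w) (L N w)) in T1.
    pose proof (HN w Hw). pose proof (HN z Hz). lra. }
  assert (ELam : forall w, S w -> Lam w = lam w).
  { intros w Hw. unfold Lam. rewrite Cclamp_id; auto. }
  (* The bound may grow, because membership in the closure only has to give some extension. *)
  assert (BLam : forall w, S w -> Cmod (Lam w) <= M + 1).
  { intros w Hw. rewrite ELam by auto. destruct (Hlam 1) as [N HN]. lra. specialize (HN N (le_n N) w Hw).
    destruct (HL N) as [(_ & _ & BN) _]. specialize (BN w (Hsub w Hw)).
    pose proof (Cmod_le_plus_minus (lam w) (L N w)) as T. rewrite Cmod_minus_sym in T. lra. }
  exists Lam, (M + 1). split; [split; [|split]|]; auto.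
  - intros w Hw. apply (holo_unif_limit Lam x1 (d / 16) (c - d / 16) (c + d / 16) (M + 1)); auto.
    + intros u [Hu _]. apply BLam. exact Hu.
    + intros eps Heps. destruct (Hlam eps Heps) as [N HN]. specialize (HN N (le_n N)).
      destruct (HL N) as [(CN & HhN & _) _]. exists (L N). split; [|split]; auto.
      intros u Hu. rewrite ELam by auto. rewrite Cmod_minus_sym. auto.
  - intros x Hx. rewrite ELam by auto. apply Ceq_minus. apply Cmod_eq_0.
    apply Rle_antisym; [|apply Cmod_ge_0]. apply Rnot_lt_le. intros Hlt.
    set (k := Cmod (lam (0, x) - g x)%C) in *.
    destruct (Hlam (k / 4)) as [N1 HN1]. lra. destruct (Harch (k / 4)) as [N2 HN2]. lra.
    specialize (HN1 (N1 + N2)%nat ltac:(lia) (0, x) (Hedge x Hx)). specialize (HN2 (N1 + N2)%nat ltac:(lia)).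
    destruct (HL (N1 + N2)%nat) as [_ A]. specialize (A x ltac:(lra)).
    pose proof (Cmod_minus_triangle (lam (0, x)) (L (N1 + N2)%nat (0, x)) (g x)) as T.
    rewrite (Cmod_minus_sym (lam (0, x)) (L _ _)) in T. fold k in T. lra.
Qed.

(** * Logarithmic coordinates near the circle *)

Definition sgn (s : bool) : R := if s then 1 else -1.

Lemma sgn_sq (s : bool) : sgn s * sgn s = 1.
Proof. destruct s; simpl; ring. Qed.

Lemma Cexp_imag (t : R) : Cexp (0, t) = Cexp_i t.
Proof. unfold Cexp, Cexp_i; simpl. rewrite exp_0. f_equal; ring. Qed.

(** The side of the circle on which an extension lives: [s = true] is the
    exterior, [s = false] the interior, and [both = true] means both sides. *)
Definition on_side (s both : bool) (z : C) : Prop :=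
  both = true \/ (if s then 1 < Cmod z else Cmod z < 1).

(** A common form implied by the extensions in all the classes: continuity is asked only inside the
    disk, so it follows from continuity on all of I and the one-sided region as well as from
    holomorphy on the disk. *)
Definition extends_near (s both : bool) (a b : R) (z0 : C) (u : C -> C) : Prop :=
  exists r (lam : C -> C), 0 < r /\
    (forall z, Cmod (z - z0)%C < r -> inI a b z \/ on_side s both z ->
       forall eps, 0 < eps -> exists d, 0 < d /\ forall w, Cmod (w - z0)%C < r ->
         inI a b w \/ on_side s both w -> Cmod (w - z)%C < d -> Cmod (lam w - lam z)%C < eps) /\
    (forall z, Cmod (z - z0)%C < r -> on_side s both z -> holo lam z) /\
    (forall z, Cmod (z - z0)%C < r -> inI a b z -> lam z = u z).

(** In the coordinate [w] with [z = exp (sgn s * w)], both sides of the circle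
    become the half-plane [Re w > 0]. *)
Definition log_ext (s both : bool) (d c M : R) (u : C -> C) : Prop :=
  exists Lam, rect_ext both d (sgn s * c) M Lam /\
    forall t, c - d <= t <= c + d -> Lam (0, sgn s * t) = u (Cexp_i t).

(** The one integer [n] fixes the denominator of the position, the half-size 1/(n + 1) and the bound
    n, so pairs (p, n) enumerate all rectangles with their bounds. *)
Definition node (a b : R) (p n : nat) : R := a + (b - a) * (INR p / (INR n + 1)).

Lemma node_approx (a b t eps : R) (k : R) : a < b -> a < t < b -> 0 < eps ->
  exists p n, let d := / (INR n + 1) in 0 < d /\ d <= eps /\ k <= INR n /\ Rabs (node a b p n - t) <= eps.
Proof.
  intros Hab Ht Heps.
  destruct (nfloor_ex (Rmax k (Rmax (/ eps) ((b - a) / eps)))) as [n [_ Hn]].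
  { eapply Rle_trans; [|apply Rmax_r]. eapply Rle_trans; [|apply Rmax_l]. left. apply Rinv_0_lt_compat; auto. }
  assert (H1 := Rmax_l k (Rmax (/ eps) ((b - a) / eps))).
  assert (H2 := Rmax_r k (Rmax (/ eps) ((b - a) / eps))).
  assert (H3 := Rmax_l (/ eps) ((b - a) / eps)).
  assert (H4 := Rmax_r (/ eps) ((b - a) / eps)).
  (* [n] is only the integer part of the required size; its successor exceeds all three
     requirements. *)
  set (m := S n).
  assert (Hm : INR m = INR n + 1) by apply S_INR.
  assert (Hn0 := pos_INR n).
  destruct (nfloor_ex ((t - a) / (b - a) * (INR m + 1))) as [p [Hp1 Hp2]].
  { apply Rmult_le_pos; [|lra]. left. apply Rdiv_lt_0_compat; lra. }
  exists p, m. cbv zeta.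
  assert (Hd : 0 < / (INR m + 1)) by (apply Rinv_0_lt_compat; lra).
  assert (He1 : 1 <= eps * (INR m + 1)).
  { apply Rle_trans with (eps * / eps). rewrite Rinv_r; lra. apply Rmult_le_compat_l; lra. }
  assert (He2 : (b - a) <= eps * (INR m + 1)).
  { replace (b - a) with (eps * ((b - a) / eps)) by (field; lra). apply Rmult_le_compat_l; lra. }
  split; [|split; [|split]]; auto.
  - apply (Rmult_le_reg_r (INR m + 1)). lra. rewrite Rinv_l by lra. lra.
  - lra.
  - unfold node.
    assert (E : t - a = (b - a) * ((t - a) / (b - a) * (INR m + 1) / (INR m + 1))) by (field; lra).
    set (q := (t - a) / (b - a) * (INR m + 1)) in *.
    replace (a + (b - a) * (INR p / (INR m + 1)) - t) with ((b - a) * ((INR p - q) * / (INR m + 1))).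
    2:{ replace t with (a + (t - a)) by ring. rewrite E. field. lra. }
    rewrite Rabs_mult, Rabs_mult, (Rabs_pos_eq (b - a)), (Rabs_pos_eq (/ (INR m + 1))) by lra.
    assert (Rabs (INR p - q) <= 1) by (apply Rabs_le; lra).
    apply Rle_trans with ((b - a) * (1 * / (INR m + 1))).
    + apply Rmult_le_compat_l. lra. apply Rmult_le_compat_r; lra.
    + apply (Rmult_le_reg_r (INR m + 1)). lra.
      replace ((b - a) * (1 * / (INR m + 1)) * (INR m + 1)) with (b - a) by (field; lra). lra.
Qed.

(** Since z0 may be an endpoint of the arc, its angle is first pushed inside by at most eta, then
    moved to a node. Continuity of the extension at z0 bounds it by |lam z0| + 1 nearby, and [n] is
    taken at least that large. *)
Lemma log_ext_of_extends_near (s both : bool) (a b : R) (z0 : C) (u : C -> C) :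
  (both = true -> s = true) -> a < b -> inI a b z0 -> extends_near s both a b z0 u ->
  exists p n, let d := / (INR n + 1) in
    a <= node a b p n - d /\ node a b p n + d <= b /\ log_ext s both d (node a b p n) (INR n) u.
Proof.
  intros Hsb Hab [t0 [Ht0 Ez0]] (r & lam & Hr & Hlc & Hlh & Hlu).
  assert (Hz0 : Cmod (z0 - z0)%C < r) by (rewrite Cmod_minus_0; auto).
  assert (HI0 : inI a b z0) by (exists t0; auto).
  destruct (Hlc z0 Hz0 (or_introl HI0) 1) as [r1 [Hr1 Hlb]]. lra.
  set (E := fun w : C => Cexp (RtoC (sgn s) * w)).
  assert (HE : forall w, holo E w).
  { intros w. apply (holo_comp (fun w => RtoC (sgn s) * w)%C Cexp). apply holo_mult. apply holo_const. apply holo_id. apply holo_Cexp. }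
  assert (EE : forall x y, (RtoC (sgn s) * (x, y))%C = (sgn s * x, sgn s * y)).
  { intros x y. unfold RtoC, Cmult; simpl. f_equal; ring. }
  assert (E0 : forall t, E (0, sgn s * t) = Cexp_i t).
  { intros t. unfold E. rewrite EE, <- Cexp_imag. f_equal. f_equal. ring.
    rewrite <- Rmult_assoc, sgn_sq. ring. }
  destruct (holo_Ccont _ _ (HE (0, sgn s * t0)) (Rmin r r1)) as [rho [Hrho Hcont]].
  { apply Rmin_glb_lt; auto. }
  rewrite E0, <- Ez0 in Hcont.
  (* All points of the rectangle are within eta + 3 eta < rho of the coordinate of z0; (b - a)/4
     keeps the interval [a + eta, b - eta] nonempty. *)
  set (eta := Rmin (rho / 6) ((b - a) / 4)).
  assert (Heta : 0 < eta) by (apply Rmin_glb_lt; lra).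
  assert (Heta1 : eta <= rho / 6) by apply Rmin_l. assert (Heta2 : eta <= (b - a) / 4) by apply Rmin_r.
  set (t1 := clamp (a + eta) (b - eta) t0).
  assert (Ht1 : a + eta <= t1 <= b - eta) by (apply clamp_in; lra).
  assert (Ht10 : Rabs (t1 - t0) <= eta).
  { unfold t1, clamp, Rmax, Rmin. repeat destruct Rle_dec; apply Rabs_le; lra. }
  destruct (node_approx a b t1 (eta / 2) (Cmod (lam z0) + 1)) as (p & n & Hd & Hd2 & Hn & Hnode); try lra.
  exists p, n. cbv zeta. set (d := / (INR n + 1)) in *. set (c := node a b p n) in *.
  apply Rabs_le_between in Hnode. apply Rabs_le_between in Ht10.
  split; [lra|split; [lra|]].
  assert (Hball : forall w, in_rect (left_end both d) d (sgn s * c - d) (sgn s * c + d) w ->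
    Cmod (E w - z0)%C < r /\ Cmod (E w - z0)%C < r1 /\ (inI a b (E w) \/ on_side s both (E w))).
  { intros [x y] Hw. assert (Hw1 : Cmod (E (x, y) - z0)%C < Rmin r r1).
    { apply Hcont. eapply Rle_lt_trans; [apply Cmod_le_abs|]. simpl.
      assert (Rabs (x + - 0) <= eta).
      { unfold in_rect, left_end in Hw; simpl in Hw. apply Rabs_le. destruct both; lra. }
      assert (Rabs (y + - (sgn s * t0)) <= 3 * eta).
      { unfold in_rect in Hw; simpl in Hw. apply Rabs_le. destruct s; unfold sgn in *; lra. }
      lra. }
    apply Rmin_Rgt in Hw1. destruct Hw1 as [Hw1 Hw2]. split; [exact Hw1|split; [exact Hw2|]].
    destruct both; [right; left; reflexivity|]. unfold in_rect, left_end in Hw; simpl in Hw.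
    destruct (Req_dec x 0) as [->|Hx].
    - left. exists (sgn s * y). split.
      + destruct s; unfold sgn in *; lra.
      + rewrite <- E0. f_equal. f_equal. rewrite <- Rmult_assoc, sgn_sq. ring.
    - right. right. unfold E. rewrite EE, Cmod_Cexp. simpl fst. rewrite <- exp_0.
      destruct s; apply exp_increasing; unfold sgn; lra. }
  assert (Hle : left_end both d <= d) by (unfold left_end; destruct both; lra).
  exists (fun w => lam (E (Cclamp (left_end both d) d (sgn s * c - d) (sgn s * c + d) w))).
  split; [split; [|split]|].
  - apply (Ccont_clamped (fun w => lam (E w))); try lra.
    intros z Hz eps Heps. destruct (Hball z Hz) as (B1 & _ & B3).
    destruct (Hlc _ B1 B3 eps Heps) as [d1 [Hd1 Hd1']].
    destruct (holo_Ccont _ _ (HE z) d1 Hd1) as [d3 [Hd3 Hd3']].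
    exists d3. split; auto. intros w Hw Hwz. destruct (Hball w Hw) as (D1 & _ & D3). auto.
  - intros w Hw. apply (holo_clamped (fun w => lam (E w))); auto.
    destruct (Hball w (in_open_in_rect _ _ _ _ _ Hw)) as (B1 & _ & B3).
    apply (holo_comp E lam); auto. apply Hlh; auto.
    destruct both; [left; reflexivity|]. right. destruct w as [x y].
    unfold E. rewrite EE, Cmod_Cexp. simpl fst. rewrite <- exp_0.
    unfold in_open_rect, left_end in Hw; simpl in Hw.
    destruct s; apply exp_increasing; unfold sgn; lra.
  - intros w Hw. rewrite Cclamp_id by auto. destruct (Hball w Hw) as (B1 & B2 & B3).
    specialize (Hlb _ B1 B3 B2). pose proof (Cmod_le_plus_minus (lam (E w)) (lam z0)). lra.
  - intros t Ht.
    assert (Hrect : in_rect (left_end both d) d (sgn s * c - d) (sgn s * c + d) (0, sgn s * t)).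
    { unfold in_rect, left_end; simpl. destruct both; destruct s; unfold sgn; lra. }
    rewrite Cclamp_id by auto. destruct (Hball _ Hrect) as (B1 & _ & _).
    rewrite E0 in *. apply Hlu; auto. exists t. split; [lra | reflexivity].
Qed.

(** Rotating by exp (- i c) brings z near 1, where [Clog] inverts the exponential. Agreement with u
    is obtained on the whole circle near exp (i c), not only on the arc, so no choice of angle in
    [a, b] has to be discussed. *)
Lemma extends_near_of_log_ext (s both : bool) (d c M : R) (u : C -> C) : 0 < d ->
  log_ext s both d c M u ->
  exists r (lam : C -> C), 0 < r /\ (forall z, Ccont lam z) /\
    (forall z, Cmod (z - Cexp_i c)%C < r -> on_side s both z -> holo lam z) /\
    (forall z, Cmod (z - Cexp_i c)%C < r -> Cmod z = 1 -> lam z = u z).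
Proof.
  intros Hd (Lam & (CL & HL & _) & EL).
  destruct (Clog_Cexp_small d Hd) as (r & Hr & Hr2 & Hsmall).
  set (rot := fun z : C => (z * Cexp (0, - c)%R)%C).
  set (l := fun z : C => (RtoC (sgn s) * (Clog (rot z) + (0, c)))%C).
  assert (Hrot : forall z, holo rot z) by (intros; apply holo_mult; [apply holo_id | apply holo_const]).
  assert (Ec : (Cexp (0, c) * Cexp (0, - c)%R)%C = RtoC 1).
  { rewrite <- Cexp_plus, <- Cexp_0. f_equal. unfold Cplus, RtoC; simpl. f_equal; ring. }
  assert (Drot : forall z, Cmod (rot z - 1)%C = Cmod (z - Cexp_i c)%C).
  { intros z. unfold rot. rewrite <- Ec, <- Cexp_imag.
    replace (z * Cexp (0, - c)%R - Cexp (0, c) * Cexp (0, - c)%R)%C with ((z - Cexp (0, c)) * Cexp (0, - c)%R)%C by ring.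
    rewrite Cmod_mult, Cmod_Cexp. simpl. rewrite exp_0. ring. }
  assert (Mrot : forall z, Cmod (rot z) = Cmod z).
  { intros z. unfold rot. rewrite Cmod_mult, Cmod_Cexp. simpl. rewrite exp_0. ring. }
  assert (Hl : forall z, Cmod (z - Cexp_i c)%C < r -> holo l z).
  { intros z Hz. apply (holo_mult (fun _ => RtoC (sgn s))). apply holo_const.
    apply (holo_plus (fun z => Clog (rot z))). apply (holo_comp rot Clog); auto.
    apply holo_Clog. rewrite Drot. lra. apply holo_const. }
  assert (El : forall z, l z = (sgn s * fst (Clog (rot z)), sgn s * snd (Clog (rot z)) + sgn s * c)).
  { intros z. unfold l. destruct (Clog (rot z)) as [x y]. unfold RtoC, Cmult, Cplus; simpl. f_equal; ring. }
  assert (Eexp : forall z, Cmod (z - Cexp_i c)%C < r -> exp (fst (Clog (rot z))) = Cmod z).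
  { intros z Hz. rewrite <- Cmod_Cexp, Cexp_Clog. apply Mrot. rewrite Drot. lra. }
  assert (Bl : forall z, Cmod (z - Cexp_i c)%C < r -> - d < fst (Clog (rot z)) < d /\ - d < snd (Clog (rot z)) < d).
  { intros z Hz. assert (B : Cmod (Clog (rot z)) < d) by (apply Hsmall; rewrite Drot; auto).
    pose proof (abs_fst_le_Cmod (Clog (rot z))). pose proof (abs_snd_le_Cmod (Clog (rot z))).
    split; [assert (A : Rabs (fst (Clog (rot z))) < d) by lra | assert (A : Rabs (snd (Clog (rot z))) < d) by lra];
    apply Rabs_def2 in A; lra. }
  exists r, (fun z => Lam (l z)). split; [auto|split; [|split]].
  - intros z. apply (Ccont_comp l Lam); auto.
    apply (Ccont_mult (fun _ => RtoC (sgn s))). apply Ccont_const.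
    apply (Ccont_plus (fun z => Clog (rot z))). apply (Ccont_comp rot Clog).
    apply holo_Ccont; auto. apply Ccont_Clog. apply Ccont_const.
  - intros z Hz Hside. apply (holo_comp l Lam); auto. apply HL. rewrite El.
    specialize (Bl z Hz). specialize (Eexp z Hz).
    unfold in_open_rect, left_end; cbn [fst snd].
    assert (both = true \/ 0 < sgn s * fst (Clog (rot z))).
    { destruct Hside as [Hb|Hside]; auto. right. rewrite <- Eexp, <- exp_0 in Hside.
      destruct s; apply exp_lt_inv in Hside; unfold sgn; lra. }
    destruct both, s; unfold sgn in *; destruct H; try discriminate; lra.
  - intros z Hz Hz1. specialize (Bl z Hz). specialize (Eexp z Hz). rewrite Hz1, <- exp_0 in Eexp.
    apply exp_inv in Eexp. rewrite El, Eexp, Rmult_0_r, <- Rmult_plus_distr_l.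
    rewrite EL by lra. f_equal. rewrite <- Cexp_imag.
    replace (Cexp (0, snd (Clog (rot z)) + c)) with (Cexp (Clog (rot z)) * Cexp (0, c))%C.
    + rewrite Cexp_Clog by (rewrite Drot; lra). unfold rot.
      replace (z * Cexp (0, - c)%R * Cexp (0, c))%C with (z * (Cexp (0, c) * Cexp (0, - c)%R))%C by ring.
      rewrite Ec, Cmult_1_r. reflexivity.
    + rewrite <- Cexp_plus. f_equal. unfold Cplus; cbn [fst snd]. rewrite Eexp. f_equal. ring.
Qed.

Lemma log_ext_closure (s both : bool) (d c M : R) (u : C -> C) : 0 < d ->
  (forall eps, 0 < eps -> exists v, log_ext s both d c M v /\
     forall t, c - d <= t <= c + d -> Cmod (u (Cexp_i t) - v (Cexp_i t))%C <= eps) ->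
  exists M', log_ext s both (d / 16) c M' u.
Proof.
  intros Hd H.
  destruct (rect_ext_limit both d (sgn s * c) M (fun x => u (Cexp_i (sgn s * x))) Hd) as (Lam & M' & HL & EL).
  - intros eps Heps. destruct (H eps Heps) as (v & (Lam & HL & EL) & Hv). exists Lam. split; auto.
    intros x Hx. replace (0, x) with (0, sgn s * (sgn s * x)) by (rewrite <- Rmult_assoc, sgn_sq; f_equal; ring).
    assert (Ht : c - d <= sgn s * x <= c + d) by (destruct s; unfold sgn in *; lra).
    rewrite EL by auto. rewrite Cmod_minus_sym. auto.
  - exists M', Lam. split; auto. intros t Ht. rewrite EL by (destruct s; unfold sgn in *; lra).
    rewrite <- Rmult_assoc, sgn_sq, Rmult_1_l. reflexivity.
Qed.

(** * The lacunary series *)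

Definition lac_coef (n : nat) : R := / 2 ^ (n * n).

Lemma lac_coef_pos (n : nat) : 0 < lac_coef n.
Proof. apply Rinv_0_lt_compat, pow_lt. lra. Qed.

Lemma lac_coef_le_1 (n : nat) : lac_coef n <= 1.
Proof.
  unfold lac_coef. rewrite <- Rinv_1. apply Rinv_le_contravar. lra. apply pow_R1_Rle. lra.
Qed.

(** In exponents of 2 this is n (l + 1) <= n^2 + (l + 1)^2. *)
Lemma lac_weight_bound (l n : nat) : 0 <= lac_coef n * (2 ^ n) ^ l <= 2 ^ ((S l) * (S l)) * (/ 2) ^ n.
Proof.
  assert (P : forall k, 0 < 2 ^ k) by (intros; apply pow_lt; lra).
  split. { apply Rmult_le_pos. left; apply lac_coef_pos. apply pow_le. left; auto. }
  unfold lac_coef. rewrite pow_inv, <- pow_mult.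
  apply (Rmult_le_reg_l (2 ^ (n * n))); auto. apply (Rmult_le_reg_r (2 ^ n)); auto.
  replace (2 ^ (n * n) * (/ 2 ^ (n * n) * 2 ^ (n * l)) * 2 ^ n) with (2 ^ (n * l + n))
    by (rewrite pow_add; field; repeat split; apply pow_nonzero; lra).
  replace (2 ^ (n * n) * (2 ^ (S l * S l) * / 2 ^ n) * 2 ^ n) with (2 ^ (n * n + S l * S l))
    by (rewrite pow_add; field; repeat split; apply pow_nonzero; lra).
  apply Rle_pow. lra. nia.
Qed.

Lemma ex_series_lac_weight (l : nat) : ex_series (fun n => lac_coef n * (2 ^ n) ^ l).
Proof.
  apply (ex_series_le (V := R_CompleteNormedModule) _ (fun n => 2 ^ ((S l) * (S l)) * (/ 2) ^ n)).
  - intros n. pose proof (lac_weight_bound l n) as B.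
    change (Rabs (lac_coef n * (2 ^ n) ^ l) <= 2 ^ (S l * S l) * (/ 2) ^ n).
    rewrite Rabs_pos_eq; apply B.
  - apply (ex_series_scal_l (V := R_NormedModule) (2 ^ ((S l) * (S l))) (fun n => (/ 2) ^ n)).
    apply ex_series_geom. rewrite Rabs_pos_eq; lra.
Qed.

(** The [l]-th derivative of [t |-> sum_n 2^(-n^2) cos (2^n t)]. *)
Definition lac (l : nat) (t : R) : R :=
  Series (fun n => lac_coef n * (2 ^ n) ^ l * cos (2 ^ n * t + INR l * (PI / 2))).

Definition lac_sup (l : nat) : R := Series (fun n => lac_coef n * (2 ^ n) ^ l).

Lemma ex_series_le_weight (l : nat) (u : nat -> R) :
  (forall n, Rabs (u n) <= lac_coef n * (2 ^ n) ^ l) -> ex_series u.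
Proof.
  intros H. apply (ex_series_le (V := R_CompleteNormedModule) _ (fun n => lac_coef n * (2 ^ n) ^ l)).
  exact H. apply ex_series_lac_weight.
Qed.

Lemma Series_le_weight (l : nat) (c : R) (u : nat -> R) : 
  (forall n, Rabs (u n) <= lac_coef n * (2 ^ n) ^ l * c) -> Rabs (Series u) <= lac_sup l * c.
Proof.
  intros H. unfold lac_sup. rewrite <- Series_scal_r.
  assert (E : ex_series (fun n => lac_coef n * (2 ^ n) ^ l * c))
    by (apply ex_series_scal_r, ex_series_lac_weight).
  eapply Rle_trans.
  - apply Series_Rabs. apply (ex_series_le (V := R_CompleteNormedModule) _ _) with (2 := E).
    intros n. eapply Rle_trans; [right; apply Rabs_Rabsolu|]. apply H.
  - apply Series_le; auto. intros n. split. apply Rabs_pos. apply H.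
Qed.

Lemma abs_cos_le_1 (x : R) : Rabs (cos x) <= 1.
Proof. apply Rabs_le. pose proof (COS_bound x). lra. Qed.

Lemma lac_term_bound (l : nat) (t : R) (n : nat) :
  Rabs (lac_coef n * (2 ^ n) ^ l * cos (2 ^ n * t + INR l * (PI / 2))) <= lac_coef n * (2 ^ n) ^ l.
Proof.
  rewrite Rabs_mult, Rabs_pos_eq by apply lac_weight_bound.
  pose proof (abs_cos_le_1 (2 ^ n * t + INR l * (PI / 2))).
  pose proof (proj1 (lac_weight_bound l n)). nra.
Qed.

Lemma lac_bound (l : nat) (t : R) : Rabs (lac l t) <= lac_sup l.
Proof.
  rewrite <- (Rmult_1_r (lac_sup l)). apply Series_le_weight. intros n. rewrite Rmult_1_r. apply lac_term_bound.
Qed.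

Lemma cos_taylor (x h : R) : Rabs (cos (x + h) - cos x - h * cos (x + PI / 2)) <= h ^ 2.
Proof.
  destruct (MVT_gen (fun s => cos (x + s) - s * cos (x + PI / 2)) 0 h (fun s => - sin (x + s) - cos (x + PI / 2))) as (s & Hs & E).
  - intros s _. auto_derive; auto. ring.
  - intros s _. apply derivable_continuous_pt. apply ex_derive_Reals_0. auto_derive. auto.
  - rewrite Rplus_0_r in E.
    replace (cos (x + h) - cos x - h * cos (x + PI / 2))
      with (cos (x + h) - h * cos (x + PI / 2) - (cos x - 0 * cos (x + PI / 2))) by ring.
    rewrite E, Rminus_0_r.
    assert (Es : cos (x + PI / 2) = - sin x).
    { rewrite cos_plus, cos_PI2, sin_PI2. ring. }
    rewrite Es.
    assert (B : Rabs (- sin (x + s) - - sin x) <= Rabs s).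
    { destruct (MVT_gen (fun r => - sin (x + r)) 0 s (fun r => - cos (x + r))) as (r & _ & E2).
      - intros r _. auto_derive; auto. ring.
      - intros r _. apply derivable_continuous_pt. apply ex_derive_Reals_0. auto_derive. auto.
      - rewrite Rplus_0_r, Rminus_0_r in E2. rewrite E2, Rabs_mult, Rabs_Ropp.
        pose proof (abs_cos_le_1 (x + r)). pose proof (Rabs_pos s). nra. }
    assert (Hsh : Rabs s <= Rabs h).
    { revert Hs. unfold Rmin, Rmax, Rabs. destruct (Rle_dec 0 h); repeat destruct Rcase_abs; lra. }
    rewrite Rabs_mult, <- (pow2_abs h). pose proof (Rabs_pos h). nra.
Qed.

(** The quadratic remainder of the n-th cosine carries the factor (2^n)^2, whence the sum of weights
    of order l + 2. This one estimate yields all derivatives, without a theorem on termwise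
    differentiation. *)
Lemma lac_taylor (l : nat) (x y : R) :
  Rabs (lac l y - lac l x - (y - x) * lac (S l) x) <= lac_sup (S (S l)) * (y - x) ^ 2.
Proof.
  unfold lac at 1 2 3.
  assert (X : forall l t, ex_series (fun n => lac_coef n * (2 ^ n) ^ l * cos (2 ^ n * t + INR l * (PI / 2))))
    by (intros k t; apply (ex_series_le_weight k); apply lac_term_bound).
  rewrite <- Series_scal_l. rewrite <- !Series_minus; auto.
  2:{ apply (ex_series_minus (V := R_NormedModule)); auto. }
  2:{ apply (ex_series_scal_l (V := R_NormedModule)). auto. }
  apply Series_le_weight. intros n.
  replace (lac_coef n * (2 ^ n) ^ l * cos (2 ^ n * y + INR l * (PI / 2)) -
    lac_coef n * (2 ^ n) ^ l * cos (2 ^ n * x + INR l * (PI / 2)) -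
    (y - x) * (lac_coef n * (2 ^ n) ^ S l * cos (2 ^ n * x + INR (S l) * (PI / 2))))
    with (lac_coef n * (2 ^ n) ^ l * (cos ((2 ^ n * x + INR l * (PI / 2)) + 2 ^ n * (y - x)) -
      cos (2 ^ n * x + INR l * (PI / 2)) - (2 ^ n * (y - x)) * cos ((2 ^ n * x + INR l * (PI / 2)) + PI / 2))).
  2:{ rewrite S_INR. replace (2 ^ n * x + INR l * (PI / 2) + 2 ^ n * (y - x)) with (2 ^ n * y + INR l * (PI / 2)) by ring.
      replace (2 ^ n * x + (INR l + 1) * (PI / 2)) with (2 ^ n * x + INR l * (PI / 2) + PI / 2) by ring.
      simpl. ring. }
  rewrite Rabs_mult, Rabs_pos_eq by apply lac_weight_bound.
  eapply Rle_trans. { apply Rmult_le_compat_l. apply lac_weight_bound. apply cos_taylor. }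
  right. simpl. ring.
Qed.

(** * The series split into a periodic tail and an entire head *)

Definition lac_tail (m : nat) (t : R) : R := Series (fun n => lac_coef (m + n) * cos (2 ^ (m + n) * t)).

Lemma ex_series_lac_tail (m : nat) (t : R) : ex_series (fun n => lac_coef (m + n) * cos (2 ^ (m + n) * t)).
Proof.
  apply (ex_series_incr_n (fun n => lac_coef n * cos (2 ^ n * t)) m).
  apply (ex_series_le_weight 0). intros n. simpl. rewrite Rmult_1_r, Rabs_mult, Rabs_pos_eq by (left; apply lac_coef_pos).
  pose proof (abs_cos_le_1 (2 ^ n * t)). pose proof (lac_coef_pos n). nra.
Qed.

Lemma lac_tail_0 (t : R) : lac_tail 0 t = lac 0 t.
Proof.
  apply Series_ext. intros n. simpl. rewrite Rmult_0_l, Rplus_0_r. ring.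
Qed.

Lemma lac_tail_S (m : nat) (t : R) : lac_tail m t = lac_coef m * cos (2 ^ m * t) + lac_tail (S m) t.
Proof.
  unfold lac_tail. rewrite Series_incr_1 by apply ex_series_lac_tail. rewrite Nat.add_0_r. f_equal.
  apply Series_ext. intros n. rewrite Nat.add_succ_r. reflexivity.
Qed.

Lemma lac_tail_even (m : nat) (t : R) : lac_tail m (- t) = lac_tail m t.
Proof.
  apply Series_ext. intros n. rewrite <- Ropp_mult_distr_r, cos_neg. reflexivity.
Qed.

Lemma lac_tail_period (m : nat) (t : R) : lac_tail m (t + 2 * PI / 2 ^ m) = lac_tail m t.
Proof.
  apply Series_ext. intros n. f_equal.
  replace (2 ^ (m + n) * (t + 2 * PI / 2 ^ m)) with (2 ^ (m + n) * t + 2 * INR (2 ^ n) * PI).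
  - apply cos_period.
  - rewrite pow_INR, pow_add. change (INR 2) with 2. field. apply pow_nonzero. lra.
Qed.

(** From (m + 1 + n)^2 >= m^2 + 3 + n the tail is dominated by a geometric series starting at a_m /
    8, where a_m is the m-th coefficient. The fraction 1/4 lies below 1/2, the mean of cos^2, so the
    m-th term dominates when its Fourier coefficient is computed. *)
Lemma lac_tail_small (m : nat) (t : R) : (1 <= m)%nat -> Rabs (lac_tail (S m) t) <= lac_coef m / 4.
Proof.
  intros Hm. unfold lac_tail.
  assert (B : forall n, Rabs (lac_coef (S m + n) * cos (2 ^ (S m + n) * t)) <= lac_coef m / 8 * (/ 2) ^ n).
  { intros n. rewrite Rabs_mult, Rabs_pos_eq by (left; apply lac_coef_pos).
    pose proof (abs_cos_le_1 (2 ^ (S m + n) * t)). pose proof (lac_coef_pos (S m + n)).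
    apply Rle_trans with (lac_coef (S m + n)). nra.
    unfold lac_coef. rewrite pow_inv.
    replace (/ 2 ^ (m * m) / 8 * / 2 ^ n) with (/ 2 ^ (m * m + 3 + n)).
    - apply Rinv_le_contravar. apply pow_lt; lra. apply Rle_pow. lra. nia.
    - rewrite !pow_add. field. split; apply pow_nonzero; lra. }
  assert (G : ex_series (fun n => lac_coef m / 8 * (/ 2) ^ n)).
  { apply (ex_series_scal_l (V := R_NormedModule)). apply ex_series_geom. rewrite Rabs_pos_eq; lra. }
  eapply Rle_trans. { apply Series_Rabs.
    apply (ex_series_le (V := R_CompleteNormedModule) _ _) with (2 := G).
    intros n. eapply Rle_trans; [right; apply Rabs_Rabsolu|]. apply B. }
  eapply Rle_trans. { apply Series_le. intros n. split. apply Rabs_pos. apply B. exact G. }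
  rewrite Series_scal_l, Series_geom by (rewrite Rabs_pos_eq; lra). right. field.
Qed.

(** The sum of the first m terms continued from the edge w = i x to an entire function, each cosine
    being half a sum of two exponentials. *)
Fixpoint lac_head (m : nat) (w : C) : C :=
  match m with
  | O => RtoC 0
  | S p => (lac_head p w + RtoC (lac_coef p / 2) * (Cexp (RtoC (2 ^ p) * w) + Cexp (RtoC (- 2 ^ p) * w)))%C
  end.

Lemma holo_lac_head (m : nat) (w : C) : holo (lac_head m) w.
Proof.
  induction m as [|m IH]; simpl. apply holo_const.
  apply holo_plus; auto. apply holo_mult. apply holo_const.
  apply holo_plus; apply (holo_comp _ Cexp); try apply holo_Cexp; apply holo_mult; try apply holo_const; apply holo_id.
Qed.

Lemma lac_head_edge (m : nat) (x : R) : (lac_head m (0, x) + RtoC (lac_tail m x))%C = RtoC (lac 0 x).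
Proof.
  induction m as [|m IH].
  - simpl. rewrite lac_tail_0. ring.
  - rewrite <- IH, (lac_tail_S m). cbn [lac_head].
    assert (E : (RtoC (lac_coef m / 2) * (Cexp (RtoC (2 ^ m) * (0, x)) + Cexp (RtoC (- 2 ^ m) * (0, x))))%C
      = RtoC (lac_coef m * cos (2 ^ m * x))).
    { unfold Cexp, Cmult, Cplus, RtoC; simpl.
      replace (2 ^ m * 0 - 0 * x) with 0 by ring. replace (- 2 ^ m * 0 - 0 * x) with 0 by ring.
      replace (2 ^ m * x + 0 * 0) with (2 ^ m * x) by ring.
      replace (- 2 ^ m * x + 0 * 0) with (- (2 ^ m * x)) by ring.
      rewrite exp_0, cos_neg, sin_neg. f_equal; field. }
    rewrite E, RtoC_plus. ring.
Qed.

(** The highest frequency in the head is 2^(m-1). Its growth rate is thus half of 2^m, and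
    multiplication by exp (- 2^m w) makes the head exponentially small. *)
Lemma lac_head_bound (m : nat) (w : C) : 0 <= fst w ->
  Cmod (lac_head m w) <= INR m * exp (2 ^ m * fst w / 2).
Proof.
  intros Hw. induction m as [|m IH].
  - simpl. rewrite Cmod_0. lra.
  - cbn [lac_head]. eapply Rle_trans; [apply Cmod_triangle|].
    assert (P : 0 < 2 ^ m) by (apply pow_lt; lra).
    assert (E : exp (2 ^ m * fst w / 2) <= exp (2 ^ S m * fst w / 2)).
    { simpl. destruct (Req_dec (fst w) 0) as [->|Hn]. right. f_equal. field.
      left. apply exp_increasing. nra. }
    assert (B : Cmod (RtoC (lac_coef m / 2) * (Cexp (RtoC (2 ^ m) * w) + Cexp (RtoC (- 2 ^ m) * w)))%C
      <= exp (2 ^ S m * fst w / 2)).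
    { rewrite Cmod_mult, Cmod_R. pose proof (lac_coef_pos m). pose proof (lac_coef_le_1 m).
      rewrite Rabs_pos_eq by lra.
      assert (T := Cmod_triangle (Cexp (RtoC (2 ^ m) * w)) (Cexp (RtoC (- 2 ^ m) * w))).
      rewrite !Cmod_Cexp in T. unfold Cmult, RtoC in T; cbn [fst snd] in T.
      assert (E1 : exp (- 2 ^ m * fst w - 0 * snd w) <= exp (2 ^ S m * fst w / 2)).
      { simpl. destruct (Req_dec (fst w) 0) as [->|Hn]. right. f_equal. field.
        left. apply exp_increasing. nra. }
      assert (E2 : exp (2 ^ m * fst w - 0 * snd w) = exp (2 ^ S m * fst w / 2)).
      { f_equal. simpl. field. }
      rewrite E2 in T. pose proof (exp_pos (2 ^ S m * fst w / 2)).
      (* Unfolding has altered the left side of [T]; the goal is converted to the same form so that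
         both become one atom [q]. *)
      match type of T with ?a <= _ => pose proof (Cmod_ge_0 (Cexp (RtoC (2 ^ m) * w) + Cexp (RtoC (- 2 ^ m) * w))%C) as G;
        change (Cmod (Cexp (RtoC (2 ^ m) * w) + Cexp (RtoC (- 2 ^ m) * w))%C) with a; set (q := a) in * end.
      assert (q <= 2 * exp (2 ^ S m * fst w / 2)) by lra.
      assert (0 <= q) by exact G. nra. }
    rewrite S_INR. pose proof (pos_INR m). nra.
Qed.

(** For m = 4 i and t = i + 1, Bernoulli's inequality gives 2^m = (2^i)^4 >= t^4. On the other side
    K (1 + m) <= exp (K + m) and 2^(-m^2) >= exp (- m^2), so it suffices that K + m + m^2 < k t^4.
    The left side is at most (16 + K) t^2, and t is chosen with k t > 16 + K. *)
Lemma lac_growth (k K : R) : 0 < k -> 0 <= K -> forall m0 : nat, exists m, (m0 <= m)%nat /\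
  K * (1 + INR m) * exp (- (k * 2 ^ m)) < lac_coef m.
Proof.
  intros Hk HK m0.
  destruct (nfloor_ex (Rmax 1 ((16 + K) / k))) as [j [_ Hj]].
  { eapply Rle_trans; [|apply Rmax_l]. lra. }
  pose proof (Rmax_l 1 ((16 + K) / k)). pose proof (Rmax_r 1 ((16 + K) / k)).
  set (i := (j + m0)%nat). set (t := INR i + 1).
  assert (Ht : INR j + 1 <= t) by (unfold t, i; rewrite plus_INR; pose proof (pos_INR m0); lra).
  assert (Ht2 : (16 + K) / k < t) by lra. apply Rlt_div_l in Ht2; auto.
  exists (4 * i)%nat. split. unfold i; lia.
  set (m := (4 * i)%nat). assert (Em : INR m = 4 * (t - 1)) by (unfold m, t; rewrite mult_INR; simpl; ring).
  assert (H2m : t ^ 4 <= 2 ^ m).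
  { unfold m. rewrite Nat.mul_comm, pow_mult. apply pow_incr. split. unfold t; pose proof (pos_INR i); lra.
    pose proof (poly i 1 ltac:(lra)) as HB. unfold t. replace (1 + 1) with 2 in HB by ring. lra. }
  assert (E1 : K * (1 + INR m) <= exp (K + INR m)).
  { rewrite exp_plus. pose proof (exp_ineq1_le K). pose proof (exp_ineq1_le (INR m)). pose proof (pos_INR m).
    apply Rmult_le_compat; lra. }
  assert (E2 : exp (- (INR m * INR m)) <= lac_coef m).
  { unfold lac_coef. rewrite exp_Ropp. apply Rinv_le_contravar. apply pow_lt; lra.
    rewrite <- mult_INR. rewrite <- (exp_ln (2 ^ (m * m))) by (apply pow_lt; lra).
    rewrite ln_pow by lra. pose proof ln_lt_2. pose proof (pos_INR (m * m)).
    assert (ln 2 < 1). { rewrite <- (ln_exp 1). apply ln_increasing. lra. pose proof (exp_ineq1 1 ltac:(lra)). lra. }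
    assert (H5 : INR (m * m) * ln 2 <= INR (m * m)) by nra.
    destruct (Rle_lt_or_eq_dec _ _ H5) as [L | ->]. left. apply exp_increasing; auto. lra. }
  apply Rlt_le_trans with (2 := E2).
  apply Rle_lt_trans with (exp (K + INR m) * exp (- (k * 2 ^ m))).
  { apply Rmult_le_compat_r; auto. left; apply exp_pos. }
  rewrite <- exp_plus. apply exp_increasing.
  assert (B : (16 + K) * t ^ 2 < k * t ^ 4).
  { replace (k * t ^ 4) with (t * k * t * t ^ 2) by ring.
    apply Rmult_lt_compat_r. apply pow_lt; lra. nra. }
  assert (k * t ^ 4 <= k * 2 ^ m) by nra.
  rewrite Em. assert (1 <= t ^ 2) by nra. assert (K <= K * t ^ 2) by nra. nra.
Qed.

(** An extension of the lacunary series minus its first [m] terms inherits the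
    period [2 PI / 2^m] of the boundary values, so that the horizontal sides
    cancel in Cauchy's theorem over one period and the coefficient [m] decays
    like [exp (- 2^m y)]. *)
Lemma lac_no_rect_ext (d c M : R) (Lam : C -> C) : 0 < d -> rect_ext false d c M Lam ->
  ~ (forall x, c - d <= x <= c + d -> Lam (0, x) = RtoC (lac 0 x)).
Proof.
  intros Hd (CL & HL & BL) EL. unfold left_end in HL, BL.
  assert (HM : 0 <= M).
  { eapply Rle_trans; [apply Cmod_ge_0|]. apply (BL (0, c)). unfold in_rect; simpl. lra. }
  (* The two-constants estimate is used below with half-size d / 2 and is valid up to abscissa (d /
     2) / 16. *)
  set (y0 := d / 32).
  destruct (nfloor_ex (32 / d)) as [m1 [_ Hm1]]. { left. apply Rdiv_lt_0_compat; lra. }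
  (* The rate and the constant are those of the upper bound 8 (M + 1)(1 + m) exp (- N y0 / 2)
     reached at the end. Taking m > m1 makes one period at most d / 4. *)
  destruct (lac_growth (y0 / 2) (8 * (M + 1)) ltac:(unfold y0; lra) ltac:(lra) (S m1)) as (m & Hm & Hgrowth).
  set (N := 2 ^ m) in *.
  assert (HN : 1 + INR m <= N).
  { unfold N. pose proof (poly m 1 ltac:(lra)) as HB. replace (1 + 1) with 2 in HB by ring. lra. }
  pose proof (pos_INR m) as Hm0.
  assert (Hm2 : 32 / d < INR m). { apply le_INR in Hm. rewrite S_INR in Hm. lra. }
  set (h := 2 * PI / N).
  assert (Hh : 0 < h) by (apply Rdiv_lt_0_compat; pose proof PI_RGT_0; lra).
  assert (Hhd : h <= d / 4).
  { unfold h. apply Rle_div_l. lra. apply Rlt_div_l in Hm2; auto. pose proof PI_4. nra. }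
  set (T := fun w => (Lam w - lac_head m w)%C).
  assert (CT : forall w, Ccont T w) by (intros; apply Ccont_minus; auto; apply holo_Ccont, holo_lac_head).
  assert (HT : forall w, in_open_rect 0 d (c - d) (c + d) w -> holo T w)
    by (intros; apply holo_minus; auto; apply holo_lac_head).
  assert (ET : forall x, c - d <= x <= c + d -> T (0, x) = RtoC (lac_tail m x)).
  { intros x Hx. unfold T. rewrite EL by auto. rewrite <- (lac_head_edge m). ring. }
  assert (BT : forall w, in_rect 0 d (c - d) (c + d) w -> Cmod (T w) <= M + INR m * exp (N * fst w / 2)).
  { intros w Hw. unfold T, Cminus. eapply Rle_trans; [apply Cmod_triangle|]. rewrite Cmod_opp.
    apply Rplus_le_compat; auto. apply lac_head_bound. apply Hw. }
  assert (Hper : forall x y, 0 <= x <= y0 -> c - d / 4 <= y <= c + d / 4 -> T (x, y + h) = T (x, y)).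
  { intros x y Hx Hy. apply Ceq_minus, Cmod_eq_0. apply Rle_antisym; [|apply Cmod_ge_0].
    apply Rnot_lt_le. intros Hpos.
    (* The difference T(w + i h) - T(w) vanishes on the edge, so it meets the hypotheses for every
       eta; half of its supposed modulus gives a contradiction. Half-size d / 2 leaves room for the
       shift h <= d / 4. *)
    destruct (two_constants (d / 2) c (2 * (M + INR m * exp (N * d / 2))) (Cmod (T (x, y + h)%R - T (x, y))%C / 2))
      as (eps & Heps & TC); try lra.
    assert (Esh : forall a b : R, ((a, b) + (0, h))%C = (a, b + h)) by (intros; unfold Cplus; simpl; f_equal; ring).
    assert (Hsh : forall w, holo (fun w => w + (0, h))%C w) by (intros; apply holo_plus; [apply holo_id | apply holo_const]).
    assert (B : Cmod (T ((x, y) + (0, h))%C - T (x, y))%C <= Cmod (T (x, y + h)%R - T (x, y))%C / 2).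
    { apply (TC (fun w => T (w + (0, h)) - T w)%C).
      - intros w. apply Ccont_minus; auto. apply (Ccont_comp (fun w => w + (0, h))%C T); auto. apply holo_Ccont; auto.
      - intros [p q] Hw. unfold in_open_rect in Hw; simpl in Hw. apply holo_minus.
        + apply (holo_comp (fun w => w + (0, h))%C T); auto. apply HT. rewrite Esh. unfold in_open_rect; simpl. lra.
        + apply HT. unfold in_open_rect; simpl. lra.
      - intros [p q] Hw. unfold in_rect in Hw; simpl in Hw.
        unfold Cminus. eapply Rle_trans; [apply Cmod_triangle|]. rewrite Cmod_opp, Esh.
        assert (E : exp (N * p / 2) <= exp (N * d / 2)).
        { destruct (Req_dec p d) as [->|Hp]. lra. left. apply exp_increasing. nra. }
        assert (B1 := BT (p, q + h) ltac:(unfold in_rect; simpl; lra)).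
        assert (B2 := BT (p, q) ltac:(unfold in_rect; simpl; lra)). simpl in B1, B2. nra.
      - intros q Hq. rewrite Esh, !ET by lra. unfold h, N. rewrite lac_tail_period, Cmod_minus_0. lra.
      - unfold in_rect, y0 in *; simpl. lra. }
    rewrite Esh in B. lra. }
  (* The factor exp (- N w) also has period i h; integrated over one period on the edge, [G] gives
     the Fourier coefficient of frequency N of the tail. *)
  set (G := fun w : C => (T w * Cexp (RtoC (- N) * w))%C).
  assert (HE : forall w, holo (fun w => Cexp (RtoC (- N) * w))%C w).
  { intros w. apply (holo_comp (fun w => RtoC (- N) * w)%C Cexp). apply holo_mult. apply holo_const. apply holo_id. apply holo_Cexp. }
  assert (CG : forall w, Ccont G w) by (intros; apply Ccont_mult; auto; apply holo_Ccont; auto).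
  assert (HNe : forall x y, (RtoC (- N) * (x, y))%C = (- N * x, - N * y))
    by (intros; unfold RtoC, Cmult; simpl; f_equal; ring).
  assert (Hy0 : 0 < y0) by (unfold y0; lra).
  assert (J : rect_int G 0 y0 c (c + h) = RtoC 0).
  { apply cauchy_rect; auto; try lra. intros w Hw. apply holo_mult; auto. apply HT.
    unfold in_open_rect, y0 in *. lra. }
  assert (V : CInt (fun y => G (y0, y)) c (c + h) = CInt (fun y => G (0, y)) c (c + h)).
  { unfold rect_int in J. rewrite (CInt_ext (fun x => G (x, c + h)) (fun x => G (x, c)) 0 y0) in J; try lra.
    2:{ intros x Hx. unfold G. rewrite Hper by lra. f_equal. rewrite !HNe. unfold Cexp; simpl.
        replace (- N * (c + h)) with (- N * c - 2 * PI) by (unfold h; field; lra).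
        rewrite cos_minus, sin_minus, cos_2PI, sin_2PI. f_equal; ring. }
    apply Ceq_minus.
    replace (CInt (fun y => G (y0, y)) c (c + h) - CInt (fun y => G (0, y)) c (c + h))%C
      with (- Ci * (Ci * CInt (fun y => G (y0, y)) c (c + h) - Ci * CInt (fun y => G (0, y)) c (c + h)))%C.
    - match type of J with ?X = _ => match goal with |- (- Ci * ?Y)%C = _ => replace Y with X by ring end end.
      rewrite J. ring.
    - match goal with |- (- Ci * (Ci * ?p - Ci * ?q) = _)%C =>
        replace (- Ci * (Ci * p - Ci * q))%C with (- (Ci * Ci) * (p - q))%C by ring end.
      replace (Ci * Ci)%C with (- RtoC 1)%C. ring. unfold Ci, RtoC, Cmult, Copp; simpl. f_equal; ring. }
  assert (XV : forall x, Cex_RInt (fun y => G (x, y)) c (c + h)).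
  { intros x. apply Cex_RInt_ver. lra. auto. }
  (* On the line x = y0 the factor exp (- N y0) outweighs the growth exp (N y0 / 2) of the head. *)
  assert (Up : Cmod (CInt (fun y => G (y0, y)) c (c + h)) <=
    2 * h * ((M + INR m * exp (N * y0 / 2)) * exp (- (N * y0)))).
  { replace (2 * h) with (2 * ((c + h) - c)) by ring. apply CInt_bound; auto. lra.
    intros t Ht. unfold G. rewrite Cmod_mult, HNe, Cmod_Cexp. cbn [fst].
    replace (- N * y0) with (- (N * y0)) by ring. apply Rmult_le_compat_r. left; apply exp_pos.
    apply (BT (y0, t)). unfold in_rect, y0; simpl. lra. }
  assert (Lo : lac_coef m * h / 4 <= fst (CInt (fun y => G (0, y)) c (c + h))).
  { change (lac_coef m * h / 4 <= RInt (fun t => fst (G (0, t))) c (c + h)).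
    (* With a the m-th coefficient and r the next tail, the real part of G(i t) is a cos^2 (N t) + r
       cos (N t). As |r| <= a / 4, it is at least a (1/4 + cos (2 N t) / 2), whose mean is a / 4. *)
    assert (Ep : is_RInt (fun t => lac_coef m * (/ 4 + cos (2 * N * t) / 2)) c (c + h) (lac_coef m * h / 4)).
    { replace (lac_coef m * h / 4) with
        (minus (lac_coef m * ((c + h) / 4 + sin (2 * N * (c + h)) / (4 * N))) (lac_coef m * (c / 4 + sin (2 * N * c) / (4 * N)))).
      - apply (is_RInt_derive (V := R_CompleteNormedModule) (fun t => lac_coef m * (t / 4 + sin (2 * N * t) / (4 * N)))).
        + intros t _. auto_derive; auto. field. lra.
        + intros t _. apply (ex_derive_continuous (V := R_NormedModule)). auto_derive. auto.
      - replace (2 * N * (c + h)) with (2 * N * c + 2 * INR 2 * PI).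
        + rewrite sin_period. unfold minus, plus, opp; simpl. field. lra.
        + change (INR 2) with 2. unfold h. field. lra. }
    rewrite <- (is_RInt_unique _ _ _ _ Ep). apply RInt_le; try lra.
    - eexists; exact Ep.
    - exact (proj1 (XV 0)).
    - intros t Ht. unfold G. rewrite ET by (unfold y0 in *; lra). rewrite HNe. unfold Cexp, RtoC, Cmult; simpl.
      replace (- N * 0) with 0 by ring. rewrite exp_0.
      replace (- N * t) with (- (N * t)) by ring. rewrite cos_neg.
      rewrite lac_tail_S. fold N.
      pose proof (lac_tail_small m t ltac:(lia)) as Hs. apply Rabs_le_between in Hs.
      pose proof (COS_bound (N * t)). replace (2 * N * t) with (2 * (N * t)) by ring. rewrite cos_2a_cos.
      set (k := cos (N * t)) in *. set (r := lac_tail (S m) t) in *. set (a := lac_coef m) in *.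
      assert (- (a / 4) <= r * k) by nra. nra. }
  assert (Hfst := abs_fst_le_Cmod (CInt (fun y => G (y0, y)) c (c + h))). rewrite V in Hfst at 1.
  assert (Rle_abs' := Rle_abs (fst (CInt (fun y => G (0, y)) c (c + h)))).
  assert (Fin1 : lac_coef m * h / 4 <= 2 * h * ((M + INR m * exp (N * y0 / 2)) * exp (- (N * y0)))) by lra.
  assert (Fin2 : lac_coef m <= 8 * ((M + INR m * exp (N * y0 / 2)) * exp (- (N * y0)))).
  { apply (Rmult_le_reg_l (h / 4)). lra. lra. }
  replace (- (y0 / 2 * N)) with (- (N * y0 / 2)) in Hgrowth by field.
  assert (E1 : exp (- (N * y0)) = exp (- (N * y0 / 2)) * exp (- (N * y0 / 2))) by (rewrite <- exp_plus; f_equal; field).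
  assert (E2 : exp (N * y0 / 2) * exp (- (N * y0 / 2)) = 1) by (rewrite <- exp_plus, <- exp_0; f_equal; ring).
  assert (E3 : exp (- (N * y0 / 2)) <= 1).
  { rewrite <- exp_0. left. apply exp_increasing. assert (0 < N * y0) by (apply Rmult_lt_0_compat; lra). lra. }
  pose proof (exp_pos (- (N * y0 / 2))) as E4.
  set (e := exp (- (N * y0 / 2))) in *.
  replace ((M + INR m * exp (N * y0 / 2)) * exp (- (N * y0))) with (M * (e * e) + INR m * e) in Fin2.
  2:{ rewrite E1. replace ((M + INR m * exp (N * y0 / 2)) * (e * e))
        with (M * (e * e) + INR m * (exp (N * y0 / 2) * e) * e) by ring. rewrite E2. ring. }
  assert (M * (e * e) <= M * e) by (apply Rmult_le_compat_l; nra).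
  assert (8 * (M + 1) * (1 + INR m) * e = 8 * (M * e) + 8 * (M * INR m * e) + 8 * e + 8 * (INR m * e)) by ring.
  assert (0 <= M * INR m * e) by (repeat apply Rmult_le_pos; lra). lra.
Qed.

(** * The classes of non-extendable functions *)

Lemma Cnorm_Cmod (z : C) : Cnorm z = Cmod z.
Proof. unfold Cnorm, Cmod. f_equal. ring. Qed.

Lemma Cmod_Cexp_i (t : R) : Cmod (Cexp_i t) = 1.
Proof. rewrite <- Cexp_imag, Cmod_Cexp. apply exp_0. Qed.

Lemma inI_Cmod (a b : R) (z : C) : inI a b z -> Cmod z = 1.
Proof. intros [t [_ ->]]. apply Cmod_Cexp_i. Qed.

(** * Derivatives on the arc and perturbation by the lacunary series *)

Lemma has_deriv_within_unique (a b : R) (f g : R -> C) (x : R) (d1 d2 : C) : a < b -> a <= x <= b ->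
  (forall t, a <= t <= b -> f t = g t) ->
  has_deriv_within a b f x d1 -> has_deriv_within a b g x d2 -> d1 = d2.
Proof.
  intros Hab Hx Hfg H1 H2. apply Ceq_minus, Cmod_eq_0. apply Rle_antisym; [|apply Cmod_ge_0].
  apply Rnot_lt_le. intros Hk. set (k := Cmod (d1 - d2)%C) in *.
  destruct (H1 (k / 4) ltac:(lra)) as [e1 [He1 K1]]. destruct (H2 (k / 4) ltac:(lra)) as [e2 [He2 K2]].
  assert (Hy : exists y, a <= y <= b /\ y <> x /\ Rabs (y - x) < e1 /\ Rabs (y - x) < e2).
  { set (e := Rmin (Rmin e1 e2) ((b - a) / 2) / 2).
    assert (Hr : 0 < Rmin (Rmin e1 e2) ((b - a) / 2)) by (repeat apply Rmin_glb_lt; lra).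
    assert (He : 0 < e) by (unfold e; lra).
    pose proof (Rmin_l (Rmin e1 e2) ((b - a) / 2)). pose proof (Rmin_r (Rmin e1 e2) ((b - a) / 2)).
    pose proof (Rmin_l e1 e2). pose proof (Rmin_r e1 e2).
    (* Derivatives at the endpoints are one-sided, so the test point is taken on the side of x where
       at least half of the interval lies. *)
    destruct (Rle_lt_dec x ((a + b) / 2)).
    - exists (x + e). replace (x + e - x) with e by ring. rewrite Rabs_pos_eq by lra. unfold e in *. lra.
    - exists (x - e). replace (x - e - x) with (- e) by ring. rewrite Rabs_Ropp, Rabs_pos_eq by lra. unfold e in *. lra. }
  destruct Hy as (y & Hy & Hyx & Hy1 & Hy2).
  specialize (K1 y Hy Hy1). specialize (K2 y Hy Hy2). rewrite Cnorm_Cmod in K1, K2.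
  rewrite <- (Hfg y Hy), <- (Hfg x Hx) in K2.
  change (Cmod (f y - f x - RtoC (y - x) * d1)%C <= k / 4 * Rabs (y - x)) in K1.
  change (Cmod (f y - f x - RtoC (y - x) * d2)%C <= k / 4 * Rabs (y - x)) in K2.
  assert (E : Cmod (RtoC (y - x) * (d1 - d2))%C <= k / 2 * Rabs (y - x)).
  { replace (RtoC (y - x) * (d1 - d2))%C with
      ((f y - f x - RtoC (y - x) * d2) - (f y - f x - RtoC (y - x) * d1))%C by ring.
    unfold Cminus at 1. eapply Rle_trans; [apply Cmod_triangle|]. rewrite Cmod_opp. lra. }
  rewrite Cmod_mult, Cmod_R in E. fold k in E.
  assert (0 < Rabs (y - x)) by (apply Rabs_pos_lt; lra). nra.
Qed.

Lemma le_ext_S (l : nat) (k : ext_nat) : le_ext (S l) k -> le_ext l k.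
Proof. destruct k; simpl; auto. lia. Qed.

(** [near] quantifies over all derivative chains; uniqueness lets it be verified on the explicit
    ones. *)
Lemma deriv_chain_unique (a b : R) (k : ext_nat) (g : R -> C) (d d' : nat -> R -> C) : a < b ->
  deriv_chain a b k g d -> deriv_chain a b k g d' ->
  forall l, le_ext l k -> forall t, a <= t <= b -> d l t = d' l t.
Proof.
  intros Hab (H0 & _ & H1) (H0' & _ & H1'). induction l as [|l IH]; intros Hl t Ht.
  - rewrite H0, H0'; auto.
  - apply (has_deriv_within_unique a b (d l) (d' l) t); auto. intros s Hs. apply IH; auto. apply le_ext_S; auto.
Qed.

Lemma deriv_chain_plus_scal (a b : R) (k : ext_nat) (f g : R -> C) (df dg : nat -> R -> C) (tau : R) :
  deriv_chain a b k f df -> deriv_chain a b k g dg ->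
  deriv_chain a b k (fun t => f t + RtoC tau * g t)%C (fun l t => df l t + RtoC tau * dg l t)%C.
Proof.
  intros (F0 & F1 & F2) (G0 & G1 & G2).
  pose proof (Rabs_pos tau) as Htau.
  assert (Hsplit : forall eps, 0 < eps -> 0 < eps / (2 * (Rabs tau + 1)) /\
     Rabs tau * (eps / (2 * (Rabs tau + 1))) <= eps / 2).
  { intros eps Heps. assert (P : 0 < eps / (2 * (Rabs tau + 1))) by (apply Rdiv_lt_0_compat; lra).
    split; auto. apply Rle_trans with ((Rabs tau + 1) * (eps / (2 * (Rabs tau + 1)))). nra. right. field. lra. }
  split; [|split].
  - intros t Ht. rewrite F0, G0; auto.
  - intros l Hl x Hx eps Heps. destruct (Hsplit eps Heps) as [He Hle].
    destruct (F1 l Hl x Hx (eps / 2) ltac:(lra)) as [e1 [He1 K1]]. destruct (G1 l Hl x Hx _ He) as [e2 [He2 K2]].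
    exists (Rmin e1 e2). split. apply Rmin_glb_lt; auto. intros y Hy Hyx. apply Rmin_Rgt in Hyx. destruct Hyx as [Y1 Y2].
    specialize (K1 y Hy Y1). specialize (K2 y Hy Y2). rewrite Cnorm_Cmod in *.
    change (Cmod (df l y - df l x)%C < eps / 2) in K1. change (Cmod (dg l y - dg l x)%C < eps / (2 * (Rabs tau + 1))) in K2.
    change (Cmod ((df l y + RtoC tau * dg l y) - (df l x + RtoC tau * dg l x))%C < eps).
    replace ((df l y + RtoC tau * dg l y) - (df l x + RtoC tau * dg l x))%C
      with ((df l y - df l x) + RtoC tau * (dg l y - dg l x))%C by ring.
    eapply Rle_lt_trans; [apply Cmod_triangle|]. rewrite Cmod_mult, Cmod_R.
    assert (Rabs tau * Cmod (dg l y - dg l x)%C <= Rabs tau * (eps / (2 * (Rabs tau + 1)))) by (apply Rmult_le_compat_l; lra).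
    lra.
  - intros l Hl x Hx eps Heps. destruct (Hsplit eps Heps) as [He Hle].
    destruct (F2 l Hl x Hx (eps / 2) ltac:(lra)) as [e1 [He1 K1]]. destruct (G2 l Hl x Hx _ He) as [e2 [He2 K2]].
    exists (Rmin e1 e2). split. apply Rmin_glb_lt; auto. intros y Hy Hyx. apply Rmin_Rgt in Hyx. destruct Hyx as [Y1 Y2].
    specialize (K1 y Hy Y1). specialize (K2 y Hy Y2). rewrite Cnorm_Cmod in *.
    set (h := RtoC (y - x)).
    change (Cmod (df l y - df l x - h * df (S l) x)%C <= eps / 2 * Rabs (y - x)) in K1.
    change (Cmod (dg l y - dg l x - h * dg (S l) x)%C <= eps / (2 * (Rabs tau + 1)) * Rabs (y - x)) in K2.
    change (Cmod ((df l y + RtoC tau * dg l y) - (df l x + RtoC tau * dg l x)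
       - h * (df (S l) x + RtoC tau * dg (S l) x))%C <= eps * Rabs (y - x)).
    replace ((df l y + RtoC tau * dg l y) - (df l x + RtoC tau * dg l x)
       - h * (df (S l) x + RtoC tau * dg (S l) x))%C
      with ((df l y - df l x - h * df (S l) x) + RtoC tau * (dg l y - dg l x - h * dg (S l) x))%C by ring.
    eapply Rle_trans; [apply Cmod_triangle|]. rewrite Cmod_mult, Cmod_R.
    assert (Rabs tau * Cmod (dg l y - dg l x - h * dg (S l) x)%C <= Rabs tau * (eps / (2 * (Rabs tau + 1)) * Rabs (y - x)))
      by (apply Rmult_le_compat_l; lra).
    pose proof (Rabs_pos (y - x)). nra.
Qed.

(** The Chebyshev polynomial of degree 2^n, by iterated angle doubling. Elements of [Ck] are
    functions of z, so cos (2^n t) has to be written without the angle t. *)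
Fixpoint cheb (n : nat) (x : R) : R := match n with O => x | S p => 2 * cheb p x * cheb p x - 1 end.

Lemma cheb_cos (n : nat) (t : R) : cheb n (cos t) = cos (2 ^ n * t).
Proof.
  induction n as [|n IH]; simpl.
  - f_equal. ring.
  - rewrite IH. replace (2 * 2 ^ n * t) with (2 * (2 ^ n * t)) by ring. rewrite cos_2a_cos. ring.
Qed.

(** The lacunary series as a function of [z = exp (i t)]: [cos (2^n t)] is an
    iterated Chebyshev polynomial of [Re z]. *)
Definition lac_fun (z : C) : C := RtoC (Series (fun n => lac_coef n * cheb n (fst z))).

Lemma lac_fun_circle (t : R) : lac_fun (Cexp_i t) = RtoC (lac 0 t).
Proof.
  unfold lac_fun, lac. f_equal. apply Series_ext. intros n. cbn [Cexp_i fst INR pow].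
  rewrite cheb_cos, Rmult_1_r, Rmult_0_l, Rplus_0_r. reflexivity.
Qed.

Lemma lac_has_deriv_within (a b : R) (l : nat) (x : R) :
  has_deriv_within a b (fun t => RtoC (lac l t)) x (RtoC (lac (S l) x)).
Proof.
  intros eps Heps. set (B := lac_sup (S (S l))).
  assert (HB : 0 <= B). { eapply Rle_trans; [apply Rabs_pos | apply (lac_bound (S (S l)) 0)]. }
  exists (eps / (B + 1)). split. { apply Rdiv_lt_0_compat; lra. }
  intros y _ Hy. rewrite Cnorm_Cmod.
  replace (Csub _ _) with (RtoC (lac l y - lac l x - (y - x) * lac (S l) x)).
  2:{ unfold Csub, Cmul, Defs.RtoC, RtoC; simpl. f_equal; ring. }
  rewrite Cmod_R. eapply Rle_trans; [apply lac_taylor|]. fold B.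
  rewrite <- pow2_abs. pose proof (Rabs_pos (y - x)). apply Rlt_div_r in Hy; [|lra]. nra.
Qed.

Lemma cont_within_of_deriv (a b : R) (f : R -> C) (d : R -> C) :
  (forall x, a <= x <= b -> has_deriv_within a b f x (d x)) -> cont_within a b f.
Proof.
  intros H x Hx eps Heps. destruct (H x Hx 1 ltac:(lra)) as [e [He K]].
  pose proof (Cmod_ge_0 (d x)) as Hd.
  exists (Rmin e (eps / (2 + Cmod (d x)))). split. { apply Rmin_glb_lt; auto. apply Rdiv_lt_0_compat; lra. }
  intros y Hy Hyx. apply Rmin_Rgt in Hyx. destruct Hyx as [Y1 Y2]. specialize (K y Hy Y1).
  rewrite Cnorm_Cmod in *.
  change (Cmod (f y - f x - RtoC (y - x) * d x)%C <= 1 * Rabs (y - x)) in K.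
  change (Cmod (f y - f x)%C < eps).
  pose proof (Cmod_le_plus_minus (f y - f x)%C (RtoC (y - x) * d x)%C) as T.
  rewrite Cmod_mult, Cmod_R in T. apply Rlt_gt, Rlt_div_r in Y2; [|lra].
  pose proof (Rabs_pos (y - x)). nra.
Qed.

Lemma lac_deriv_chain (a b : R) (k : ext_nat) :
  deriv_chain a b k (fun t => lac_fun (Cexp_i t)) (fun l t => RtoC (lac l t)).
Proof.
  split; [|split].
  - intros t _. rewrite lac_fun_circle. reflexivity.
  - intros l _. apply (cont_within_of_deriv a b _ (fun x => RtoC (lac (S l) x))).
    intros x _. apply lac_has_deriv_within.
  - intros l _ t _. apply lac_has_deriv_within.
Qed.

Lemma near_plus_lac (a b : R) (k : ext_nat) (N : nat) (eps : R) (u : C -> C) : a < b -> Ck a b k u -> 0 < eps ->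
  exists tau0, 0 < tau0 /\ forall tau, 0 < tau < tau0 ->
    Ck a b k (fun z => u z + RtoC tau * lac_fun z)%C /\
    near a b k N eps u (fun z => u z + RtoC tau * lac_fun z)%C.
Proof.
  intros Hab [du Hdu] Heps.
  assert (HB : exists B, 0 < B /\ forall l, (l <= N)%nat -> lac_sup l <= B).
  { induction N as [|N [B [HB1 HB2]]].
    - exists (Rmax 1 (lac_sup 0)). split. pose proof (Rmax_l 1 (lac_sup 0)); lra.
      intros l Hl. replace l with O by lia. apply Rmax_r.
    - exists (Rmax B (lac_sup (S N))). split. pose proof (Rmax_l B (lac_sup (S N))); lra.
      intros l Hl. destruct (Nat.eq_dec l (S N)) as [->|]. apply Rmax_r.
      eapply Rle_trans; [apply HB2; lia | apply Rmax_l]. }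
  destruct HB as [B [HB1 HB2]].
  exists (eps / B). split. { apply Rdiv_lt_0_compat; auto. }
  intros tau [Ht1 Ht2]. apply Rlt_div_r in Ht2; auto.
  pose proof (deriv_chain_plus_scal a b k _ _ _ _ tau Hdu (lac_deriv_chain a b k)) as Hv.
  split. { eexists; exact Hv. }
  intros eu ev Heu Hev l Hl HlN t Ht.
  rewrite (deriv_chain_unique a b k _ eu du Hab Heu Hdu l Hl t Ht).
  rewrite (deriv_chain_unique a b k _ _ _ Hab Hev Hv l Hl t Ht).
  rewrite Cnorm_Cmod.
  replace (Csub _ _) with (- (RtoC (tau * lac l t)))%C.
  2:{ rewrite RtoC_mult. change (- (RtoC tau * RtoC (lac l t)) = du l t - (du l t + RtoC tau * RtoC (lac l t)))%C. ring. }
  rewrite Cmod_opp, Cmod_R, Rabs_mult, (Rabs_pos_eq tau) by lra.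
  pose proof (lac_bound l t). specialize (HB2 l HlN). pose proof (Rabs_pos (lac l t)). nra.
Qed.

(** Inside the circle the logarithmic coordinate replaces t by -t; evenness lets the same
    non-extension result serve both sides. *)
Lemma lac_even (t : R) : lac 0 (- t) = lac 0 t.
Proof. rewrite <- !lac_tail_0. apply lac_tail_even. Qed.

(** Two members of the pencil [u + tau * lac_fun] extended over the same
    rectangle would give an extension of [lac_fun] itself. *)
Lemma log_ext_pencil (s : bool) (d c M : R) (u : C -> C) (tau tau' : R) : 0 < d ->
  log_ext s false d c M (fun z => u z + RtoC tau * lac_fun z)%C ->
  log_ext s false d c M (fun z => u z + RtoC tau' * lac_fun z)%C -> tau = tau'.
Proof.
  intros Hd (L1 & (C1 & H1 & B1) & E1) (L2 & (C2 & H2 & B2) & E2).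
  apply NNPP. intros Hne.
  set (q := RtoC (/ (tau - tau'))).
  apply (lac_no_rect_ext d (sgn s * c) (Cmod q * (M + M)) (fun w => q * (L1 w - L2 w))%C); auto.
  - split; [|split].
    + intros w. apply (Ccont_mult (fun _ => q)). apply Ccont_const. apply Ccont_minus; auto.
    + intros w Hw. apply (holo_mult (fun _ => q)). apply holo_const. apply holo_minus; auto.
    + intros w Hw. rewrite Cmod_mult. apply Rmult_le_compat_l. apply Cmod_ge_0.
      unfold Cminus. eapply Rle_trans; [apply Cmod_triangle|]. rewrite Cmod_opp.
      specialize (B1 w Hw). specialize (B2 w Hw). lra.
  - intros x Hx. set (t := sgn s * x).
    assert (Ht : c - d <= t <= c + d) by (unfold t; destruct s; unfold sgn in *; lra).
    replace (0, x) with (0, sgn s * t) by (unfold t; rewrite <- Rmult_assoc, sgn_sq; f_equal; ring).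
    rewrite E1, E2 by auto. rewrite lac_fun_circle.
    replace (lac 0 x) with (lac 0 t).
    + unfold q. replace (u (Cexp_i t) + RtoC tau * RtoC (lac 0 t) -
        (u (Cexp_i t) + RtoC tau' * RtoC (lac 0 t)))%C
        with (RtoC (tau - tau') * RtoC (lac 0 t))%C by (rewrite RtoC_minus; ring).
      rewrite <- !RtoC_mult. f_equal. field. lra.
    + unfold t, sgn. destruct s. f_equal; ring. replace (-1 * x) with (- x) by ring. apply lac_even.
Qed.

(** Each [P i] holds at one point at most, hence misses one of the two outer closed thirds of any
    interval; nesting such thirds leaves a point outside all of them. *)
Lemma avoid_countable (P : nat -> R -> Prop) (l r : R) : l < r ->
  (forall i t t', P i t -> P i t' -> t = t') -> exists t, l < t < r /\ forall i, ~ P i t.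
Proof.
  intros Hlr HP.
  assert (Step : forall (n : nat) (I : R * R), exists J : R * R, fst I < snd I ->
    fst I <= fst J /\ snd J <= snd I /\ fst J < snd J /\ forall t, fst J <= t <= snd J -> ~ P n t).
  { intros n [x y]. simpl. set (w := (y - x) / 3).
    destruct (classic (exists t, x <= t <= x + w /\ P n t)) as [[t [Ht Hp]]|Hn].
    - exists (x + 2 * w, y). simpl. intros Hxy. unfold w in *. split; [lra|split; [lra|split; [lra|]]].
      intros t' Ht' Hp'. pose proof (HP n t t' Hp Hp'). lra.
    - exists (x, x + w). simpl. intros Hxy. unfold w in *. split; [lra|split; [lra|split; [lra|]]].
      intros t' Ht' Hp'. apply Hn. exists t'. auto. }
  set (next := fun n I => proj1_sig (constructive_indefinite_description _ (Step n I))).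
  assert (Hnext : forall n I, fst I < snd I -> fst I <= fst (next n I) /\ snd (next n I) <= snd I /\
    fst (next n I) < snd (next n I) /\ forall t, fst (next n I) <= t <= snd (next n I) -> ~ P n t)
    by (intros n I; unfold next; exact (proj2_sig (constructive_indefinite_description _ (Step n I)))).
  (* Starting from the middle third keeps the limit strictly between l and r. *)
  set (I := fix I n := match n with O => (l + (r - l) / 3, r - (r - l) / 3) | S m => next m (I m) end).
  assert (HI : forall n, fst (I n) < snd (I n)).
  { induction n as [|n IH]. simpl; lra. apply (Hnext n (I n) IH). }
  destruct (nested_intervals (fun n => fst (I n)) (fun n => snd (I n))) as [t Ht].
  - intros n. apply (Hnext n (I n) (HI n)).
  - intros n. apply (Hnext n (I n) (HI n)).
  - intros n. left. apply HI.
  - exists t. split.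
    + specialize (Ht O). simpl in Ht. lra.
    + intros n. apply (Hnext n (I n) (HI n)). exact (Ht (S n)).
Qed.

(** * The countable family of closed sets *)

Definition exact_at (s both : bool) (a b : R) (p n : nat) (u : C -> C) : Prop :=
  let d := / (INR n + 1) in
  a <= node a b p n - d /\ node a b p n + d <= b /\ log_ext s both d (node a b p n) (INR n) u.

(** The sup-norm closure of [exact_at], closed by construction. Its elements extend at the same
    node, with a smaller rectangle and another bound. *)
Definition adherent_at (s both : bool) (a b : R) (p n : nat) (u : C -> C) : Prop :=
  forall eps, 0 < eps -> exists v, exact_at s both a b p n v /\
    forall t, a <= t <= b -> Cmod (u (Cexp_i t) - v (Cexp_i t))%C <= eps.

Lemma adherent_exact (s both : bool) (a b : R) (p n : nat) (u : C -> C) :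
  exact_at s both a b p n u -> adherent_at s both a b p n u.
Proof. intros H eps Heps. exists u. split; auto. intros t _. rewrite Cmod_minus_0. lra. Qed.

Lemma step_pos (n : nat) : 0 < / (INR n + 1).
Proof. apply Rinv_0_lt_compat. pose proof (pos_INR n). lra. Qed.

Lemma Ck_open_not_adherent (s both : bool) (a b : R) (k : ext_nat) (p n : nat) :
  Ck_open a b k (fun u => ~ adherent_at s both a b p n u).
Proof.
  intros u [du Hdu] Hu. unfold adherent_at in Hu. apply not_all_ex_not in Hu. destruct Hu as [eps Hu].
  apply imply_to_and in Hu. destruct Hu as [Heps Hu].
  (* The sets are closed already for the uniform norm, so the seminorm of order 0 suffices for every
     k. *)
  exists O, (eps / 2). split. lra. intros v [dv Hdv] Hnear Hv. apply Hu.
  destruct (Hv (eps / 2) ltac:(lra)) as (w & Hw & Hwv). exists w. split; auto. intros t Ht.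
  assert (Hl : le_ext 0 k) by (destruct k; simpl; auto; lia).
  specialize (Hnear du dv Hdu Hdv O Hl (le_n O) t Ht). rewrite Cnorm_Cmod in Hnear.
  rewrite (proj1 Hdu), (proj1 Hdv) in Hnear by auto.
  change (Cmod (u (Cexp_i t) - v (Cexp_i t))%C <= eps / 2) in Hnear.
  eapply Rle_trans; [apply (Cmod_minus_triangle _ (v (Cexp_i t)))|]. specialize (Hwv t Ht). lra.
Qed.

Lemma Ck_open_and (a b : R) (k : ext_nat) (O1 O2 : (C -> C) -> Prop) :
  Ck_open a b k O1 -> Ck_open a b k O2 -> Ck_open a b k (fun u => O1 u /\ O2 u).
Proof.
  intros H1 H2 u Hu [U1 U2]. destruct (H1 u Hu U1) as (N1 & e1 & He1 & K1). destruct (H2 u Hu U2) as (N2 & e2 & He2 & K2).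
  exists (N1 + N2)%nat, (Rmin e1 e2). split. apply Rmin_glb_lt; auto.
  intros v Hv Hn. split; [apply K1 | apply K2]; auto; intros du dv Hdu Hdv l Hl HlN t Ht;
  (eapply Rle_trans; [apply (Hn du dv Hdu Hdv l Hl ltac:(lia) t Ht)|]). apply Rmin_l. apply Rmin_r.
Qed.

Lemma adherent_extends (s both : bool) (a b : R) (p n : nat) (u : C -> C) :
  adherent_at s both a b p n u -> a <= node a b p n <= b /\
  exists r (lam : C -> C), 0 < r /\ (forall z, Ccont lam z) /\
    (forall z, Cmod (z - Cexp_i (node a b p n))%C < r -> on_side s both z -> holo lam z) /\
    (forall z, Cmod (z - Cexp_i (node a b p n))%C < r -> Cmod z = 1 -> lam z = u z).
Proof.
  intros H. pose proof (step_pos n) as Hd.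
  destruct (H 1 ltac:(lra)) as (v0 & (A & B & _) & _). split. lra.
  destruct (log_ext_closure s both (/ (INR n + 1)) (node a b p n) (INR n) u Hd) as [M HM].
  - intros eps Heps. destruct (H eps Heps) as (v & (_ & _ & Hv) & E). exists v. split; auto.
    intros t Ht. apply E. lra.
  - apply (extends_near_of_log_ext s both (/ (INR n + 1) / 16) (node a b p n) M); auto. lra.
Qed.

(** The excluded parameters are counted over both sides together, so one perturbation defeats the
    extensions on either side at every point. *)
Lemma dense_no_extension (a b : R) (k : ext_nat) (u : C -> C) (N : nat) (eps : R) : a < b -> Ck a b k u -> 0 < eps ->
  exists v, Ck a b k v /\ near a b k N eps u v /\
    forall s z0, inI a b z0 -> ~ extends_near s false a b z0 v.
Proof.
  intros Hab Hu Heps. destruct (near_plus_lac a b k N eps u Hab Hu Heps) as (tau0 & Ht0 & Hnear).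
  (* A surjection of the integers onto triples (side, p, n): j = 0 codes the exterior, every other j
     the interior. *)
  set (code := fun i => let '(j, q) := Cantor.of_nat i in let '(p, n) := Cantor.of_nat q in
    (match j with O => true | S _ => false end, p, n)).
  destruct (avoid_countable (fun i tau => let '(s, p, n) := code i in
    exact_at s false a b p n (fun z => u z + RtoC tau * lac_fun z)%C) 0 tau0 Ht0) as (tau & Htau & Hav).
  - intros i t t'. destruct (code i) as [[s p] n]. intros (_ & _ & H1) (_ & _ & H2).
    exact (log_ext_pencil s _ _ _ u t t' (step_pos n) H1 H2).
  - destruct (Hnear tau Htau) as [H1 H2].
    exists (fun z => u z + RtoC tau * lac_fun z)%C. split; [exact H1 | split; [exact H2|]].
    intros s z0 Hz0 Hext.
    destruct (log_ext_of_extends_near s false a b z0 _ ltac:(discriminate) Hab Hz0 Hext) as (p & n & Hpn).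
    apply (Hav (Cantor.to_nat ((if s then O else 1%nat), Cantor.to_nat (p, n)))).
    unfold code. rewrite !Cantor.cancel_of_to. destruct s; exact Hpn.
Qed.

(** An extension at any z0 puts u in some [exact_at], perhaps at another node, and adherence gives
    back an extension at that node. Since all points of I are quantified over, the change of point
    is harmless, and extending somewhere is the same as lying in one of the countably many closed
    sets. *)
Lemma Gdelta_not_extendable (s both : bool) (a b : R) (k : ext_nat) (Ext : C -> (C -> C) -> Prop) :
  a < b -> (both = true -> s = true) ->
  (forall z0 u, inI a b z0 -> Ext z0 u -> extends_near s both a b z0 u) ->
  (forall p n u, adherent_at s both a b p n u -> Ext (Cexp_i (node a b p n)) u) ->
  exists O : nat -> (C -> C) -> Prop, (forall i, Ck_open a b k (O i)) /\
    forall u, (forall z0, inI a b z0 -> ~ Ext z0 u) <-> forall i, O i u.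
Proof.
  intros Hab Hsb H1 H2.
  exists (fun i u => let '(p, n) := Cantor.of_nat i in ~ adherent_at s both a b p n u). split.
  - intros i. destruct (Cantor.of_nat i) as [p n]. apply Ck_open_not_adherent.
  - intros u. split.
    + intros H i. destruct (Cantor.of_nat i) as [p n]. intros Had.
      apply (H (Cexp_i (node a b p n))); auto. exists (node a b p n). split; auto.
      apply (adherent_extends s both a b p n u Had).
    + intros H z0 Hz0 Hext.
      destruct (log_ext_of_extends_near s both a b z0 u Hsb Hab Hz0 (H1 z0 u Hz0 Hext)) as (p & n & Hpn).
      specialize (H (Cantor.to_nat (p, n))). rewrite Cantor.cancel_of_to in H. apply H.
      apply adherent_exact. exact Hpn.
Qed.

(** * Passage to the extensions used in the definitions of the classes *)

Lemma extends_near_one_side (a b : R) (z0 : C) (u : C -> C) :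
  extends_near true true a b z0 u -> extends_near true false a b z0 u.
Proof.
  intros (r & lam & Hr & Hc & Hh & He). exists r, lam. split; [auto|split; [|split; auto]].
  - intros z Hz _ eps Heps. destruct (Hc z Hz (or_intror (or_introl eq_refl)) eps Heps) as [d [Hd Hd']].
    exists d. split; auto. intros w Hw _ Hwz. apply Hd'; auto. right. left. reflexivity.
  - intros z Hz _. apply Hh; auto. left. reflexivity.
Qed.

Lemma cont_on_Ccont (S : C -> Prop) (f : C -> C) : (forall z, Ccont f z) -> cont_on S f.
Proof.
  intros H z _ eps Heps. destruct (H z eps Heps) as [d [Hd Hd']]. exists d. split; auto.
  intros w _ Hw. rewrite Cnorm_Cmod in *. apply Hd'. exact Hw.
Qed.

Lemma holo_on_iff (S : C -> Prop) (f : C -> C) : holo_on S f <-> forall z, S z -> holo f z.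
Proof.
  split.
  - intros H z Hz. destruct (H z Hz) as [f' Hf']. apply (holo_of_deriv f z f'). intros eps Heps.
    destruct (Hf' eps Heps) as [d [Hd Hd']]. exists d. split; auto. intros w Hw. specialize (Hd' w).
    rewrite !Cnorm_Cmod in Hd'. apply Hd'. exact Hw.
  - intros H z Hz. destruct (deriv_of_holo f z (H z Hz)) as [f' Hf']. exists f'. intros eps Heps.
    destruct (Hf' eps Heps) as [d [Hd Hd']]. exists d. split; auto. intros w Hw.
    rewrite !Cnorm_Cmod in *. apply Hd'. exact Hw.
Qed.

Lemma inD_iff (z0 : C) (r : R) (z : C) : inD z0 r z <-> Cmod (z - z0)%C < r.
Proof. unfold inD. rewrite Cnorm_Cmod. reflexivity. Qed.

Definition one_sided_ext (s : bool) (a b : R) (z0 : C) (u : C -> C) : Prop :=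
  let region := if s then inOmega else inP in
  exists r (lam : C -> C), 0 < r /\
    cont_on (fun z => inI a b z \/ region z0 r z) lam /\
    holo_on (region z0 r) lam /\
    (forall z, inD z0 r z -> inI a b z -> lam z = u z).

Lemma one_sided_region_iff (s : bool) (z0 : C) (r : R) (z : C) :
  (if s then inOmega else inP) z0 r z <-> Cmod (z - z0)%C < r /\ on_side s false z.
Proof.
  unfold on_side, inOmega, inP. destruct s; rewrite inD_iff, Cnorm_Cmod; intuition discriminate.
Qed.

Lemma one_sided_ext_extends (s : bool) (a b : R) (z0 : C) (u : C -> C) :
  one_sided_ext s a b z0 u -> extends_near s false a b z0 u.
Proof.
  intros (r & lam & Hr & Hc & Hh & He). exists r, lam. split; [auto|split; [|split]].
  - intros z Hz Hz' eps Heps. destruct (Hc z) with (eps := eps) as [d [Hd Hd']]; auto.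
    { destruct Hz'; auto. right. apply one_sided_region_iff. auto. }
    exists d. split; auto. intros w Hw Hw' Hwz. specialize (Hd' w). rewrite !Cnorm_Cmod in Hd'. apply Hd'; auto.
    destruct Hw'; auto. right. apply one_sided_region_iff. auto.
  - intros z Hz Hz'. rewrite holo_on_iff in Hh. apply Hh. apply one_sided_region_iff. auto.
  - intros z Hz Hz'. apply He; auto. apply inD_iff; auto.
Qed.

(** The classes ask for continuity on all of I, also far from the node. It holds because the
    truncated logarithm and the clamped rectangle function make the extension continuous on the
    whole plane. *)
Lemma adherent_one_sided_ext (s : bool) (a b : R) (p n : nat) (u : C -> C) :
  adherent_at s false a b p n u -> one_sided_ext s a b (Cexp_i (node a b p n)) u.
Proof.
  intros H. destruct (adherent_extends s false a b p n u H) as (_ & r & lam & Hr & Hc & Hh & He).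
  exists r, lam. split; [auto|split; [|split]].
  - apply cont_on_Ccont; auto.
  - apply holo_on_iff. intros z Hz. apply one_sided_region_iff in Hz. apply Hh; tauto.
  - intros z Hz HI. apply inD_iff in Hz. apply He; auto. apply (inI_Cmod a b); auto.
Qed.

Definition two_sided_ext (a b : R) (z0 : C) (u : C -> C) : Prop :=
  exists r (F : C -> C), 0 < r /\ holo_on (inD z0 r) F /\
    (forall z, inD z0 r z -> inI a b z -> F z = u z).

Lemma two_sided_ext_extends (a b : R) (z0 : C) (u : C -> C) :
  two_sided_ext a b z0 u -> extends_near true true a b z0 u.
Proof.
  intros (r & F & Hr & Hh & He). rewrite holo_on_iff in Hh. exists r, F. split; [auto|split; [|split]].
  - intros z Hz _ eps Heps. destruct (holo_Ccont F z (Hh z (proj2 (inD_iff _ _ _) Hz)) eps Heps) as [d [Hd Hd']].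
    exists d. auto.
  - intros z Hz _. apply Hh, inD_iff; auto.
  - intros z Hz Hz'. apply He; auto. apply inD_iff; auto.
Qed.

Lemma adherent_two_sided_ext (a b : R) (p n : nat) (u : C -> C) :
  adherent_at true true a b p n u -> two_sided_ext a b (Cexp_i (node a b p n)) u.
Proof.
  intros H. destruct (adherent_extends true true a b p n u H) as (_ & r & lam & Hr & _ & Hh & He).
  exists r, lam. split; [auto|split].
  - apply holo_on_iff. intros z Hz. apply inD_iff in Hz. apply Hh; auto. left. reflexivity.
  - intros z Hz HI. apply inD_iff in Hz. apply He; auto. apply (inI_Cmod a b); auto.
Qed.

Theorem theorem4p7 (a b : R) (k : ext_nat) (hab : 0 <= a < b) (hb : b <= 2 * PI) :
  dense_Gdelta_in_Ck a b k (U2 a b k) /\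
  dense_Gdelta_in_Ck a b k (U3 a b k) /\
  dense_Gdelta_in_Ck a b k (U4 a b k) /\
  dense_Gdelta_in_Ck a b k (U5 a b k).
Proof.
  assert (Hab : a < b) by lra.
  destruct (Gdelta_not_extendable true false a b k (one_sided_ext true a b) Hab ltac:(discriminate))
    as (O2 & Op2 & E2).
  { intros z0 u _. apply one_sided_ext_extends. } { intros p n u. apply adherent_one_sided_ext. }
  destruct (Gdelta_not_extendable false false a b k (one_sided_ext false a b) Hab ltac:(discriminate))
    as (O3 & Op3 & E3).
  { intros z0 u _. apply one_sided_ext_extends. } { intros p n u. apply adherent_one_sided_ext. }
  destruct (Gdelta_not_extendable true true a b k (two_sided_ext a b) Hab ltac:(reflexivity))
    as (O5 & Op5 & E5).
  { intros z0 u _. apply two_sided_ext_extends. } { intros p n u. apply adherent_two_sided_ext. }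
  assert (F2 : forall u, Ck a b k u -> (U2 a b k u <-> forall i, O2 i u)).
  { intros u Hu. rewrite <- E2. unfold U2, U2_at. split.
    - intros [_ H] z0 Hz0. exact (proj2 (H z0 Hz0)).
    - intros H. split; auto. intros z0 Hz0. split; auto. exact (H z0 Hz0). }
  assert (F3 : forall u, Ck a b k u -> (U3 a b k u <-> forall i, O3 i u)).
  { intros u Hu. rewrite <- E3. unfold U3, U3_at. split.
    - intros [_ H] z0 Hz0. exact (proj2 (H z0 Hz0)).
    - intros H. split; auto. intros z0 Hz0. split; auto. exact (H z0 Hz0). }
  assert (F5 : forall u, Ck a b k u -> (U5 a b k u <-> forall i, O5 i u)).
  { intros u Hu. rewrite <- E5. unfold U5, U5_at. split.
    - intros [_ H] z0 Hz0. exact (proj2 (H z0 Hz0)).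
    - intros H. split; auto. intros z0 Hz0. split; auto. exact (H z0 Hz0). }
  assert (F4 : forall u, U4 a b k u <-> U2 a b k u /\ U3 a b k u).
  { intros u. unfold U4, U4_at, U2, U3. split.
    - intros [Hu H]. split; split; auto; intros z0 Hz0; apply (H z0 Hz0).
    - intros [[Hu H2] [_ H3]]. split; auto. }
  (* The same perturbed function lies in all the classes at once; membership in U5 comes from the
     exterior side, to which a two-sided extension restricts. *)
  assert (D : forall u, Ck a b k u -> forall N eps, 0 < eps ->
    exists v, Ck a b k v /\ (U2 a b k v /\ U3 a b k v /\ U5 a b k v) /\ near a b k N eps u v).
  { intros u Hu N eps Heps. destruct (dense_no_extension a b k u N eps Hab Hu Heps) as (v & Hv & Hn & Hno).
    exists v. split; [auto|split; [|auto]]. split; [|split].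
    - apply F2, E2; auto. intros z0 Hz0 H. apply (Hno true z0 Hz0). apply one_sided_ext_extends; auto.
    - apply F3, E3; auto. intros z0 Hz0 H. apply (Hno false z0 Hz0). apply one_sided_ext_extends; auto.
    - apply F5, E5; auto. intros z0 Hz0 H. apply (Hno true z0 Hz0).
      apply extends_near_one_side, two_sided_ext_extends; auto. }
  assert (G : forall A : (C -> C) -> Prop, (forall u, A u -> Ck a b k u) ->
    (forall v, U2 a b k v /\ U3 a b k v /\ U5 a b k v -> A v) -> Ck_Gdelta a b k A -> dense_Gdelta_in_Ck a b k A).
  { intros A HA HU HG. split; [auto|split; [|auto]]. intros u Hu N eps Heps.
    destruct (D u Hu N eps Heps) as (v & Hv & HvU & Hn). exists v. auto. }
  split; [|split; [|split]]; apply G.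
  - intros u [Hu _]; auto.
  - intros v Hv; apply Hv.
  - exists O2; auto.
  - intros u [Hu _]; auto.
  - intros v Hv; apply Hv.
  - exists O3; auto.
  - intros u [Hu _]; auto.
  - intros v Hv; apply F4; tauto.
  (* U4 is the intersection of U2 and U3, so intersecting their open sets index by index is
     enough. *)
  - exists (fun i u => O2 i u /\ O3 i u). split.
    + intros i. apply Ck_open_and; auto.
    + intros u Hu. rewrite F4, F2, F3 by auto. split.
      * intros [H2 H3] i. auto.
      * intros H. split; intros i; apply H.
  - intros u [Hu _]; auto.
  - intros v Hv; apply Hv.
  - exists O5; auto.
Qed.
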